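(* Let $\mathcal{D}=(d_1,\ldots,d_r)$ be positive integers and let $\mathrm{Fl}_{2\mathcal{D}}$ be the even real flag manifold $\mathrm{Fl}_{2\mathcal{D}}(\mathbb{R}^{2N})$, $N=\sum_i d_i$. Then $2\operatorname{Tor}(H^*(\mathrm{Fl}_{2\mathcal{D}};\mathbb{Z}))=0$, i.e. all torsion of $H^*(\mathrm{Fl}_{2\mathcal{D}};\mathbb{Z})$ is of order $2$. In particular, if $\beta$ denotes the Bockstein homomorphism and $H^*_{\mathrm{free}}$ denotes the free part, then $$H^*(\mathrm{Fl}_{2\mathcal{D}};\mathbb{Z})=H^*_{\mathrm{free}}(\mathrm{Fl}_{2\mathcal{D}};\mathbb{Z})\oplus \operatorname{Im}\beta .$$
   Context: $\mathrm{Fl}_{2\mathcal{D}}(\mathbb{R}^{2N})$ is the manifold of flags $F_1\subset\cdots\subset F_r=\mathbb{R}^{2N}$ of real subspaces with $\dim F_i=2(d_1+\cdots+d_i)$. $\operatorname{Tor}$ denotes the torsion subgroup. $\beta:H^{*-1}(X;\mathbb{F}_2)\to H^{*}(X;\mathbb{Z})$ is the Bockstein homomorphism of the coefficient sequence $0\to\mathbb{Z}\xrightarrow{2}\mathbb{Z}\to\mathbb{F}_2\to0$. The free part is a free complement (as graded abelian groups) of the torsion subgroup; the direct sum is additive. *)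

(* Defs.v *)
From HB Require Import structures.
From mathcomp Require Import all_boot all_order all_algebra.
From mathcomp Require Import all_classical all_reals all_analysis.
From mathcomp Require Import zify.

Set Implicit Arguments.
Unset Strict Implicit.
Unset Printing Implicit Defensive.

Import Order.TTheory GRing.Theory Num.Theory.
Import numFieldNormedType.Exports.

Local Open Scope classical_set_scope.
Local Open Scope ring_scope.
Local Open Scope quotient_scope.

Definition stdsimplex (R : realType) (n : nat) : set 'rV[R]_n.+1 :=
  [set t | (forall i, 0 <= t ord0 i) /\ \sum_i t ord0 i = 1].

Arguments stdsimplex : clear implicits.

Definition singular (R : realType) (X : topologicalType) (n : nat) :=
  continuousType (stdsimplex R n) X.

Section Faces.
Context {R : realType}.

Definition insert0 n (i : 'I_n.+2) (t : 'rV[R]_n.+1) : 'rV[R]_n.+2 :=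
  \row_j (if unlift i j is Some k then t ord0 k else 0).

Lemma insert0_simplex n (i : 'I_n.+2) (t : stdsimplex R n) :
  insert0 i (set_val t) \in stdsimplex R n.+1.
Proof.
apply/mem_set; case: t => t tP /=; move/set_mem: (tP) => [t0 t1].
rewrite set_valE /=; split=> [j|].
  by rewrite mxE; case: unliftP => [k _|_].
rewrite (bigD1_ord i) //= mxE unlift_none add0r -[RHS]t1.
by apply: eq_bigr => k _; rewrite mxE liftK.
Qed.

Definition face n (i : 'I_n.+2) (t : stdsimplex R n) : stdsimplex R n.+1 :=
  SigSub (insert0_simplex i t).

Lemma insert0_continuous n (i : 'I_n.+2) : continuous (insert0 i).
Proof.
move=> t A [P Pt PA].
exists (fun _ l => P ord0 (lift i l)) => [a l|s Ps].
  by have := Pt ord0 (lift i l); rewrite mxE liftK (ord1 a).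
apply: PA => a k; rewrite (ord1 a) mxE; case: unliftP => [l ->|ik].
  exact: Ps.
by have := nbhs_singleton (Pt ord0 k); rewrite mxE ik unlift_none.
Qed.

Lemma face_continuous n (i : 'I_n.+2) : continuous (@face n i).
Proof.
apply: (@continuous_comp_initial _ _ _ set_val (@face n i)).
move=> t; apply: (@continuous_comp _ _ _ set_val (insert0 i)).
  exact: initial_continuous.
exact: insert0_continuous.
Qed.

HB.instance Definition _ n (i : 'I_n.+2) :=
  isContinuous.Build (stdsimplex R n) (stdsimplex R n.+1) (@face n i)
    (@face_continuous n i).

Lemma insert0_lift n (i : 'I_n.+2) (t : 'rV[R]_n.+1) k :
  insert0 i t ord0 (lift i k) = t ord0 k.
Proof. by rewrite mxE liftK. Qed.

Lemma insert0_id n (i : 'I_n.+2) (t : 'rV[R]_n.+1) : insert0 i t ord0 i = 0.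
Proof. by rewrite mxE unlift_none. Qed.

Lemma insert0_comm n (i i' : 'I_n.+3) (j j' : 'I_n.+2) (t : 'rV[R]_n.+1) :
  (j < i)%N -> i' = j :> nat -> j' = i.-1 :> nat ->
  insert0 i (insert0 j t) = insert0 i' (insert0 j' t).
Proof.
move=> ji ei' ej'.
have e1 : lift i j = i' by apply/val_inj; rewrite /= /bump; lia.
have e2 : lift i' j' = i by apply/val_inj; rewrite /= /bump; lia.
apply/rowP => m; case: (unliftP i m) => [m1 ->|->]; last first.
  by rewrite insert0_id -e2 insert0_lift insert0_id.
rewrite insert0_lift; case: (unliftP j m1) => [m2 ->|->]; last first.
  by rewrite insert0_id e1 insert0_id.
have -> : lift i (lift j m2) = lift i' (lift j' m2).
  by apply/val_inj; rewrite /= /bump; lia.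
by rewrite !insert0_lift.
Qed.

Lemma face_comm n (i i' : 'I_n.+3) (j j' : 'I_n.+2) :
  (j < i)%N -> i' = j :> nat -> j' = i.-1 :> nat ->
  face i \o face j = face i' \o face j'.
Proof.
move=> ji ei' ej'; apply/funext => t; apply/val_inj => /=.
by rewrite !set_valE /=; exact: insert0_comm.
Qed.

End Faces.

Definition cochain (R : realType) (X : topologicalType) (A : zmodType)
    (n : nat) : zmodType :=
  singular R X n -> A.

Section Cohomology.
Context {R : realType} {X : topologicalType} {A : zmodType}.

(* (-1)^i is an integer acting on the abelian group A. *)
Definition coboundary n (c : cochain R X A n) : cochain R X A n.+1 :=
  fun s => \sum_(i < n.+2) c (s \o face i) *~ (-1) ^+ i.

Lemma coboundary_is_zmod_morphism n : zmod_morphism (@coboundary n).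
Proof.
move=> b c; apply/funext => s.
transitivity (coboundary b s - coboundary c s); last by [].
rewrite /coboundary -sumrB.
by apply: eq_bigr => i _; rewrite -mulrzBl.
Qed.

HB.instance Definition _ n := GRing.isZmodMorphism.Build
  (cochain R X A n) (cochain R X A n.+1) (@coboundary n)
  (@coboundary_is_zmod_morphism n).

Lemma coboundaryK n (c : cochain R X A n) : coboundary (coboundary c) = 0.
Proof.
apply/funext => s; rewrite /coboundary.
pose F (p : 'I_n.+3 * 'I_n.+2) : A :=
  c ((s \o face p.1) \o face p.2) *~ (-1) ^+ (p.1 + p.2).
transitivity (\sum_p F p).
  rewrite -(pair_bigA _ (fun i j => F (i, j))) /=; apply: eq_bigr => i _.
  rewrite mulrz_suml; apply: eq_bigr => j _.
  by rewrite /F /= -mulrzA exprD mulrC.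
pose h (p : 'I_n.+3 * 'I_n.+2) : 'I_n.+3 * 'I_n.+2 :=
  (inord p.2.+1, inord p.1).
pose h' (p : 'I_n.+3 * 'I_n.+2) : 'I_n.+3 * 'I_n.+2 :=
  (inord p.2, inord p.1.-1).
rewrite (bigID (fun p : 'I_n.+3 * 'I_n.+2 => p.2 < p.1)%N) /=.
rewrite (reindex_onto h h') /=; last first.
  move=> [i j] /= ji; have li := ltn_ord i; have lj := ltn_ord j.
  have e1 : (inord i.-1 : 'I_n.+2) = i.-1 :> nat by rewrite inordK; lia.
  have e2 : (inord j : 'I_n.+3) = j :> nat by rewrite inordK; lia.
  by rewrite /h /h' /= e1 e2; congr pair; apply/ord_inj; rewrite inordK; lia.
rewrite [X in X + _](eq_bigl (fun p : 'I_n.+3 * 'I_n.+2 => ~~ (p.2 < p.1)%N));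
  last first.
  move=> [i j] /=; have li := ltn_ord i; have lj := ltn_ord j.
  have e1 : (inord j.+1 : 'I_n.+3) = j.+1 :> nat by rewrite inordK; lia.
  rewrite -leqNgt e1; apply/andP/idP => [[H1 /eqP [E1 E2]]|ij].
    have := congr1 (@nat_of_ord n.+3) E1.
    by rewrite inordK ?ltnS //; [lia | exact: ltnW].
  have e2 : (inord i : 'I_n.+2) = i :> nat by rewrite inordK; lia.
  split; first by rewrite e2; lia.
  by rewrite /h /h' /= e1 e2; apply/eqP; congr pair; apply/ord_inj;
    rewrite inordK; lia.
rewrite -big_split /= big1 // => -[i j] /=; rewrite -leqNgt => ij.
have li := ltn_ord i; have lj := ltn_ord j.
have e1 : (inord j.+1 : 'I_n.+3) = j.+1 :> nat by rewrite inordK.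
have e2 : (inord i : 'I_n.+2) = i :> nat by rewrite inordK //; lia.
rewrite /F /= e1 e2.
have -> : ((s \o face (inord j.+1)) \o face (inord i) : singular R X n) =
          ((s \o face i) \o face j : singular R X n).
  apply/continuousEP => t /=; congr (s _).
  have := @face_comm R n (inord j.+1) i (inord i) j.
  rewrite e1 e2 => /(_ ij erefl erefl)/(congr1 (fun f => f t)) /=; exact.
by rewrite addSn addnC exprS mulN1r mulrNz addNr.
Qed.

Definition cocycles n : {pred cochain R X A n} :=
  fun c => `[< coboundary c = 0 >].

Lemma cocycles_zmod_closed n : zmod_closed (@cocycles n).
Proof.
split=> [|b c /asboolP b0 /asboolP c0]; apply/asboolP; first exact: raddf0.
by rewrite raddfB /= b0 c0 subr0.
Qed.

HB.instance Definition _ n :=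
  GRing.isZmodClosed.Build (cochain R X A n) (@cocycles n)
    (@cocycles_zmod_closed n).

Record cocycle n := Cocycle {
  cocycle_val :> cochain R X A n;
  cocycle_valP : cocycle_val \in @cocycles n }.

HB.instance Definition _ n := [isSub for @cocycle_val n].
HB.instance Definition _ n := [Choice of cocycle n by <:].
HB.instance Definition _ n :=
  [SubChoice_isSubZmodule of cocycle n by <:].

Definition coboundaries n : set (cochain R X A n) :=
  match n with
  | 0 => [set 0]
  | m.+1 => range (@coboundary m)
  end.

Definition exact_cocycles n : {pred cocycle n} :=
  fun z => `[< coboundaries (cocycle_val z) >].

Lemma exact_cocycles_zmod_closed n : zmod_closed (@exact_cocycles n).
Proof.
case: n => [|n]; split.
- exact/asboolP.
- move=> y z /asboolP y0 /asboolP z0; apply/asboolP.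
  by rewrite /= y0 z0 subr0.
- by apply/asboolP; exists 0 => //; rewrite raddf0.
- move=> y z /asboolP[b _ yb] /asboolP[c _ zc]; apply/asboolP.
  by exists (b - c) => //; rewrite raddfB /= yb zc.
Qed.

HB.instance Definition _ n :=
  GRing.isZmodClosed.Build (cocycle n) (@exact_cocycles n)
    (@exact_cocycles_zmod_closed n).

End Cohomology.

Arguments cocycle : clear implicits.
Arguments exact_cocycles : clear implicits.

Definition cohomology (R : realType) (X : topologicalType) (A : zmodType)
    (n : nat) : zmodType :=
  @Quotient.quot (cocycle R X A n) (exact_cocycles R X A n).

Definition cohomology_class (R : realType) (X : topologicalType)
    (A : zmodType) (n : nat) (z : cocycle R X A n) : cohomology R X A n :=
  \pi_(@Quotient.quot (cocycle R X A n) (exact_cocycles R X A n)) z.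

Lemma cohomology_class_is_zmod_morphism (R : realType) (X : topologicalType)
    (A : zmodType) (n : nat) : zmod_morphism (@cohomology_class R X A n).
Proof. by move=> y z; rewrite /cohomology_class raddfB. Qed.

HB.instance Definition _ (R : realType) (X : topologicalType)
    (A : zmodType) (n : nat) :=
  GRing.isZmodMorphism.Build (cocycle R X A n) (cohomology R X A n)
    (@cohomology_class R X A n) (@cohomology_class_is_zmod_morphism R X A n).

Lemma cohomology_class_eq0 (R : realType) (X : topologicalType)
    (A : zmodType) (n : nat) (z : cocycle R X A n) :
  (cohomology_class z == 0) = (z \in exact_cocycles R X A n).
Proof. by rewrite -[z in RHS]subr0 Quotient.idealrBE raddf0. Qed.

Section Bockstein.
Context {R : realType} {X : topologicalType}.

Definition reduce2 n (c : cochain R X int n) : cochain R X 'F_2 n :=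
  fun s => (c s)%:~R.

Definition lift2 n (c : cochain R X 'F_2 n) : cochain R X int n :=
  fun s => (c s : nat)%:Z.

Lemma lift2K n : cancel (@lift2 n) (@reduce2 n).
Proof. by move=> c; apply/funext => s; rewrite /reduce2 /lift2 -pmulrn natr_Zp. Qed.

Lemma reduce2_eq0 n (c : cochain R X int n) :
  reduce2 c = 0 -> c = (fun s => (c s %/ 2)%Z : int) *+ 2.
Proof.
move=> c0; apply/funext => s; rewrite mulr2n.
have /eqP : reduce2 c s = 0 by rewrite c0.
rewrite -(dvdz_pcharf (pchar_Fp (isT : prime 2))) => /divzK cE.
by rewrite -[LHS]cE (_ : 2 = 1 + 1 :> int) // mulrDr mulr1.
Qed.

Lemma mulr2_cochain_inj n : injective (fun c : cochain R X int n => c *+ 2).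
Proof.
move=> b c /= bc; apply/funext => s.
have := congr1 (fun f => f s) bc; rewrite !mulr2n /= => H.
change (b s + b s = c s + c s) in H; lia.
Qed.

Lemma reduce2_is_zmod_morphism n : zmod_morphism (@reduce2 n).
Proof. by move=> b c; apply/funext => s; exact: rmorphB. Qed.

HB.instance Definition _ n := GRing.isZmodMorphism.Build
  (cochain R X int n) (cochain R X 'F_2 n) (@reduce2 n)
  (@reduce2_is_zmod_morphism n).

Lemma reduce2_coboundary n (c : cochain R X int n) :
  reduce2 (coboundary c) = coboundary (reduce2 c).
Proof.
apply/funext => s; rewrite /reduce2 /coboundary rmorph_sum /=.
by apply: eq_bigr => i _; exact: raddfMz.
Qed.

Definition bockstein_cochain n (c : cochain R X 'F_2 n) :
    cochain R X int n.+1 :=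
  fun s => (coboundary (lift2 c) s %/ 2)%Z.

Lemma bockstein_cochainE n (z : cocycle R X 'F_2 n) :
  bockstein_cochain z *+ 2 = coboundary (lift2 z).
Proof.
rewrite -reduce2_eq0 // reduce2_coboundary lift2K.
exact/asboolP/cocycle_valP.
Qed.

Lemma bockstein_cochain_cocycle n (z : cocycle R X 'F_2 n) :
  bockstein_cochain z \in cocycles (n := n.+1).
Proof.
apply/asboolP/mulr2_cochain_inj => /=.
by rewrite -raddfMn bockstein_cochainE mul0rn; exact: coboundaryK.
Qed.

(* The connecting homomorphism of 0 -> Z -2-> Z -> F_2 -> 0: lift a mod 2
   cocycle to an integral cochain, and halve the coboundary of the lift. The
   choices of representative and lift are immaterial by bocksteinE. *)
Definition bockstein n (x : cohomology R X 'F_2 n) :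
    cohomology R X int n.+1 :=
  cohomology_class (Cocycle (bockstein_cochain_cocycle (repr x))).

Lemma exact_cocycle_lift n (z : cocycle R X 'F_2 n) :
  z \in exact_cocycles R X 'F_2 n ->
  exists2 b : cochain R X int n, coboundary b = 0 & reduce2 b = z.
Proof.
case: n z => [|n] z /asboolP /= => [->|[c _ <-]].
  by exists 0; rewrite raddf0.
exists (coboundary (lift2 c)); first exact: coboundaryK.
by rewrite reduce2_coboundary lift2K.
Qed.

Lemma bocksteinE n (z : cocycle R X 'F_2 n) (c : cochain R X int n)
    (e : cocycle R X int n.+1) :
  reduce2 c = z -> coboundary c = cocycle_val e *+ 2 ->
  bockstein (cohomology_class z) = cohomology_class e.
Proof.
move=> cz ce; apply/eqP.
rewrite -subr_eq0 -raddfB /= cohomology_class_eq0; set w := repr _.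
have /exact_cocycle_lift[b b0 bwz] : w - z \in exact_cocycles R X 'F_2 n.
  rewrite -cohomology_class_eq0 raddfB /= subr_eq0.
  by rewrite [cohomology_class w]reprK.
have /reduce2_eq0 : reduce2 (lift2 w - c - b) = 0.
  by rewrite !raddfB /= lift2K bwz cz; exact: subrr.
set a : cochain R X int n := fun s => _ => wa.
apply/asboolP; exists a => //; apply: mulr2_cochain_inj => /=.
by rewrite -raddfMn -wa !raddfB /= b0 subr0 ce -bockstein_cochainE
  -mulrnBl.
Qed.

Lemma bockstein_is_zmod_morphism n : zmod_morphism (@bockstein n).
Proof.
move=> x y; rewrite -[x in LHS]reprK -[y in LHS]reprK.
rewrite /(bockstein x) /(bockstein y) -!/(cohomology_class _) -!raddfB.
apply: (bocksteinE (c := lift2 (repr x) - lift2 (repr y))).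
  by rewrite raddfB /= !lift2K.
by rewrite !raddfB /= mulrnBl !bockstein_cochainE.
Qed.

HB.instance Definition _ n := GRing.isZmodMorphism.Build
  (cohomology R X 'F_2 n) (cohomology R X int n.+1) (@bockstein n)
  (@bockstein_is_zmod_morphism n).

End Bockstein.

(* In degree 0 the source H^-1(X; F_2) of the Bockstein vanishes. *)
Definition bockstein_image (R : realType) (X : topologicalType) (n : nat) :
    set (cohomology R X int n) :=
  match n with
  | 0 => [set 0]
  | m.+1 => range (@bockstein R X m)
  end.
Arguments bockstein_image : clear implicits.

Section AbelianGroups.
Context {V : zmodType}.
Implicit Types F G B : set V.

Definition torsion : set V := [set x | exists2 m, (0 < m)%N & x *+ m = 0].

Definition is_subgroup G := G 0 /\ forall x y, G x -> G y -> G (x - y).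

Definition is_direct_sum F G :=
  [/\ is_subgroup F, is_subgroup G, F `&` G = [set 0] &
      forall x, exists y z, [/\ F y, G z & x = y + z]].

Definition is_basis F B :=
  [/\ B `<=` F,
      forall (s : seq V) (c : V -> int), uniq s -> [set` s] `<=` B ->
        \sum_(b <- s) b *~ c b = 0 -> forall b, b \in s -> c b = 0 &
      forall x, F x -> exists (s : seq V) (c : V -> int),
        [set` s] `<=` B /\ x = \sum_(b <- s) b *~ c b].

Definition is_free_part F :=
  (exists B, is_basis F B) /\ is_direct_sum F torsion.

End AbelianGroups.

Arguments torsion : clear implicits.

Section Flags.
Context {R : realType} {r : nat} (d : 'I_r -> nat).

Definition flag_rank (i : 'I_r) : nat := (2 * \sum_(j < r | (j <= i)%N) d j)%N.

Definition flag_ambient : nat := (2 * \sum_(j < r) d j)%N.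

(* F_1 <= ... <= F_r in R^(2N), with dim F_i = 2(d_1 + ... + d_i); vectors
   are rows. F_r is the whole space by dimension. *)
Record even_flag := EvenFlag {
  flag_space : 'I_r -> {vspace 'rV[R]_flag_ambient};
  flag_nested : forall i j : 'I_r, (i <= j)%N ->
    (flag_space i <= flag_space j)%VS;
  flag_dim : forall i, \dim (flag_space i) = flag_rank i }.

HB.instance Definition _ := gen_eqMixin even_flag.
HB.instance Definition _ := gen_choiceMixin even_flag.

Definition frames : set 'M[R]_flag_ambient := [set g | g \in unitmx].

Definition first_rows (g : 'M[R]_flag_ambient) (p : nat) :
    {vspace 'rV[R]_flag_ambient} :=
  <<[seq row k g | k : 'I_flag_ambient <- enum 'I_flag_ambient & (k < p)%N]>>%VS.

Lemma flag_rank_le i : (flag_rank i <= flag_ambient)%N.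
Proof.
rewrite leq_mul2l /=; rewrite [leqRHS](bigID (fun j : 'I_r => (j <= i)%N)) /=.
exact: leq_addr.
Qed.

Lemma flag_rank_mono (i j : 'I_r) :
  (i <= j)%N -> (flag_rank i <= flag_rank j)%N.
Proof.
move=> ij; rewrite leq_mul2l /=.
rewrite [leqRHS](bigID (fun k : 'I_r => (k <= i)%N)) /=.
rewrite (eq_bigl (fun k : 'I_r => (k <= j)%N && (k <= i)%N)) ?leq_addr // => k.
by case: (leqP k i) => ki; rewrite ?andbF // (leq_trans ki ij).
Qed.

Lemma first_rows_mono (g : 'M[R]_flag_ambient) p q :
  (p <= q)%N -> (first_rows g p <= first_rows g q)%VS.
Proof.
move=> pq; apply: sub_span => v /mapP[k + ->].
rewrite mem_filter => /andP[kp kI]; apply: map_f.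
by rewrite mem_filter (leq_trans kp pq).
Qed.

Lemma dim_first_rows (g : 'M[R]_flag_ambient) p :
  g \in unitmx -> (p <= flag_ambient)%N -> \dim (first_rows g p) = p.
Proof.
move=> gU pn.
rewrite /first_rows; set I := enum _; pose lt_p (k : 'I_flag_ambient) := (k < p)%N.
have sizeI : size [seq k <- I | lt_p k] = p.
  rewrite size_filter -[LHS]/(count (preim val (fun k => (k < p)%N)) I).
  rewrite -count_map val_enum_ord -size_filter.
  by rewrite (filter_iota_ltn 0 pn) size_iota.
have rows_free : free [seq row k g | k <- I].
  pose X := [tuple row k g | k < flag_ambient].
  have -> : [seq row k g | k <- I] = X :> seq _ by rewrite -[I]val_ord_tuple.
  apply/freeP => c cX0 i.
  have : (\row_k c k) *m g = 0.
    rewrite mulmx_sum_row -[RHS]cX0; apply: eq_bigr => k _.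
    by rewrite mxE -tnth_nth tnth_mktuple.
  move=> /(congr1 (mulmx^~ (invmx g))).
  by rewrite mulmxK // mul0mx => /rowP/(_ i); rewrite !mxE.
have /perm_free : perm_eq [seq row k g | k <- I]
    ([seq row k g | k <- [seq k <- I | lt_p k]] ++
     [seq row k g | k <- [seq k <- I | predC lt_p k]]).
  by rewrite -map_cat; apply: perm_map; rewrite perm_sym; apply/permPl/perm_filterC.
rewrite rows_free => /esym/catl_free/eqP.
by rewrite size_map sizeI.
Qed.

Definition flag_of_frame (g : frames) : even_flag :=
  @EvenFlag (fun i => first_rows (set_val g) (flag_rank i))
    (fun i j ij => first_rows_mono _ (flag_rank_mono ij))
    (fun i => dim_first_rows (set_mem (valP g)) (flag_rank_le i)).

(* The topology of the homogeneous space GL_2N(R) / P: the quotient topology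
   along the map sending a frame to the flag spanned by its initial segments. *)
Definition flag_open : set_system even_flag :=
  [set U | open (flag_of_frame @^-1` U)].

Lemma flag_openT : flag_open setT.
Proof. by rewrite /flag_open /= preimage_setT; exact: openT. Qed.

Lemma flag_openI : setI_closed flag_open.
Proof. by move=> U W oU oW; rewrite /flag_open /= preimage_setI; exact: openI. Qed.

Lemma flag_open_bigU (I : Type) (f : I -> set even_flag) :
  (forall i, flag_open (f i)) -> flag_open (\bigcup_i f i).
Proof.
move=> fo; rewrite /flag_open /= preimage_bigcup.
by apply: bigcup_open => i _; exact: fo.
Qed.

HB.instance Definition _ :=
  isOpenTopological.Build even_flag flag_openT flag_openI flag_open_bigU.

End Flags.

Arguments even_flag : clear implicits.

(* Main.v *)
(* Flags in R^n, n = 2N, are stratified by the Schubert cells of words phi in which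
   the letter i occurs 2 d_i times; the codimension of a cell is the number of
   inversions of its word. The cells of codimension a give Z-modules K^a of
   cellular cochains with basis the cells, and H^k embeds in the cokernel of the
   cellular differential K^(k-1) -> K^k, compatibly with maps preserving the cells.

   For m < N let t_m be the diagonal matrix with entries -1 at the positions 2m and
   2m+1. It is homotopic to the identity by a rotation of that coordinate plane, so
   it acts trivially on H^k, whereas it multiplies the basis element of phi by a
   sign eps_m(phi). The cellular differential commutes with all t_m, hence splits
   according to the characters eps. A class whose cellular representative has only
   coordinates with some eps_m = -1 is therefore killed by 2. If the two letters of
   some pair of positions 2m, 2m+1 differ, the first such m has eps_m(phi) = -1,
   since every letter occurs an even number of times; otherwise phi has an even
   number of inversions. So all coordinates with trivial character sit in even
   degrees, where no coboundary reaches them, and they define homomorphisms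
   H^k -> Z whose common kernel is killed by 2. This kernel is the torsion
   subgroup; it has a free complement, and it is the image of the Bockstein by
   exactness. *)
Require Import Defs.
From HB Require Import structures.
From mathcomp Require Import fingroup perm.
From mathcomp Require Import all_boot all_order all_algebra.
From mathcomp Require Import all_classical all_reals all_analysis.
From mathcomp Require Import zify ring lra.

Set Implicit Arguments.
Unset Strict Implicit.
Unset Printing Implicit Defensive.

Import Order.TTheory GRing.Theory Num.Theory.
Import numFieldNormedType.Exports.
Local Open Scope classical_set_scope.
Local Open Scope ring_scope.

(** * Subdivision and prisms of affine simplices *)

(** No cell structure on the flag manifold is constructed. A cell enters only through an open chart
    in which it is the zero locus of the inversion coordinates, and the filtration is by the open
    unions [W m] of the charts of codimension less than [m]. Over one chart the relative group is
    that of a coordinate space modulo the complement of a coordinate subspace: it is Z, in degree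
    the codimension, and a diagonal sign matrix acts on the generator by the product of the signs of
    the normal coordinates. This product is the origin of eps.

    Relative groups and exact sequences are never formed. A relative cochain is one that vanishes on
    a family of simplices, and each exactness argument is an explicit correction by a coboundary.
    The recurring obstacle is that a simplex of a union of open sets need not lie in one of them, so
    that cochains defined piecewise agree only on small simplices; [small_simplices] repairs this
    each time.

    The incidence numbers of the cellular differential are never computed: it is enough that they
    vanish between cells with different characters. *)

Section AffineCochains.
Context {R : realType} {A : zmodType}.

(** Cochains on affine simplices of R^N. A simplex is the matrix whose rows are its ordered
    vertices, degenerate ones included. *)
Definition acochain N m := 'M[R]_(m.+1, N) -> A.

Definition abd N m (e : acochain N m) : acochain N m.+1 :=
  fun M => \sum_(i < m.+2) e (row' i M) *~ (-1) ^+ i.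

Definition cone N m (b : 'rV[R]_N) (M : 'M[R]_(m.+1, N)) : 'M[R]_(m.+2, N) :=
  col_mx b M.

Definition coned N m (b : 'rV[R]_N) (e : acochain N m.+1) : acochain N m :=
  fun M => e (cone b M).

Lemma cone_lift N m b (M : 'M[R]_(m.+1, N)) i j : cone b M (lift ord0 i) j = M i j.
Proof.
have -> : lift ord0 i = rshift 1 i by apply/val_inj.
exact: col_mxEd.
Qed.

Lemma cone_ord0 N m b (M : 'M[R]_(m.+1, N)) j : cone b M ord0 j = b ord0 j.
Proof.
have -> : ord0 = lshift m.+1 (ord0 : 'I_1) by apply/val_inj.
exact: col_mxEu.
Qed.

Lemma row'_cone0 N m b (M : 'M[R]_(m.+1, N)) : row' ord0 (cone b M) = M.
Proof. by apply/matrixP => i j; rewrite mxE cone_lift. Qed.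

Lemma row'_coneS N m b (M : 'M[R]_(m.+2, N)) (i : 'I_m.+2) :
  row' (lift ord0 i) (cone b M) = cone b (row' i M).
Proof.
apply/matrixP => k j; rewrite mxE; case: (unliftP ord0 k) => [k' ->|->].
  have -> : lift (lift ord0 i) (lift ord0 k') = lift ord0 (lift i k').
    by apply/val_inj; rewrite /= /bump; lia.
  by rewrite !cone_lift mxE.
have -> : lift (lift ord0 i) ord0 = ord0 by apply/val_inj.
by rewrite !cone_ord0.
Qed.

Lemma row'_cone1 N b (M : 'M[R]_(1, N)) : row' (lift ord0 ord0) (cone b M) = b.
Proof.
apply/matrixP => k j; rewrite mxE (ord1 k).
have -> : lift (lift ord0 ord0) ord0 = ord0 :> 'I_2 by apply/val_inj.
by rewrite cone_ord0.
Qed.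

Lemma coneE N m (M : 'M[R]_(m.+2, N)) : exists b M', M = cone b M'.
Proof. by exists (usubmx (M : 'M[R]_(1 + m.+1, N))), (dsubmx (M : 'M[R]_(1 + m.+1, N))); rewrite /cone vsubmxK. Qed.

Lemma abdB N m (e e' : acochain N m) M :
  abd (fun M => e M - e' M) M = abd e M - abd e' M.
Proof. by rewrite /abd -sumrB; apply: eq_bigr => i _; rewrite mulrzBl. Qed.

(** Deleting the apex leaves the base; every other face is the cone over a face of the base, with
    its index shifted by one, whence the minus sign. *)
Lemma abd_cone N m (e : acochain N m.+1) b M :
  abd e (cone b M) = e M - abd (coned b e) M.
Proof.
rewrite /abd big_ord_recl row'_cone0 expr0 mulr1z; congr (_ + _).
rewrite -sumrN; apply: eq_bigr => i _.
by rewrite row'_coneS lift0 exprS mulN1r mulrNz.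
Qed.

Lemma abd_cone0 N (e : acochain N 0) b M : abd e (cone b M) = e M - e b.
Proof.
by rewrite /abd 2!big_ord_recl big_ord0 row'_cone0 row'_cone1 expr0 addr0.
Qed.

(** Every simplex of positive dimension is a cone over its last vertices, so [abd_cone] gives the
    vanishing by induction on the dimension, without reindexing a double sum. *)
Lemma abdK N m (e : acochain N m) M : abd (abd e) M = 0.
Proof.
elim: m e M => [|m IH] e M; have [b [M' ->]] := coneE M; rewrite abd_cone.
  have -> : coned b (abd e) = fun M => e M - e b.
    by apply/funext => M1; rewrite /coned abd_cone0.
  rewrite abdB opprB addrC subrK /abd 2!big_ord_recl big_ord0 /=.
  by rewrite expr0 expr1 mulr1z mulrN1z addr0 subrr.
have -> : coned b (abd e) = fun M => e M - abd (coned b e) M.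
  by apply/funext => M1; rewrite /coned abd_cone.
by rewrite abdB IH subr0 subrr.
Qed.

Lemma abd_ext N m (S : set 'rV[R]_N) (e e' : acochain N m) (M : 'M[R]_(m.+2, N)) :
  (forall M', (forall i, S (row i M')) -> e M' = e' M') ->
  (forall i, S (row i M)) -> abd e M = abd e' M.
Proof.
move=> ee SM; apply: eq_bigr => i _; rewrite ee // => k.
have -> : row k (row' i M) = row (lift i k) M by apply/rowP => j; rewrite !mxE.
exact: SM.
Qed.

Definition bary N m (M : 'M[R]_(m.+1, N)) : 'rV[R]_N :=
  m.+1%:R^-1 *: \sum_i row i M.

Lemma bary1 N (M : 'M[R]_(1, N)) : bary M = M.
Proof.
by rewrite /bary big_ord1 invr1 scale1r; apply/rowP => j; rewrite mxE.
Qed.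

Lemma baryM N N' m (M : 'M[R]_(m.+1, N)) (L : 'M[R]_(N, N')) :
  bary (M *m L) = bary M *m L.
Proof.
rewrite /bary -scalemxAl mulmx_suml; congr (_ *: _).
by apply: eq_bigr => i _; rewrite row_mul.
Qed.

Lemma coneM N N' m b (M : 'M[R]_(m.+1, N)) (L : 'M[R]_(N, N')) :
  cone b M *m L = cone (b *m L) (M *m L).
Proof. exact: (@mul_col_mx _ 1 m.+1 _ _ b M L). Qed.

Lemma row'M N N' m (i : 'I_m.+2) (M : 'M[R]_(m.+2, N)) (L : 'M[R]_(N, N')) :
  row' i M *m L = row' i (M *m L).
Proof. by apply/matrixP => k j; rewrite !mxE; apply: eq_bigr => l _; rewrite !mxE. Qed.

(** With b the cone at the barycentre of M, this is the transpose of the chain operator T(M) = b(M -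
    T(dM)), and [subdiv] that of S(M) = b(S(dM)). In dimension 0 the cone is a degenerate edge. *)
Fixpoint subdivT N m : acochain N m.+1 -> acochain N m :=
  match m return acochain N m.+1 -> acochain N m with
  | 0 => fun e M => e (cone (bary M) M)
  | m'.+1 => fun e M =>
      e (cone (bary M) M) - abd (subdivT (coned (bary M) e)) M
  end.

Fixpoint subdiv N m : acochain N m -> acochain N m :=
  match m return acochain N m -> acochain N m with
  | 0 => fun e => e
  | m'.+1 => fun e M => abd (subdiv (coned (bary M) e)) M
  end.

Definition abdpre N m : acochain N m.-1 -> acochain N m :=
  match m return acochain N m.-1 -> acochain N m with
  | 0 => fun _ _ => 0
  | m'.+1 => fun e => abd e
  end.

Lemma abd_abdpre N m (e : acochain N m.-1) M : abd (abdpre (m := m) e) M = 0.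
Proof.
case: m e M => [|m] e M /=; last exact: abdK.
by rewrite /abd big1 // => i _; rewrite mul0rz.
Qed.

Lemma subdivTB N m (e e' : acochain N m.+1) M :
  subdivT (fun M => e M - e' M) M = subdivT e M - subdivT e' M.
Proof.
elim: m e e' M => [//|m IH] e e' M /=.
have -> : subdivT (coned (bary M) (fun M0 => e M0 - e' M0)) =
  fun M0 => subdivT (coned (bary M) e) M0 - subdivT (coned (bary M) e') M0.
  by apply/funext => M0; rewrite -IH.
by rewrite abdB !opprB [LHS]addrACA [RHS]addrACA; congr (_ + _); exact: addrC.
Qed.

Definition subdivT' N m : acochain N m -> acochain N m.-1 :=
  match m return acochain N m -> acochain N m.-1 with
  | 0 => fun _ _ => 0
  | m'.+1 => fun e => subdivT e
  end.

(** The transpose of dT + Td = 1 - S. On a cone [abd_cone] splits the coboundary into the value on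
    the base and a term in the coned cochain, to which the induction hypothesis applies. *)
Lemma subdivT_homotopy N m (e : acochain N m) M :
  subdivT (abd e) M + abdpre (subdivT' e) M = e M - subdiv e M.
Proof.
elim: m e M => [|m IH] e M /=.
  by rewrite abd_cone0 bary1 !subrr addr0.
rewrite abd_cone; set b := bary M; set g := coned b e.
have -> : coned b (abd e) = fun M => e M - abd g M.
  by apply/funext => M1; rewrite /coned abd_cone.
have -> : subdivT (fun M0 => e M0 - abd g M0) =
  fun M => subdivT e M - (g M - subdiv g M - abdpre (subdivT' g) M).
  by apply/funext => M0; rewrite subdivTB -IH addrK.
rewrite !abdB abd_abdpre subr0.
set u := abd g M; set v := abd (subdivT e) M; set w := abd _ M.
by rewrite opprB !addrA !subrK.
Qed.

(** Barycentres and cones commute with linear maps. This allows a singular simplex to be subdivided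
    by computing on the identity matrix. *)
Lemma subdivT_nat N N' m (e : acochain N' m.+1) (L : 'M[R]_(N, N')) M :
  subdivT (fun M => e (M *m L)) M = subdivT e (M *m L).
Proof.
elim: m e M => [|m IH] e M /=; first by rewrite baryM coneM.
rewrite baryM coneM; congr (_ - _).
rewrite /abd; apply: eq_bigr => i _; rewrite -row'M -IH.
by congr (_ *~ _); congr subdivT; apply/funext => M1; rewrite /coned coneM.
Qed.

Lemma subdiv_nat N N' m (e : acochain N' m) (L : 'M[R]_(N, N')) M :
  subdiv (fun M => e (M *m L)) M = subdiv e (M *m L).
Proof.
elim: m e M => [//|m IH] e M /=.
rewrite baryM /abd; apply: eq_bigr => i _; rewrite -row'M -IH.
by congr (_ *~ _); congr subdiv; apply/funext => M1; rewrite /coned coneM.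
Qed.

(** This closure keeps all vertices of a subdivision inside S, which makes the operators local to
    S. *)
Definition bary_closed N (S : set 'rV[R]_N) :=
  forall m (M : 'M[R]_(m.+1, N)), (forall i, S (row i M)) -> S (bary M).

Lemma cone_rows N m (S : set 'rV[R]_N) b (M : 'M[R]_(m.+1, N)) :
  S b -> (forall i, S (row i M)) -> forall i, S (row i (cone b M)).
Proof.
move=> Sb SM i; case: (unliftP ord0 i) => [k ->|->].
  suff -> : row (lift ord0 k) (cone b M) = row k M by [].
  by apply/rowP => j; rewrite mxE cone_lift mxE.
suff -> : row ord0 (cone b M) = b by [].
by apply/rowP => j; rewrite mxE cone_ord0.
Qed.

Lemma subdivT_ext N m (S : set 'rV[R]_N) (e e' : acochain N m.+1) M :
  bary_closed S -> (forall M', (forall i, S (row i M')) -> e M' = e' M') ->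
  (forall i, S (row i M)) -> subdivT e M = subdivT e' M.
Proof.
move=> Sb; elim: m e e' M => [|m IH] e e' M ee SM /=.
  by apply: ee; apply: cone_rows => //; exact: Sb.
congr (_ - _); first by apply: ee; apply: cone_rows => //; exact: Sb.
apply: (abd_ext (S := S)) => // M' SM'; apply: IH => // M'' SM''.
by apply: ee; apply: cone_rows => //; exact: Sb.
Qed.

End AffineCochains.

(** * Mesh of iterated subdivisions, and the prism operator *)

Section Fine.
Context {R : realType}.
Local Notation A := int.
Local Notation acochain := (@acochain R A).

Definition diam_le N m (r : R) (M : 'M[R]_(m.+1, N)) :=
  forall i j, `|row i M - row j M| <= r.

Lemma ball_bary_closed N (b : 'rV[R]_N) (r : R) :
  bary_closed [set p : 'rV[R]_N | `|b - p| <= r].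
Proof.
move=> m M SM /=; have m0 : 0 < m.+1%:R :> R by rewrite ltr0n.
have -> : b - bary M = m.+1%:R^-1 *: \sum_i (b - row i M).
  rewrite big_split /= sumr_const card_ord sumrN -[b *+ _]scaler_nat scalerDr scalerA.
  by rewrite mulVf ?gt_eqF // scale1r scalerN.
rewrite normrZ gtr0_norm ?invr_gt0 // mulrC ler_pdivrMr //.
apply: le_trans (ler_norm_sum _ _ _) _.
have -> : r * m.+1%:R = \sum_(i < m.+1) r.
  by rewrite sumr_const card_ord mulr_natr.
by apply: ler_sum => i _; exact: SM.
Qed.

Lemma bary_closedI N (S S' : set 'rV[R]_N) :
  bary_closed S -> bary_closed S' -> bary_closed (S `&` S').
Proof. by move=> h h' m M SM; split; [apply: h|apply: h'] => i; case: (SM i). Qed.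

(** The numerator is m because one of the m + 1 averaged differences is zero. *)
Lemma bary_dist N m (r : R) (M : 'M[R]_(m.+1, N)) i :
  diam_le r M -> `|bary M - row i M| <= m%:R / m.+1%:R * r.
Proof.
move=> dM; have m0 : 0 < m.+1%:R :> R by rewrite ltr0n.
have -> : bary M - row i M = m.+1%:R^-1 *: \sum_j (row j M - row i M).
  rewrite big_split /= sumr_const card_ord -[(- row i M) *+ _]scaler_nat scalerDr scalerA.
  by rewrite mulVf ?gt_eqF // scale1r.
rewrite normrZ gtr0_norm ?invr_gt0 // mulrAC [_^-1 * _]mulrC.
rewrite ler_pM2r ?invr_gt0 //.
rewrite (bigD1 i) //= subrr add0r.
apply: le_trans (ler_norm_sum _ _ _) _.
have -> : m%:R * r = \sum_(j < m.+1 | j != i) r.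
  by rewrite sumr_const cardC1 card_ord mulr_natl.
by apply: ler_sum => j _; exact: dM.
Qed.

Lemma diam_row' N m (r : R) (M : 'M[R]_(m.+2, N)) i :
  diam_le r M -> diam_le r (row' i M).
Proof.
move=> dM k l.
have E (j : 'I_m.+1) : row j (row' i M) = row (lift i j) M by apply/rowP => ?; rewrite !mxE.
by rewrite !E.
Qed.

Lemma diam_cone N m (r : R) b (M : 'M[R]_(m.+1, N)) :
  0 <= r -> (forall i, `|b - row i M| <= r) -> diam_le r M ->
  diam_le r (cone b M).
Proof.
move=> r0 bM dM.
have E0 : row ord0 (cone b M) = b by apply/rowP => j; rewrite mxE cone_ord0.
have E (k : 'I_m.+1) : row (lift ord0 k) (cone b M) = row k M.
  by apply/rowP => j; rewrite mxE cone_lift mxE.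
move=> i j; case: (unliftP ord0 i) => [k ->|->]; case: (unliftP ord0 j) => [l ->|->];
  rewrite ?E ?E0 //.
- by rewrite distrC.
- by rewrite subrr normr0.
Qed.

Lemma subdiv_fine N m (S : set 'rV[R]_N) (r : R) (e e' : acochain N m) M :
  0 <= r -> bary_closed S ->
  (forall M', (forall i, S (row i M')) -> diam_le (m%:R / m.+1%:R * r) M' ->
    e M' = e' M') ->
  (forall i, S (row i M)) -> diam_le r M -> subdiv e M = subdiv e' M.
Proof.
move=> r0; elim: m S e e' M => [|m IH] S e e' M Sb ee SM dM /=.
  apply: ee => // i j; rewrite (ord1 i) (ord1 j) subrr normr0.
  by rewrite mulr_ge0 // divr_ge0.
rewrite /abd; apply: eq_bigr => i _; congr (_ *~ _).
set b := bary M; pose q : R := m.+1%:R / m.+2%:R * r.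
have q0 : 0 <= q by rewrite mulr_ge0 // divr_ge0.
(* Restricting the vertices to the ball of radius q about the barycentre carries the length bound
   for the edges at the cone point through the induction. The other edges belong to a subdivided
   face, whose ratio is smaller. *)
apply: (IH (S `&` [set p | `|b - p| <= q])).
- by apply: bary_closedI => //; exact: ball_bary_closed.
- move=> M' SM' dM'; apply: ee.
    by apply: cone_rows => [|k]; [exact: Sb|case: (SM' k)].
  apply: diam_cone => // [k|k l]; first by case: (SM' k).
  apply: le_trans (dM' k l) _; apply: ler_wpM2r => //.
  rewrite ler_pdivrMr ?ltr0n // mulrAC ler_pdivlMr ?ltr0n //.
  by rewrite -!natrM ler_nat; lia.
- have E (j : 'I_m.+1) : row j (row' i M) = row (lift i j) M.
    by apply/rowP => ?; rewrite !mxE.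
  by move=> k; split; rewrite /= E //; exact: bary_dist.
- exact: diam_row'.
Qed.

Lemma subdiv_iter_fine N m (S : set 'rV[R]_N) k (r : R) (e e' : acochain N m) M :
  0 <= r -> bary_closed S ->
  (forall M', (forall i, S (row i M')) ->
    diam_le ((m%:R / m.+1%:R) ^+ k * r) M' -> e M' = e' M') ->
  (forall i, S (row i M)) -> diam_le r M ->
  iter k (@subdiv R A N m) e M = iter k (@subdiv R A N m) e' M.
Proof.
move=> r0 Sb; elim: k r r0 e e' M => [|k IH] r r0 e e' M ee SM dM /=.
  by apply: ee => // i j; rewrite expr0 mul1r.
apply: (subdiv_fine (S := S) (r := r)) => // M' SM' dM'.
apply: (IH (m%:R / m.+1%:R * r)) => //; first by rewrite mulr_ge0 // divr_ge0.
by move=> M'' SM'' dM''; apply: ee => //; rewrite exprSr -mulrA.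
Qed.

(* In ['rV_(N + 1)] the last coordinate is time. *)
Definition level N m (t : R) (M : 'M[R]_(m.+1, N)) : 'M[R]_(m.+1, N + 1) :=
  row_mx M (const_mx t).

Definition prism_apex N m (M : 'M[R]_(m.+1, N)) : 'rV[R]_(N + 1) :=
  level 0 (row ord0 M).

(** The transpose of P(M) = b(M at time 1 - M at time 0 - P(dM)), where b is the cone at the initial
    vertex of M at time 0. Coning replaces the usual decomposition of the prism, so the proof of dP
    + Pd = 1 - 0 has the pattern of the one for subdivision. *)
Fixpoint prism N m : acochain (N + 1) m.+1 -> acochain N m :=
  match m return acochain (N + 1) m.+1 -> acochain N m with
  | 0 => fun e M => coned (prism_apex M) e (level 1 M) -
                    coned (prism_apex M) e (level 0 M)
  | m'.+1 => fun e M =>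
      coned (prism_apex M) e (level 1 M) - coned (prism_apex M) e (level 0 M) -
      abd (prism (coned (prism_apex M) e)) M
  end.

Definition prism' N m : acochain (N + 1) m -> acochain N m.-1 :=
  match m return acochain (N + 1) m -> acochain N m.-1 with
  | 0 => fun _ _ => 0
  | m'.+1 => fun e => prism e
  end.

Lemma prismB N m (e e' : acochain (N + 1) m.+1) M :
  prism (fun M => e M - e' M) M = prism e M - prism e' M.
Proof.
elim: m e e' M => [|m IH] e e' M /=.
  rewrite /coned; lia.
set b := prism_apex M.
have -> : prism (coned b (fun M0 => e M0 - e' M0)) =
  fun M0 => prism (coned b e) M0 - prism (coned b e') M0.
  by apply/funext => M0; rewrite -IH.
rewrite abdB /coned; lia.
Qed.

Lemma level_row' N m t (M : 'M[R]_(m.+2, N)) i :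
  row' i (level t M) = level t (row' i M).
Proof. by rewrite /level row'_row_mx; congr row_mx; apply/matrixP => ? ?; rewrite !mxE. Qed.

Lemma prism_homotopy N m (e : acochain (N + 1) m) M :
  prism (abd e) M + abdpre (prism' e) M = e (level 1 M) - e (level 0 M).
Proof.
elim: m e M => [|m IH] e M /=.
  rewrite /coned !abd_cone0 addr0; lia.
set b := prism_apex M; set g := coned b e.
have E0 : coned b (abd e) = fun M => e M - abd g M.
  by apply/funext => M1; rewrite /coned abd_cone.
rewrite E0.
have -> : prism (fun M0 => e M0 - abd g M0) =
  fun M => prism e M - (g (level 1 M) - g (level 0 M) - abdpre (prism' g) M).
  by apply/funext => M0; rewrite prismB -IH addrK.
rewrite !abdB abd_abdpre subr0.
have E t : abd (fun M0 => g (level t M0)) M = abd g (level t M).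
  by rewrite /abd; apply: eq_bigr => i _; rewrite level_row'.
rewrite !E.
rewrite /g /coned; lia.
Qed.

Lemma levelM N N' m t (M : 'M[R]_(m.+1, N)) (L : 'M[R]_(N, N')) :
  level t M *m block_mx L 0 0 1%:M = level t (M *m L).
Proof. by rewrite /level mul_row_block !mulmx0 mulmx1 addr0 add0r. Qed.

Lemma prism_nat N N' m (e : acochain (N' + 1) m.+1) (L : 'M[R]_(N, N')) M :
  prism (fun M => e (M *m block_mx L 0 0 1%:M)) M = prism e (M *m L).
Proof.
have E k (M0 : 'M[R]_(k.+1, N)) : prism_apex M0 *m block_mx L 0 0 1%:M = prism_apex (M0 *m L).
  by rewrite /prism_apex levelM row_mul.
elim: m e M => [|m IH] e M /=; first by rewrite /coned !coneM !E !levelM.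
rewrite /coned !coneM !E !levelM; congr (_ - _).
rewrite /abd; apply: eq_bigr => i _; rewrite -row'M -IH.
by congr (_ *~ _); congr prism; apply/funext => M1; rewrite coneM E.
Qed.

Lemma level_rows N m (t : R) (M : 'M[R]_(m.+1, N)) (i : 'I_m.+1) :
  row i (level t M) = level t (row i M).
Proof. by rewrite /level row_row_mx; congr row_mx; apply/matrixP => ? ?; rewrite !mxE. Qed.

Lemma prism_ext N m (S : set 'rV[R]_N) (S' : set 'rV[R]_(N + 1))
    (e e' : acochain (N + 1) m.+1) M :
  (forall v, S v -> S' (level (m := 0) 0 v)) -> (forall v, S v -> S' (level (m := 0) 1 v)) ->
  (forall M', (forall i, S' (row i M')) -> e M' = e' M') ->
  (forall i, S (row i M)) -> prism e M = prism e' M.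
Proof.
move=> S0 S1; have apx k (M0 : 'M[R]_(k.+1, N)) : (forall i, S (row i M0)) -> S' (prism_apex M0).
  by move=> SM; apply: S0; exact: SM.
have lv k (M0 : 'M[R]_(k.+1, N)) : (forall i, S (row i M0)) ->
    (forall i, S' (row i (level 0 M0))) /\ (forall i, S' (row i (level 1 M0))).
  by move=> SM; split=> i; rewrite level_rows; [apply: S0|apply: S1]; exact: SM.
elim: m e e' M => [|m IH] e e' M ee SM /=; have [l0 l1] := lv _ _ SM;
  have a := apx _ _ SM; rewrite /coned.
  by congr (_ - _); apply: ee; apply: cone_rows.
congr (_ - _); first by congr (_ - _); apply: ee; apply: cone_rows.
apply: (abd_ext (S := S)) => // M' SM'; apply: IH => // M'' SM''.
by apply: ee; apply: cone_rows.
Qed.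

End Fine.

(** * Continuity of matrix operations *)

Lemma nbhs_neq0 (R : realType) (z : R) : z != 0 -> nbhs z [set z : R | z != 0].
Proof. by move=> z0; apply: open_nbhs_nbhs; split => //; exact: open_neq. Qed.

Section MatrixContinuity.
Context {R : realType} {T : topologicalType}.

Lemma cvg_mx m n (f : T -> 'M[R]_(m, n)) x :
  (forall i j, {for x, continuous (fun y => f y i j)}) -> {for x, continuous f}.
Proof.
move=> fc U [P Pf PU]; rewrite /= /nbhs /=.
have : \forall y \near x, forall i j, P i j (f y i j).
  apply: filter_forall => i; apply: filter_forall => j.
  exact: fc (Pf i j).
by apply: filterS => y Py; apply: PU.
Qed.

Lemma cont_entry m n (f : T -> 'M[R]_(m, n)) i j x :
  {for x, continuous f} -> {for x, continuous (fun y => f y i j)}.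
Proof.
move=> fc; apply: (@continuous_comp _ _ _ f (fun M : 'M[R]_(m, n) => M i j)) => //.
exact: coord_continuous.
Qed.

Lemma cont_sum (I : Type) (r : seq I) (P : pred I) (f : I -> T -> R) x :
  (forall i, P i -> {for x, continuous (f i)}) ->
  {for x, continuous (fun y => \sum_(i <- r | P i) f i y)}.
Proof.
move=> fc; elim: r => [|i r IH].
  have -> : (fun y => \sum_(i <- [::] | P i) f i y) = cst 0.
    by apply/funext => y; rewrite big_nil.
  exact: cst_continuous.
case Pi : (P i).
  have -> : (fun y => \sum_(j <- i :: r | P j) f j y) =
            (fun y => f i y + \sum_(j <- r | P j) f j y).
    by apply/funext => y; rewrite big_cons Pi.
  exact: continuousD (fc _ Pi) IH.
have -> // : (fun y => \sum_(j <- i :: r | P j) f j y) =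
          (fun y => \sum_(j <- r | P j) f j y).
by apply/funext => y; rewrite big_cons Pi.
Qed.

Lemma cont_prod (I : Type) (r : seq I) (P : pred I) (f : I -> T -> R) x :
  (forall i, P i -> {for x, continuous (f i)}) ->
  {for x, continuous (fun y => \prod_(i <- r | P i) f i y)}.
Proof.
move=> fc; elim: r => [|i r IH].
  have -> : (fun y => \prod_(i <- [::] | P i) f i y) = cst 1.
    by apply/funext => y; rewrite big_nil.
  exact: cst_continuous.
case Pi : (P i).
  have -> : (fun y => \prod_(j <- i :: r | P j) f j y) =
            (fun y => f i y * \prod_(j <- r | P j) f j y).
    by apply/funext => y; rewrite big_cons Pi.
  exact: continuousM (fc _ Pi) IH.
have -> // : (fun y => \prod_(j <- i :: r | P j) f j y) =
          (fun y => \prod_(j <- r | P j) f j y).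
by apply/funext => y; rewrite big_cons Pi.
Qed.

Lemma cont_mulmx m n p (f : T -> 'M[R]_(m, n)) (g : T -> 'M[R]_(n, p)) x :
  {for x, continuous f} -> {for x, continuous g} ->
  {for x, continuous (fun y => f y *m g y)}.
Proof.
move=> fc gc; apply: cvg_mx => i j.
have -> : (fun y => (f y *m g y) i j) = (fun y => \sum_k f y i k * g y k j).
  by apply/funext => y; rewrite mxE.
by apply: cont_sum => k _; apply: continuousM; exact: cont_entry.
Qed.

Lemma cont_det n (f : T -> 'M[R]_n) x :
  {for x, continuous f} -> {for x, continuous (fun y => \det (f y))}.
Proof.
move=> fc; rewrite /determinant; apply: cont_sum => s _.
apply: continuousM; first exact: cst_continuous.
by apply: cont_prod => i _; exact: cont_entry.
Qed.

(** [invmx] is the identity on singular matrices, so the adjugate formula can only be used near x,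
    where the determinant stays nonzero. *)
Lemma cont_invmx n (f : T -> 'M[R]_n) x : f x \in unitmx ->
  {for x, continuous f} -> {for x, continuous (fun y => invmx (f y))}.
Proof.
move=> fU fc.
have d0 : \det (f x) != 0 by rewrite -unitfE -unitmxE.
have dc := cont_det fc.
have : {for x, continuous (fun y => (\det (f y))^-1 *: \adj (f y))}.
  apply: cvg_mx => i j.
  have -> : (fun y => ((\det (f y))^-1 *: \adj (f y)) i j) =
            (fun y => (\det (f y))^-1 * cofactor (f y) j i).
    by apply/funext => y; rewrite !mxE.
  apply: continuousM; first exact: continuousV.
  rewrite /cofactor; apply: continuousM; first exact: cst_continuous.
  apply: (@cont_det _ (fun y => row' j (col' i (f y)))).
  apply: cvg_mx => k l.
  have -> : (fun y => row' j (col' i (f y)) k l) = (fun y => f y (lift j k) (lift i l)).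
    by apply/funext => y; rewrite !mxE.
  exact: cont_entry.
have near_unit : \forall y \near x, f y \in unitmx.
  have : \forall y \near x, \det (f y) != 0 by exact: dc _ (nbhs_neq0 d0).
  by apply: filterS => y /=; rewrite unitmxE unitfE.
have E : invmx (f x) = (\det (f x))^-1 *: \adj (f x) by rewrite /invmx fU.
rewrite /prop_for /continuous_at E => h.
apply: cvg_trans h; apply: near_eq_cvg.
by near=> y; rewrite /invmx (_ : f y \in unitmx) //; near: y.
Unshelve. all: by end_near.
Qed.

End MatrixContinuity.

Lemma set_type_continuous (T X : topologicalType) (S : set X) (f : T -> S) x :
  {for x, continuous (fun y => set_val (f y))} -> {for x, continuous f}.
Proof.
move=> fc U [V [[W oW WV] Vx VU]].
have : nbhs (set_val (f x)) W.
  by apply: open_nbhs_nbhs; split=> //; rewrite -[W _]/((set_val @^-1` W) (f x)) WV.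
move=> /fc h; have h' : \forall y \near x, W (set_val (f y)) := h.
rewrite /= /nbhs /=; apply: filterS h' => y Wy; apply: VU.
by rewrite -WV.
Qed.

(** * Singular cochains *)

Section Singular.
Context {R : realType}.
Local Notation simp n := (stdsimplex R n).
Local Notation cochain X n := (cochain R X int n).

Lemma simp_mulmx N m (t : simp m) (M : 'M[R]_(m.+1, N)) :
  set_val t *m M = \sum_i set_val t ord0 i *: row i M.
Proof. by rewrite mulmx_sum_row. Qed.

Lemma simp_ge0 m (t : simp m) i : 0 <= set_val t ord0 i.
Proof. by case: t => t tP; rewrite set_valE /=; have [] := set_mem tP. Qed.

Lemma simp_sum1 m (t : simp m) : \sum_i set_val t ord0 i = 1.
Proof. by case: t => t tP; rewrite set_valE /=; have [] := set_mem tP. Qed.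

Lemma simp_setval_inj m : injective (set_val : simp m -> _).
Proof. by move=> s t; rewrite set_valE => /val_inj. Qed.

Lemma vertex_subproof n : (delta_mx 0 0 : 'rV[R]_n.+1) \in simp n.
Proof.
apply/mem_set; split=> [i|]; first by rewrite mxE; case: (_ && _).
by rewrite (bigD1 0) //= big1 => [|i /negPf i0]; rewrite mxE ?i0 ?addr0 ?eqxx.
Qed.

(** Vectors outside the simplex go to a vertex. This turns a singular simplex into a total function
    of row vectors, which can be composed with matrix products. *)
Definition to_simp n (v : 'rV[R]_n.+1) : simp n :=
  if pselect (v \in simp n) is left h then SigSub h else SigSub (vertex_subproof n).

Lemma to_simpK n (v : 'rV[R]_n.+1) : simp n v -> set_val (to_simp v) = v.
Proof. by move=> /mem_set vS; rewrite /to_simp; case: pselect. Qed.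

Lemma set_valK n (t : simp n) : to_simp (set_val t) = t.
Proof. by apply: simp_setval_inj; rewrite to_simpK //; apply/set_mem; case: t. Qed.

Lemma simp_convex n m (t : simp m) (M : 'M[R]_(m.+1, n.+1)) :
  (forall i, simp n (row i M)) -> simp n (set_val t *m M).
Proof.
move=> SM; split=> [j|].
  rewrite mxE; apply: sumr_ge0 => i _; apply: mulr_ge0; first exact: simp_ge0.
  by have [/(_ j) + _] := SM i; rewrite mxE.
under eq_bigr do rewrite mxE.
rewrite exchange_big /= -[RHS](simp_sum1 t); apply: eq_bigr => i _.
rewrite -mulr_sumr; have [_ ] := SM i; under eq_bigr do rewrite mxE.
by move=> ->; rewrite mulr1.
Qed.

Lemma simp_bary_closed n : bary_closed (simp n).
Proof.
move=> m M SM; pose t : 'rV[R]_m.+1 := const_mx (m.+1%:R^-1).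
have tS : t \in simp m.
  apply/mem_set; split=> [i|]; first by rewrite mxE invr_ge0.
  under eq_bigr do rewrite mxE.
  by rewrite sumr_const card_ord -[RHS](@mulVf R m.+1%:R) ?pnatr_eq0 // mulr_natr.
have -> : bary M = set_val (SigSub tS : simp m) *m M.
  rewrite simp_mulmx /bary scaler_sumr; apply: eq_bigr => i _.
  by rewrite set_valE /= mxE.
exact: simp_convex.
Qed.

Lemma simp_rows1 n i : simp n (row i 1%:M).
Proof.
split=> [j|]; first by rewrite !mxE; case: (_ == _).
rewrite (bigD1 i) //= big1 => [|j /negPf ij]; rewrite !mxE ?eqxx ?addr0 //.
by rewrite eq_sym ij.
Qed.

Lemma face_mulmx N m (i : 'I_m.+2) (t : simp m) (M : 'M[R]_(m.+2, N)) :
  set_val (face i t) *m M = set_val t *m row' i M.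
Proof.
apply/rowP => j; rewrite !mxE (bigD1_ord i) //= set_valE /= insert0_id mul0r add0r.
by apply: eq_bigr => k _; rewrite insert0_lift !mxE.
Qed.

Lemma simp_ball m N (t : simp m) (M : 'M[R]_(m.+1, N)) (r : R) (b : 'rV_N) :
  (forall i, `|b - row i M| <= r) -> `|b - set_val t *m M| <= r.
Proof.
move=> bM; have -> : b - set_val t *m M = \sum_i set_val t ord0 i *: (b - row i M).
  rewrite simp_mulmx -[X in X - _]scale1r -(simp_sum1 t) scaler_suml -sumrB.
  by apply: eq_bigr => i _; rewrite scalerBr.
apply: le_trans (ler_norm_sum _ _ _) _.
rewrite -[leRHS]mul1r -(simp_sum1 t) mulr_suml; apply: ler_sum => i _.
by rewrite normrZ ger0_norm ?simp_ge0 // ler_wpM2l ?simp_ge0.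
Qed.

Lemma simp_norm m (v : 'rV[R]_m.+1) : simp m v -> `|v| <= 1.
Proof.
move=> [v0 v1]; rewrite [leLHS]/Num.norm /= mx_normrE; apply/bigmax_leP; split=> //.
move=> [i j] _ /=; rewrite (ord1 i) ger0_norm //.
by rewrite -v1 (bigD1 j) //= lerDl sumr_ge0.
Qed.

Lemma simp_compact m : compact (simp m).
Proof.
apply: bounded_closed_compact.
  exists 1; split => // r r1 v /simp_norm v1; exact: le_trans v1 (ltW r1).
have -> : simp m = (\bigcap_i [set v : 'rV[R]_m.+1 | 0 <= v ord0 i]) `&`
    [set v : 'rV[R]_m.+1 | \sum_i v ord0 i = 1].
  by apply/seteqP; split=> v [v0 v1]; split=> // i *; exact: v0.
apply: closedI.
  apply: closed_bigI => i _.
  have := @preimage_closed _ _ (fun v : 'rV[R]_m.+1 => v ord0 i) [set x | 0 <= x].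
  apply; last exact: closed_ge.
  by move=> x _; exact: coord_continuous.
have := @preimage_closed _ _ (fun v : 'rV[R]_m.+1 => \sum_i v ord0 i) [set x | x = 1].
apply; last exact: closed_eq.
by move=> x _; apply: cont_sum => i _; exact: coord_continuous.
Qed.

Lemma simp_lin_continuous m N (M : 'M[R]_(m.+1, N)) :
  continuous (fun t : simp m => set_val t *m M).
Proof.
move=> t; apply: cont_mulmx; last exact: cst_continuous.
exact: initial_continuous.
Qed.

Section Space.
Context {X : topologicalType}.

Definition mksing m (f : simp m -> X) (fc : continuous f) : singular R X m :=
  mkcts fc.

(* Junk value 0 on discontinuous maps, so that cochains can be evaluated on
   compositions without carrying continuity proofs. *)
Definition ev m (c : cochain X m) (f : simp m -> X) : int :=
  if pselect (continuous f) is left fc then c (mksing fc) else 0.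

Lemma evE m (c : cochain X m) (s : singular R X m) : ev c s = c s.
Proof.
rewrite /ev; case: pselect => [fc|/(_ (@cts_fun _ _ s))] //.
by congr c; apply/continuousEP.
Qed.

Lemma evC m (c : cochain X m) (f : simp m -> X) (fc : continuous f) :
  ev c f = c (mksing fc).
Proof. by rewrite -[RHS]evE. Qed.

Lemma evB m (b c : cochain X m) f : ev (b - c) f = ev b f - ev c f.
Proof. by rewrite /ev; case: pselect => [fc|//]. Qed.

Lemma ev_coboundary m (c : cochain X m) (f : simp m.+1 -> X) :
  continuous f ->
  ev (coboundary c) f = \sum_(i < m.+2) ev c (f \o face i) *~ (-1) ^+ i.
Proof.
move=> fc; rewrite evC /coboundary; apply: eq_bigr => i _; congr (_ *~ _).
by rewrite -evE.
Qed.

Definition sfun n (s : simp n -> X) : 'rV[R]_n.+1 -> X := fun v => s (to_simp v).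

Definition ea N m (c : cochain X m) (f : 'rV[R]_N -> X) : acochain (A := int) N m :=
  fun M => ev c (fun t : simp m => f (set_val t *m M)).

Definition acont N (S : set 'rV[R]_N) (f : 'rV[R]_N -> X) :=
  forall m (M : 'M[R]_(m.+1, N)), (forall i, S (row i M)) ->
  continuous (fun t : simp m => f (set_val t *m M)).

Lemma ea_abd N m (S : set 'rV[R]_N) (c : cochain X m) f (M : 'M[R]_(m.+2, N)) :
  acont S f -> (forall i, S (row i M)) -> abd (ea c f) M = ea (coboundary c) f M.
Proof.
move=> fc SM; rewrite /ea ev_coboundary; last exact: fc.
rewrite /abd; apply: eq_bigr => i _; congr (ev _ _ *~ _).
by apply/funext => t; rewrite /= face_mulmx.
Qed.

Lemma acont_sing n (s : singular R X n) : acont (simp n) (sfun s).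
Proof.
move=> m M SM t.
apply: (@continuous_comp _ _ _ (fun t : simp m => to_simp (set_val t *m M)) s); last exact: cts_fun.
apply: set_type_continuous.
have -> : (fun y : simp m => set_val (to_simp (set_val y *m M))) =
  (fun y => set_val y *m M).
  by apply/funext => y; rewrite to_simpK //; exact: simp_convex.
exact: simp_lin_continuous.
Qed.

Lemma sfun_face n (s : singular R X n.+1) i (v : 'rV[R]_n.+1) :
  simp n v -> sfun (s \o face i) v = sfun s (v *m row' i 1%:M).
Proof.
move=> vS; rewrite /sfun /=; congr (s _); apply: simp_setval_inj.
have <- : set_val (face i (to_simp v)) = v *m row' i 1%:M.
  by rewrite -{2}(to_simpK vS) -face_mulmx mulmx1.
by rewrite set_valK.
Qed.

Lemma ea_face n m (c : cochain X m) (s : singular R X n.+1) i (M : 'M[R]_(m.+1, n.+1)) :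
  (forall i, simp n (row i M)) ->
  ea c (sfun (s \o face i)) M = ea c (sfun s) (M *m row' i 1%:M).
Proof.
move=> SM; congr ev; apply/funext => t; rewrite sfun_face ?mulmxA //.
exact: simp_convex.
Qed.

Lemma ea_sfun1 n (c : cochain X n) (s : singular R X n) : ea c (sfun s) 1%:M = c s.
Proof.
rewrite -evE; congr ev; apply/funext => t.
by rewrite mulmx1 /sfun set_valK.
Qed.

(* Affine operators transport to singular cochains by evaluation on the
   identity simplex. *)
Definition sdT n (c : cochain X n.+1) : cochain X n :=
  fun s => subdivT (ea c (sfun s)) 1%:M.

Definition sd n (c : cochain X n) : cochain X n :=
  fun s => subdiv (ea c (sfun s)) 1%:M.

(* The coboundary into degree [n], with [cobpre = 0] for [n = 0]. *)
Definition cobpre n : cochain X n.-1 -> cochain X n :=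
  match n return cochain X n.-1 -> cochain X n with
  | 0 => fun _ => 0
  | n'.+1 => fun c => coboundary c
  end.

Definition sdT' n : cochain X n -> cochain X n.-1 :=
  match n return cochain X n -> cochain X n.-1 with
  | 0 => fun _ => 0
  | n'.+1 => fun c => sdT c
  end.

(** The i-th face of s is s composed with the linear map of matrix [row' i 1%:M], so naturality
    moves the face inside the affine operator. *)
Lemma sdT_coboundary n (c : cochain X n.+1) (s : singular R X n.+1) :
  coboundary (sdT c) s = abd (subdivT (ea c (sfun s))) 1%:M.
Proof.
rewrite /coboundary /abd; apply: eq_bigr => i _; congr (_ *~ _).
rewrite /sdT -[row' i 1%:M]mul1mx -subdivT_nat.
apply: (subdivT_ext (S := simp n)); first exact: simp_bary_closed.
  by move=> M SM; rewrite ea_face.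
exact: simp_rows1.
Qed.

Lemma sd_homotopy n (c : cochain X n) :
  c - sd c = sdT (coboundary c) + cobpre (sdT' c).
Proof.
apply/funext => s.
transitivity (c s - sd c s); first by [].
transitivity (sdT (coboundary c) s + cobpre (sdT' c) s); last by [].
rewrite -{1}ea_sfun1 -subdivT_homotopy; congr (_ + _).
  apply: (subdivT_ext (S := simp n)); first exact: simp_bary_closed.
    by move=> M SM; rewrite (ea_abd (S := simp n)) //; exact: acont_sing.
  exact: simp_rows1.
by case: n c s => [//|n] c s /=; rewrite sdT_coboundary.
Qed.

Lemma ea_comp N n m (c : cochain X m) (s : singular R X n) (f : 'rV[R]_N -> X)
    (M : 'M[R]_(m.+1, n.+1)) (L : 'M[R]_(n.+1, N)) :
  (forall i, simp n (row i M)) -> (forall t, simp n t -> sfun s t = f (t *m L)) ->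
  ea c (sfun s) M = ea c f (M *m L).
Proof.
move=> SM sf; congr ev; apply/funext => t; rewrite sf ?mulmxA //.
exact: simp_convex.
Qed.

Lemma ea_sd n m (c : cochain X m) (s : singular R X n) (M : 'M[R]_(m.+1, n.+1)) :
  (forall i, simp n (row i M)) -> ea (sd c) (sfun s) M = subdiv (ea c (sfun s)) M.
Proof.
move=> SM; have fc := @acont_sing _ s _ M SM.
rewrite /ea (evC _ fc) /sd -[in RHS](mul1mx M) -subdiv_nat.
(* Only locality is used here, not the smaller diameter; 1 + 1 bounds the distance of two vertices
   of norm at most 1. *)
apply: (subdiv_fine (S := simp m) (r := 1 + 1)) => //.
- exact: simp_bary_closed.
- move=> M' SM' _; rewrite (ea_comp _ (f := sfun s) (L := M)) // => t tS.
  by rewrite -[LHS]/(sfun s (set_val (to_simp t) *m M)) to_simpK.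
- exact: simp_rows1.
- move=> i j; apply: le_trans (ler_normB _ _) _.
  by apply: lerD; apply: simp_norm; exact: simp_rows1.
Qed.

Lemma iter_sd n m k (c : cochain X m) (s : singular R X n) (M : 'M[R]_(m.+1, n.+1)) :
  (forall i, simp n (row i M)) ->
  ea (iter k (@sd m) c) (sfun s) M = iter k (@subdiv _ _ _ _) (ea c (sfun s)) M.
Proof.
elim: k M => [//|k IH] M SM; rewrite iterS ea_sd //=.
apply: (subdiv_fine (S := simp n) (r := 1 + 1)) => //.
- exact: simp_bary_closed.
- by move=> M' SM' _; rewrite IH.
- move=> i j; apply: le_trans (ler_normB _ _) _.
  by apply: lerD; apply: simp_norm.
Qed.

End Space.
End Singular.

(** * The theorem on small simplices *)

Section Small.
Context {R : realType}.
Local Notation simp n := (stdsimplex R n).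
Local Notation cochain X n := (cochain R X int n).

Lemma subdivT0 N m (M : 'M[R]_(m.+1, N)) : subdivT (fun=> 0 : int) M = 0.
Proof.
rewrite (_ : (fun=> 0 : int) = fun M' => (fun=> 0 : int) M' - (fun=> 0 : int) M').
  by rewrite subdivTB subrr.
by apply/funext => M'; rewrite subrr.
Qed.

Lemma subdiv0 N m (M : 'M[R]_(m.+1, N)) : subdiv (fun=> 0 : int) M = 0.
Proof.
elim: m M => [//|m IH] M /=; rewrite /abd big1 // => i _.
by rewrite (_ : coned _ _ = fun=> 0) // IH mul0rz.
Qed.

Lemma iter_subdiv0 N m k (M : 'M[R]_(m.+1, N)) :
  iter k (@subdiv R _ N m) (fun=> 0 : int) M = 0.
Proof.
elim: k M => [//|k IH] M /=.
by rewrite (_ : iter _ _ _ = fun=> 0) ?subdiv0 //; apply/funext.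
Qed.

Lemma prism0 N m (M : 'M[R]_(m.+1, N)) : prism (fun=> 0 : int) M = 0.
Proof.
rewrite (_ : (fun=> 0 : int) = fun M' => (fun=> 0 : int) M' - (fun=> 0 : int) M').
  by rewrite prismB subrr.
by apply/funext => M'; rewrite subrr.
Qed.

Lemma simp_diam n m (M : 'M[R]_(m.+1, n.+1)) :
  (forall i, simp n (row i M)) -> diam_le (1 + 1) M.
Proof.
move=> SM i j; apply: le_trans (ler_normB _ _) _.
by apply: lerD; apply: simp_norm.
Qed.

Section Space.
Context {X : topologicalType}.
Implicit Types O T S : set (set X).

Definition small O n (s : singular R X n) := exists2 U, O U & forall t, U (s t).

(* Relative cochains are cochains vanishing on the simplices that lie in a
   member of the family [O]; [O = [set U]] gives the pair (X, U), and an open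
   cover of U gives a complex computing the same cohomology. *)
Definition vanish O n (c : cochain X n) := forall s, small O s -> c s = 0.

(* [c] is, over the [T]-small simplices, the coboundary of a cochain relative
   to [S]. *)
Definition bnd T S n (c : cochain X n) :=
  exists2 b : cochain X n.-1, vanish S b & vanish T (c - cobpre b).

Lemma cochainB n (b c : cochain X n) s : (b - c) s = b s - c s. Proof. by []. Qed.
Lemma cochainD n (b c : cochain X n) s : (b + c) s = b s + c s. Proof. by []. Qed.
Lemma cochainN n (c : cochain X n) s : (- c) s = - c s. Proof. by []. Qed.
Lemma cochain0 n s : (0 : cochain X n) s = 0. Proof. by []. Qed.
Lemma cochain_sum (I : Type) (r : seq I) (P : pred I) n (F : I -> cochain X n) s :
  (\sum_(i <- r | P i) F i) s = \sum_(i <- r | P i) F i s.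
Proof. by elim/big_rec2: _ => // i x y _ <-. Qed.
Lemma cochainMz n (c : cochain X n) k s : (c *~ k) s = c s *~ k.
Proof.
have E (m : nat) : (c *+ m) s = c s *+ m.
  by elim: m => [//|m IH]; rewrite !mulrS cochainD IH.
by case: k => k; rewrite /intmul ?cochainN E.
Qed.

Lemma small_ea O n m (c : cochain X m) (s : singular R X n) (M : 'M[R]_(m.+1, n.+1)) :
  (exists2 U, O U & forall t : simp m, U (sfun s (set_val t *m M))) ->
  vanish O c -> ea c (sfun s) M = 0.
Proof.
move=> [U OU Us] Oc; rewrite /ea /ev; case: pselect => // fc.
by apply: Oc; exists U.
Qed.

Lemma vanish_ea O n m (c : cochain X m) (s : singular R X n) (M : 'M[R]_(m.+1, n.+1)) :
  small O s -> vanish O c -> ea c (sfun s) M = 0.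
Proof. by move=> [U OU Us]; apply: small_ea; exists U => // t; exact: Us. Qed.

Lemma vanish_sdT O n (c : cochain X n.+1) : vanish O c -> vanish O (sdT c).
Proof.
move=> Oc s sO; rewrite /sdT (_ : ea _ _ = fun=> 0) ?subdivT0 //.
by apply/funext => M; exact: vanish_ea Oc.
Qed.

Lemma vanish_sdT' O n (c : cochain X n) : vanish O c -> vanish O (sdT' c).
Proof. by case: n c => [|n] c Oc //; exact: vanish_sdT. Qed.

Lemma vanish_sd O n (c : cochain X n) : vanish O c -> vanish O (sd c).
Proof.
move=> Oc s sO; rewrite /sd (_ : ea _ _ = fun=> 0) ?subdiv0 //.
by apply/funext => M; exact: vanish_ea Oc.
Qed.

Lemma small_face O n (s : singular R X n.+1) i : small O s -> small O (s \o face i).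
Proof. by move=> [U OU Us]; exists U => // t; exact: Us. Qed.

Lemma vanish_cob O n (c : cochain X n) : vanish O c -> vanish O (coboundary c).
Proof.
move=> Oc s sO; rewrite /coboundary big1 // => i _.
by rewrite Oc ?mul0rz //; exact: small_face.
Qed.

Lemma vanish_cobpre O n (c : cochain X n.-1) : vanish O c -> vanish O (@cobpre _ _ n c).
Proof. by case: n c => [|n] c Oc //; exact: vanish_cob. Qed.

Lemma vanishB O n (b c : cochain X n) : vanish O b -> vanish O c -> vanish O (b - c).
Proof. by move=> Ob Oc s sO; rewrite cochainB Ob // Oc // subrr. Qed.

Lemma vanishD O n (b c : cochain X n) : vanish O b -> vanish O c -> vanish O (b + c).
Proof. by move=> Ob Oc s sO; rewrite cochainD Ob // Oc // addr0. Qed.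

Lemma vanishN O n (c : cochain X n) : vanish O c -> vanish O (- c).
Proof. by move=> Oc s sO; rewrite cochainN Oc // oppr0. Qed.

Lemma vanishMz O n (c : cochain X n) k : vanish O c -> vanish O (c *~ k).
Proof. by move=> Oc s sO; rewrite cochainMz Oc // mul0rz. Qed.

Lemma vanish_sumr O n (I : Type) (r : seq I) (P : pred I) (F : I -> cochain X n) :
  (forall i, P i -> vanish O (F i)) -> vanish O (\sum_(i <- r | P i) F i).
Proof. by move=> Oc s sO; rewrite cochain_sum big1 // => i Pi; exact: Oc. Qed.

Lemma vanish0 O n : vanish O (0 : cochain X n).
Proof. by []. Qed.

Lemma cobpreB n (b c : cochain X n.-1) : @cobpre R X n (b - c) = cobpre b - cobpre c.
Proof. by case: n b c => [|n] b c; rewrite /= ?subrr // raddfB. Qed.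

Lemma cobpreD n (b c : cochain X n.-1) : @cobpre R X n (b + c) = cobpre b + cobpre c.
Proof. by case: n b c => [|n] b c; rewrite /= ?addr0 // raddfD. Qed.

Lemma cobpreMz n (b : cochain X n.-1) k : @cobpre R X n (b *~ k) = cobpre b *~ k.
Proof. by case: n b => [|n] b; rewrite /= ?mul0rz // raddfMz. Qed.

Lemma cobpre_sum (I : Type) (r : seq I) (P : pred I) n (F : I -> cochain X n.-1) :
  @cobpre R X n (\sum_(i <- r | P i) F i) = \sum_(i <- r | P i) cobpre (F i).
Proof. by case: n F => [|n] F /=; [rewrite big1 | exact: raddf_sum]. Qed.

Lemma cobpre0 n : @cobpre R X n 0 = 0.
Proof. by have := @cobpreB n 0 0; rewrite subr0 subrr. Qed.

Lemma cobpreN n (b : cochain X n.-1) : @cobpre R X n (- b) = - cobpre b.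
Proof. by rewrite -sub0r cobpreB cobpre0 sub0r. Qed.

Lemma cob_cobpre n (b : cochain X n.-1) : coboundary (@cobpre R X n b) = 0.
Proof. by case: n b => [|n] b /=; [exact: raddf0 | exact: coboundaryK]. Qed.

Lemma coboundary_sd n (c : cochain X n) : coboundary (sd c) = sd (coboundary c).
Proof.
have -> : sd c = c - (sdT (coboundary c) + cobpre (sdT' c)).
  by rewrite -sd_homotopy subKr.
have -> : sd (coboundary c) = coboundary c -
    (sdT (coboundary (coboundary c)) + cobpre (n := n.+1) (sdT' (coboundary c))).
  by rewrite -sd_homotopy subKr.
rewrite raddfB raddfD /= cob_cobpre addr0 coboundaryK.
congr (_ - _).
suff -> : sdT (0 : cochain X n.+2) = 0 by rewrite add0r.
apply/funext => s; rewrite /sdT (_ : ea _ _ = fun=> 0) ?subdivT0 //.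
by apply/funext => M; rewrite /ea /ev; case: pselect.
Qed.

Lemma coboundary_iter_sd n k (c : cochain X n) :
  coboundary (iter k (@sd R X n) c) = iter k (@sd R X n.+1) (coboundary c).
Proof. by elim: k => [//|k IH]; rewrite !iterS coboundary_sd IH. Qed.

Lemma vanish_iter_sd O n k (c : cochain X n) : vanish O c -> vanish O (iter k (@sd R X n) c).
Proof. by move=> Oc; elim: k => [//|k IH]; exact: vanish_sd. Qed.

Lemma lebesgue_simp O n (s : singular R X n) :
  (forall U, O U -> open U) -> (forall t, exists2 U, O U & U (s t)) ->
  exists2 r : R, 0 < r & forall m (M : 'M[R]_(m.+1, n.+1)),
    (forall i, simp n (row i M)) -> diam_le r M ->
    exists2 U, O U & forall t : simp m, U (sfun s (set_val t *m M)).
Proof.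
move=> Oo sO.
have := @simp_compact R n; rewrite compact_near_coveringP => near_cov.
pose P (r : R) (v : 'rV[R]_n.+1) := exists2 U, O U &
  forall w, simp n w -> `|v - w| <= r -> U (sfun s w).
have : \forall r \near 0^'+, simp n `<=` P r.
  apply: near_cov => v vS.
  have [U OU Uv] := sO (to_simp v).
  have [_ /cts_fun] := (conj I (open_nbhs_nbhs (conj (Oo _ OU) Uv))).
  move=> /= [V [[W oW WV] Vv VU]].
  have Wv : W v by rewrite -(to_simpK vS) -[W _]/((set_val @^-1` W) (to_simp v)) WV.
  have /nbhs_ballP[e /= e0 eW] : nbhs v W by exact: open_nbhs_nbhs.
  have e20 : 0 < e / 2 by rewrite divr_gt0.
  (* One half of e is spent on the distance from v to the nearby centre x, the other on the radius r
     around x. *)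
  exists ([set x | `|v - x| < e / 2], [set r | r < e / 2]) => /=.
    split; first by apply/nbhs_ballP; exists (e / 2) => //= x; rewrite -ball_normE.
    exact: nbhs_right_lt.
  move=> [x r] /= [vx re]; exists U => // w wS xw.
  apply: VU; rewrite -WV /= to_simpK //; apply: eW.
  rewrite -ball_normE /= (splitr e) -(subrKA x); apply: le_lt_trans (ler_normD _ _) _.
  by apply: ltrD => //; exact: le_lt_trans re.
move=> near_r.
have pos : \forall r \near (0 : R)^'+, 0 < r by exact: nbhs_right_gt.
have both : \forall r \near (0 : R)^'+, simp n `<=` P r /\ 0 < r.
  by near=> r; split; near: r.
have [r [rP r0]] := @filter_ex _ _ (at_right_proper_filter (0 : R)) _ both.
exists r => // m M SM dM.
have [U OU Ur] := rP _ (SM ord0); exists U => // t.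
apply: Ur; first exact: simp_convex.
by apply: simp_ball => i; exact: dM.
Unshelve. all: by end_near.
Qed.

Lemma small_exp m (r : R) : 0 < r ->
  exists K, forall k, (K <= k)%N -> (m%:R / m.+1%:R) ^+ k * (1 + 1) <= r.
Proof.
move=> r0; set q : R := m%:R / m.+1%:R.
have q0 : 0 <= q by rewrite divr_ge0.
have q1 : `|q| < 1 by rewrite ger0_norm // ltr_pdivrMr ?ltr0n // mul1r ltr_nat.
have /cvgrPdist_le/(_ (r / 2)) := cvg_expr q1.
rewrite divr_gt0 // => /(_ isT) [K _ Kr]; exists K => k /Kr /=.
rewrite sub0r normrN ger0_norm ?exprn_ge0 // => h.
by rewrite -ler_pdivlMr.
Qed.

Lemma iter_sd_vanish O n m (c : cochain X m) (s : singular R X n) :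
  (forall U, O U -> open U) -> (forall t, exists2 U, O U & U (s t)) ->
  vanish O c -> exists K, forall k, (K <= k)%N ->
    forall M : 'M[R]_(m.+1, n.+1), (forall i, simp n (row i M)) ->
    ea (iter k (@sd R X m) c) (sfun s) M = 0.
Proof.
move=> Oo sO Oc; have [r r0 rP] := lebesgue_simp Oo sO.
have [K Kr] := small_exp m r0; exists K => k /Kr kr M SM.
rewrite iter_sd // -(iter_subdiv0 k M).
apply: (subdiv_iter_fine (S := simp n) (r := 1 + 1)) => //.
- exact: simp_bary_closed.
- move=> M' SM' dM'; apply: (small_ea _ Oc); apply: rP => // i j.
  exact: le_trans (dM' i j) kr.
- exact: simp_diam.
Qed.

Lemma iter_sd_telescope n (c : cochain X n) K :
  c - iter K (@sd R X n) c = \sum_(k < K)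
    (sdT (coboundary (iter k (@sd R X n) c)) + cobpre (sdT' (iter k (@sd R X n) c))).
Proof.
elim: K => [|K IH]; first by rewrite big_ord0 subrr.
by rewrite big_ord_recr /= -IH -sd_homotopy addrA subrK.
Qed.

(* The homotopies [sdT (sd^k c)] are summed over all [k]; at each simplex the
   sum is finite, since iterated subdivisions eventually become small. *)
Theorem small_simplices O n (c : cochain X n) :
  (forall U, O U -> open U) -> vanish O c ->
  vanish [set \bigcup_(U in O) U] (coboundary c) ->
  bnd [set \bigcup_(U in O) U] O c.
Proof.
move=> Oo Oc dc; set W := \bigcup_(U in O) U in dc *.
pose h k := sdT' (iter k (@sd R X n) c).
pose tail s K := forall k, (K <= k)%N -> h k s = 0.
(* For a simplex not contained in W there may be no cutoff, and [b] then gets an arbitrary value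
   from the default 0. Both conclusions test only simplices contained in W. *)
pose N s := if pselect (exists K, tail s K) is left e then projT1 (cid e) else 0%N.
have NP s : (exists K, tail s K) -> tail s (N s).
  by rewrite /N; case: pselect => // e _; case: cid.
pose b : cochain X n.-1 := fun s => \sum_(k < N s) h k s.
have WO m (s : singular R X m) : small [set W] s -> forall t, exists2 U, O U & U (s t).
  by move=> [_ -> Ws] t; have [U OU Us] := Ws t; exists U.
have tailP s : small [set W] s -> exists K, tail s K.
  move=> /WO sO; rewrite /tail /h; case: (n) (c) Oc s sO => [|m] c' Oc' s sO.
    by exists 0%N.
  have [K KP] := iter_sd_vanish Oo sO Oc'; exists K => k /KP kP /=.
  rewrite /sdT -(subdivT0 (1%:M : 'M[R]_m.+1)).
  apply: (subdivT_ext (S := simp m)); [exact: simp_bary_closed|exact: kP|].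
  exact: simp_rows1.
have bE s K : small [set W] s -> (N s <= K)%N -> b s = \sum_(k < K) h k s.
  move=> /tailP/NP sN NK; rewrite /b (big_ord_widen K (fun k => h k s)) //.
  rewrite big_mkcond /=; apply: eq_bigr => k _; case: ltnP => // Nk.
  by rewrite sN.
exists b.
  move=> s sO; rewrite /b big1 // => k _; rewrite /h.
  exact: (vanish_sdT' (vanish_iter_sd k Oc) sO).
move=> s sW.
have [K0 K0P] := iter_sd_vanish Oo (WO _ _ sW) Oc.
(* The coboundary at s sees finitely many faces. Taking K beyond all their cutoffs replaces [b] by
   the same partial sum on each of them. *)
have [K KK0 Kb] : exists2 K, (K0 <= K)%N & cobpre b s = \sum_(k < K) cobpre (h k) s.
  move: (n) (c) (h) (b) (N) bE s sW {K0P} => {n c Oc dc h tail N NP b tailP} [|n] c h b N bE s sW.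
    by exists K0 => //; rewrite big1.
  exists (K0 + \sum_(i < n.+2) N (s \o face i : singular R X n))%N; first exact: leq_addr.
  rewrite /= /coboundary exchange_big /=; apply: eq_bigr => i _.
  rewrite -mulrz_suml; congr (_ *~ _); apply: bE; first exact: small_face.
  by rewrite (bigD1 i) //= addnCA leq_addr.
rewrite cochainB Kb.
have := congr1 (fun f => f s) (iter_sd_telescope c K).
rewrite /= cochainB cochain_sum.
have -> : iter K (@sd R X n) c s = 0.
  by rewrite -ea_sfun1 K0P //; exact: simp_rows1.
rewrite subr0 => ->; rewrite -sumrB big1 // => k _.
rewrite cochainD addrK coboundary_iter_sd.
by apply: (vanish_sdT (vanish_iter_sd k dc)).
Qed.

End Space.
End Small.

(** * Pullbacks and homotopy invariance *)

Section Pull.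
Context {R : realType}.
Local Notation simp n := (stdsimplex R n).
Local Notation cochain X n := (cochain R X int n).

(** Since [ev] accepts any function, f may be discontinuous away from the simplices under study, as
    chart coordinates are. The lemmas ending in [_at] ask for continuity along one simplex only. *)
Definition pull (X Y : topologicalType) (f : X -> Y) n (c : cochain Y n) : cochain X n :=
  fun s => ev c (f \o s).

Section Props.
Context {X Y : topologicalType} (f : X -> Y).

Lemma pullB n (b c : cochain Y n) : pull f (b - c) = pull f b - pull f c.
Proof. by apply/funext => s; exact: (evB b c (f \o s)). Qed.

Lemma pull0 n : pull f (0 : cochain Y n) = 0.
Proof. by rewrite -[X in pull f X](subrr (0 : cochain Y n)) pullB subrr. Qed.

Lemma pullN n (c : cochain Y n) : pull f (- c) = - pull f c.
Proof. by rewrite -[- c]sub0r pullB pull0 sub0r. Qed.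

Lemma pullD n (b c : cochain Y n) : pull f (b + c) = pull f b + pull f c.
Proof. by rewrite -[c in LHS]opprK pullB pullN opprK. Qed.

Lemma pullMz n (c : cochain Y n) k : pull f (c *~ k) = pull f c *~ k.
Proof.
have E (m : nat) : pull f (c *+ m) = pull f c *+ m.
  by elim: m => [|m IH]; rewrite ?pull0 // !mulrS pullD IH.
by case: k => k; rewrite /intmul ?pullN E.
Qed.

Lemma pull_sum (I : Type) (r : seq I) (P : pred I) n (F : I -> cochain Y n) :
  pull f (\sum_(i <- r | P i) F i) = \sum_(i <- r | P i) pull f (F i).
Proof.
elim: r => [|i r IH]; first by rewrite !big_nil pull0.
by rewrite !big_cons; case: (P i); rewrite ?pullD IH.
Qed.

Lemma pull_cob_at n (c : cochain Y n) (s : singular R X n.+1) :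
  continuous (f \o s) -> pull f (coboundary c) s = coboundary (pull f c) s.
Proof. by move=> fc; rewrite /pull ev_coboundary. Qed.

Lemma pull_cobpre_at n (c : cochain Y n.-1) (s : singular R X n) :
  continuous (f \o s) -> pull f (cobpre c) s = cobpre (pull f c) s.
Proof. by case: n c s => [|n] c s fc; [rewrite /= pull0|exact: pull_cob_at]. Qed.

Definition fmap (S : set (set X)) (S' : set (set Y)) :=
  forall U, S U -> exists2 U', S' U' & forall x, U x -> U' (f x).

Lemma vanish_pull S S' n (c : cochain Y n) :
  fmap S S' -> vanish S' c -> vanish S (pull f c).
Proof.
move=> SS c0 s [U SU Us]; have [U' SU' UU] := SS _ SU.
rewrite /pull /ev; case: pselect => // fc; apply: c0.
by exists U' => // t; apply: UU; exact: Us.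
Qed.

Hypothesis fc : continuous f.

Lemma cont_comp_sing n (s : singular R X n) : continuous (f \o s).
Proof. by move=> t; apply: (@continuous_comp _ _ _ s f); [exact: cts_fun|exact: fc]. Qed.

Lemma pull_cob n (c : cochain Y n) : pull f (coboundary c) = coboundary (pull f c).
Proof. by apply/funext => s; apply: pull_cob_at; exact: cont_comp_sing. Qed.

Lemma pull_cobpre n (c : cochain Y n.-1) : pull f (@cobpre R Y n c) = cobpre (pull f c).
Proof. by apply/funext => s; apply: pull_cobpre_at; exact: cont_comp_sing. Qed.

Lemma bnd_pull S S' T T' n (c : cochain Y n) :
  fmap S S' -> fmap T T' -> bnd T' S' c -> bnd T S (pull f c).
Proof.
move=> SS TT [b b0 cb]; exists (pull f b); first exact: vanish_pull b0.
by rewrite -pull_cobpre -pullB; exact: vanish_pull cb.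
Qed.

End Props.

Lemma pull_comp_at (X Y Z : topologicalType) (f : X -> Y) (g : Y -> Z) n
    (c : cochain Z n) (s : singular R X n) :
  continuous (f \o s) -> pull f (pull g c) s = pull (g \o f) c s.
Proof. by move=> fc; rewrite {1}/pull evC. Qed.

Lemma pull_eq_at (X Y : topologicalType) (f g : X -> Y) n
    (c : cochain Y n) (s : singular R X n) :
  (forall t, f (s t) = g (s t)) -> pull f c s = pull g c s.
Proof. by move=> fg; rewrite /pull (_ : f \o s = g \o s) //; apply/funext => t; exact: fg. Qed.

Lemma pull_id_at (X : topologicalType) (f : X -> X) n
    (c : cochain X n) (s : singular R X n) :
  (forall t, f (s t) = s t) -> pull f c s = c s.
Proof.
by move=> fg; rewrite -[RHS]evE /pull (_ : f \o s = s :> (_ -> _)) //; apply/funext => t; exact: fg.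
Qed.

Section Homotopy.
Context {X Y : topologicalType} (F : X -> R -> Y).
Hypothesis Fc : continuous (fun p : X * R => F p.1 p.2).

Definition track n (s : simp n -> X) (v : 'rV[R]_(n.+1 + 1)) : Y :=
  F (sfun s (lsubmx v)) (rsubmx v ord0 ord0).

Definition cyl n : set 'rV[R]_(n.+1 + 1) :=
  [set v | simp n (lsubmx v) /\ 0 <= rsubmx v ord0 ord0 <= 1].

Definition hop n (c : cochain Y n.+1) : cochain X n :=
  fun s => prism (ea c (track s)) 1%:M.

Definition hop' n : cochain Y n -> cochain X n.-1 :=
  match n return cochain Y n -> cochain X n.-1 with
  | 0 => fun _ => 0
  | n'.+1 => fun c => hop c
  end.

Lemma lsubmx_mul m p q r (A : 'M[R]_(m, p)) (B : 'M[R]_(p, q + r)) :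
  lsubmx (A *m B) = A *m lsubmx B.
Proof. by apply/matrixP => i j; rewrite !mxE; apply: eq_bigr => k _; rewrite mxE. Qed.

Lemma rsubmx_mul m p q r (A : 'M[R]_(m, p)) (B : 'M[R]_(p, q + r)) :
  rsubmx (A *m B) = A *m rsubmx B.
Proof. by apply/matrixP => i j; rewrite !mxE; apply: eq_bigr => k _; rewrite mxE. Qed.

Lemma lsubmx_block p q r (w : 'M[R]_(r, p + 1)) (L : 'M[R]_(p, q)) :
  lsubmx (w *m block_mx L 0 0 (1%:M : 'M[R]_1)) = lsubmx w *m L.
Proof.
by rewrite -{1}(hsubmxK w) mul_row_block !mulmx0 addr0 row_mxKl.
Qed.

Lemma rsubmx_block p q r (w : 'M[R]_(r, p + 1)) (L : 'M[R]_(p, q)) :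
  rsubmx (w *m block_mx L 0 0 (1%:M : 'M[R]_1)) = rsubmx w.
Proof.
by rewrite -{1}(hsubmxK w) mul_row_block !mulmx0 mulmx1 add0r row_mxKr.
Qed.

Lemma cyl_rows n m (M : 'M[R]_(m.+1, n.+1 + 1)) : (forall i, cyl (row i M)) ->
  (forall i, simp n (row i (lsubmx M))) /\
  (forall i, 0 <= rsubmx M i ord0 <= 1).
Proof.
move=> SM; split=> i; have [] := SM i; last first.
  by move=> _; rewrite !mxE.
suff -> : lsubmx (row i M) = row i (lsubmx M) by [].
by apply/matrixP => a b; rewrite !mxE.
Qed.

Lemma cyl_convex n m (t : simp m) (M : 'M[R]_(m.+1, n.+1 + 1)) :
  (forall i, cyl (row i M)) -> cyl (set_val t *m M).
Proof.
move=> /cyl_rows[SM tM]; split.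
  by rewrite lsubmx_mul; exact: simp_convex.
rewrite rsubmx_mul mxE; apply/andP; split.
  by apply: sumr_ge0 => i _; rewrite mulr_ge0 ?simp_ge0 //; case/andP: (tM i).
rewrite -(simp_sum1 t); apply: ler_sum => i _.
by rewrite ler_piMr ?simp_ge0 //; case/andP: (tM i).
Qed.

Lemma acont_track n (s : singular R X n) : acont (@cyl n) (track s).
Proof.
move=> m M /cyl_rows[SM tM] t.
pose g (t : simp m) := (sfun s (set_val t *m lsubmx M), (set_val t *m rsubmx M) ord0 ord0).
have -> : (fun t : simp m => track s (set_val t *m M)) = (fun p => F p.1 p.2) \o g.
  by apply/funext => t'; rewrite /track /g /= lsubmx_mul rsubmx_mul.
apply: (@continuous_comp _ _ _ g (fun p => F p.1 p.2)); last exact: Fc.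
have h1 : {for t, continuous (fun t : simp m => sfun s (set_val t *m lsubmx M))}.
  exact: (acont_sing SM).
have h2 : {for t, continuous (fun t : simp m => (set_val t *m rsubmx M) ord0 ord0)}.
  apply: (@cont_entry _ _ _ _ (fun t : simp m => set_val t *m rsubmx M)).
  exact: simp_lin_continuous.
exact: (cvg_pair h1 h2).
Qed.

Lemma level_cyl n (t : R) v : 0 <= t <= 1 -> simp n v -> cyl (level (m := 0) t v).
Proof.
move=> t01 vS; split; first by rewrite row_mxKl.
by rewrite row_mxKr mxE.
Qed.

Lemma hop_coboundary n (c : cochain Y n.+1) (s : singular R X n.+1) :
  coboundary (hop c) s = abd (prism (ea c (track s))) 1%:M.
Proof.
rewrite /coboundary /abd; apply: eq_bigr => i _; congr (_ *~ _).
rewrite /hop -[row' i 1%:M]mul1mx -prism_nat.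
apply: (prism_ext (S := simp n) (S' := @cyl n)).
- by move=> v; apply: level_cyl; rewrite lexx ler01.
- by move=> v; apply: level_cyl; rewrite lexx ler01.
- move=> M SM; rewrite ?/pull; congr (ev _ _); apply/funext => t.
  have [vS _] := cyl_convex t SM.
  by rewrite /track sfun_face // mulmxA lsubmx_block rsubmx_block.
- exact: simp_rows1.
Qed.

Lemma hop_homotopy n (c : cochain Y n) :
  pull (F^~ 1) c - pull (F^~ 0) c = hop (coboundary c) + cobpre (hop' c).
Proof.
apply/funext => s.
have lev t : ea c (track s) (level t 1%:M) = pull (F^~ t) c s.
  rewrite ?/pull; congr (ev _ _); apply/funext => u; rewrite /track /level mul_mx_row row_mxKl row_mxKr.
  rewrite mulmx1 /sfun set_valK /= mxE; congr F.
  by under eq_bigr do rewrite mxE; rewrite -mulr_suml simp_sum1 mul1r.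
transitivity (pull (F^~ 1) c s - pull (F^~ 0) c s); first by [].
transitivity (hop (coboundary c) s + cobpre (hop' c) s); last by [].
rewrite -!lev -prism_homotopy; congr (_ + _).
  apply: (prism_ext (S := simp n) (S' := @cyl n)).
  - by move=> v; apply: level_cyl; rewrite lexx ler01.
  - by move=> v; apply: level_cyl; rewrite lexx ler01.
  - by move=> M SM; rewrite (ea_abd (S := @cyl n)) //; exact: acont_track.
  - exact: simp_rows1.
by case: n c s {lev} => [//|n] c s /=; rewrite hop_coboundary.
Qed.

Definition hmap (S : set (set X)) (S' : set (set Y)) :=
  forall U, S U -> exists2 U', S' U' & forall x t, U x -> 0 <= t <= 1 -> U' (F x t).

Lemma vanish_hop S S' n (c : cochain Y n.+1) :
  hmap S S' -> vanish S' c -> vanish S (hop c).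
Proof.
move=> SS c0 s [U SU Us]; have [U' SU' UU] := SS _ SU.
rewrite /hop -(prism0 (1%:M : 'M[R]_n.+1)).
apply: (prism_ext (S := simp n) (S' := @cyl n)).
- by move=> v; apply: level_cyl; rewrite lexx ler01.
- by move=> v; apply: level_cyl; rewrite lexx ler01.
- move=> M SM; rewrite /ea evC; first exact: acont_track.
  move=> fc; apply: c0; exists U' => // t.
  have [vS t01] := cyl_convex t SM.
  by apply: UU => //; exact: Us.
- exact: simp_rows1.
Qed.

Lemma vanish_hop' S S' n (c : cochain Y n) :
  hmap S S' -> vanish S' c -> vanish S (hop' c).
Proof. by case: n c => [|n] c SS c0 //; exact: vanish_hop c0. Qed.

Lemma homotopy_bnd S S' T T' n (c : cochain Y n) :
  hmap S S' -> hmap T T' -> vanish S' c -> vanish T' (coboundary c) ->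
  bnd T S (pull (F^~ 1) c - pull (F^~ 0) c).
Proof.
move=> SS TT c0 dc0; exists (hop' c); first exact: vanish_hop' c0.
by rewrite hop_homotopy addrK; exact: vanish_hop dc0.
Qed.

End Homotopy.
End Pull.

(** * Cohomology relative to coordinate half spaces *)

Section HalfSpaces.
Context {R : realType} (p q : nat).
Local Notation simp n := (stdsimplex R n).
Local Notation cochain X n := (cochain R X int n).
Local Notation X := 'M[R]_(p, q).
Local Notation index := ('I_p * 'I_q)%type.
Implicit Types (J : seq index) (j : index) (x : X).

Definition half j (b : bool) : set X :=
  [set x | if b then 0 < x j.1 j.2 else x j.1 j.2 < 0].

Definition halves J : set (set X) := [set U | exists j b, j \in J /\ U = half j b].

Definition all_space (Y : topologicalType) : set (set Y) := [set setT].
Arguments all_space : clear implicits.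

(** Restriction to the simplices inside U followed by extension by zero. It does not commute with
    the coboundary; the defect is what [orient] uses, as in a connecting homomorphism. *)
Definition cut (Y : topologicalType) (U : set Y) n (c : cochain Y n) : cochain Y n :=
  fun s => if pselect (forall t, U (s t)) then c s else 0.

(* For [n = size J], a generator of the cohomology of the space relative to the
   complement of the subspace where the coordinates in [J] vanish; zero for other [n]. *)
Fixpoint orient J n : cochain X n :=
  match J, n return cochain X n with
  | [::], 0 => fun=> 1
  | j :: J', n'.+1 => coboundary (cut (half j false) (@orient J' n'))
  | _, _ => 0
  end.
Arguments orient : clear implicits.

(** The step 1 + |x_j| exceeds |x_j|, so at time 1 every point has reached the half space of sign e,
    while the other coordinates are untouched. *)
Definition push j (e : R) x (t : R) : X :=
  x + (t * (1 + `|x j.1 j.2|) * e) *: delta_mx j.1 j.2.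

Lemma pushE j e x t k : push j e x t k.1 k.2 =
  if k == j then x j.1 j.2 + t * (1 + `|x j.1 j.2|) * e else x k.1 k.2.
Proof.
case: j k => a b [c d]; rewrite !mxE /= xpair_eqE.
by case: eqP => [->|_]; case: eqP => [->|_]; rewrite ?mulr1 // mulr0 addr0.
Qed.

Lemma push0 j e x : push j e x 0 = x.
Proof. by rewrite /push !mul0r scale0r addr0. Qed.

Lemma push_continuous j e : continuous (fun z : X * R => push j e z.1 z.2).
Proof.
move=> z; apply: cvg_mx => a b.
have c1 k l : {for z, continuous (fun y : X * R => y.1 k l)}.
  apply: (@cont_entry _ _ _ _ (fun y : X * R => y.1)).
  exact: cvg_fst.
have -> : (fun y : X * R => push j e y.1 y.2 a b) =
  (fun y => y.1 a b + y.2 * (1 + `|y.1 j.1 j.2|) * (e * (delta_mx j.1 j.2 : X) a b)).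
  by apply/funext => y; rewrite mxE [in LHS]mxE -!mulrA.
apply: continuousD; first exact: c1.
apply: continuousM; last exact: cst_continuous.
apply: continuousM; first exact: cvg_snd.
apply: continuousD; first exact: cst_continuous.
apply: (@continuous_comp _ _ _ (fun y : X * R => y.1 j.1 j.2) Num.norm); first exact: c1.
exact: norm_continuous.
Qed.

Lemma push1_half j x : half j true (push j 1 x 1) /\ half j false (push j (-1) x 1).
Proof.
rewrite /half /= !pushE eqxx; set y := x _ _; rewrite !mul1r mulr1 mulrN1.
have h1 := ler_norm (- y); have h2 := ler_norm y; rewrite normrN in h1.
by split; lra.
Qed.

Lemma push_half j e k b x t : k != j -> half k b x -> half k b (push j e x t).
Proof. by rewrite /half /= pushE => /negPf ->. Qed.

Lemma push_own j (b : bool) x t : 0 <= t -> half j b x ->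
  half j b (push j (if b then 1 else -1) x t).
Proof.
move=> t0; rewrite /half /= pushE eqxx.
have n0 : 0 <= t * (1 + `|x j.1 j.2|) by rewrite mulr_ge0 // addr_ge0.
case: b => h; first by rewrite mulr1 ltr_wpDr.
by rewrite mulrN1 ltr_wnDr // oppr_le0.
Qed.

Lemma hmap_push J j e : j \notin J -> hmap (push j e) (halves J) (halves J).
Proof.
move=> jJ U [k [b [kJ ->]]]; exists (half k b); first by exists k, b.
move=> x t Ux _; apply: push_half => //; apply/eqP => kj.
by rewrite kj (negPf jJ) in kJ.
Qed.

Section Cut.
Context {Y : topologicalType}.
Implicit Types U : set Y.

Lemma cut_in U n (c : cochain Y n) s : small [set U] s -> cut U c s = c s.
Proof. by move=> [V VU Us]; rewrite /cut; case: pselect => //; rewrite VU in Us. Qed.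

Lemma cut_out U V n (c : cochain Y n) s : U `&` V `<=` set0 ->
  small [set V] s -> cut U c s = 0.
Proof.
move=> UV [V' VV Vs]; rewrite VV in Vs; rewrite /cut; case: pselect => // Us.
have t : simp n by exact: (to_simp 0).
by case: (UV (s t)).
Qed.

Lemma vanish_cut U S n (c : cochain Y n) : vanish S c -> vanish S (cut U c).
Proof. by move=> Sc s sS; rewrite /cut; case: pselect => //= h; exact: Sc. Qed.

Lemma cob_ext U n (b c : cochain Y n) : vanish [set U] (b - c) ->
  vanish [set U] (coboundary b - coboundary c).
Proof. by move=> bc; rewrite -raddfB; exact: vanish_cob. Qed.

Lemma cobpre_ext U n (b c : cochain Y n.-1) : vanish [set U] (b - c) ->
  vanish [set U] (@cobpre R Y n b - cobpre c).
Proof. by move=> bc; rewrite -cobpreB; exact: vanish_cobpre. Qed.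

Lemma vanish_cut_sub U n (c : cochain Y n) : vanish [set U] (cut U c - c).
Proof. by move=> s sU; rewrite cochainB cut_in // subrr. Qed.

Lemma vanishU S T n (c : cochain Y n) : vanish S c -> vanish T c -> vanish (S `|` T) c.
Proof. by move=> Sc Tc s [U [SU|TU] Us]; [apply: Sc|apply: Tc]; exists U. Qed.

Lemma vanish_all n (c : cochain Y n) : vanish (@all_space Y) c <-> c = 0.
Proof.
split=> [c0|->] //; apply/funext => s; apply: c0.
by exists setT.
Qed.

End Cut.

Lemma half_disjoint j : half j false `&` half j true `<=` set0.
Proof. by move=> x [/= h1 h2]; have := lt_trans h1 h2; rewrite ltxx. Qed.

Lemma vanish_halves_cons j J n (c : cochain X n) :
  vanish (halves J) c -> vanish [set half j true] c -> vanish [set half j false] c ->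
  vanish (halves (j :: J)) c.
Proof.
move=> cJ cA cB s [U [k [b [+ ->]]] Us]; rewrite inE => /orP[/eqP kj|kJ].
  by subst k; case: b Us => Us; [apply: cA|apply: cB]; eexists.
by apply: cJ; exists (half k b) => //; exists k, b.
Qed.

Lemma vanish_consE j J n (c : cochain X n) : vanish (halves (j :: J)) c ->
  [/\ vanish (halves J) c, vanish [set half j true] c & vanish [set half j false] c].
Proof.
move=> cJ; split=> s [U SU Us]; apply: cJ; exists U => //.
- by case: SU => k [b [kJ ->]]; exists k, b; rewrite inE kJ orbT.
- by rewrite SU; exists j, true; rewrite mem_head.
- by rewrite SU; exists j, false; rewrite mem_head.
Qed.

Lemma orient_cocycle J n : coboundary (orient J n) = 0.
Proof.
case: J n => [|j J] [|n] /=; rewrite ?raddf0 ?coboundaryK //.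
apply/funext => s; rewrite /coboundary 2!big_ord_recl big_ord0 /=.
by rewrite expr0 expr1 addr0.
Qed.

(** On each side of the hyperplane the cut cochain agrees with a cocycle, namely [orient J n] on the
    negative side and 0 on the positive one, so its coboundary vanishes on both. *)
Lemma orient_vanish J n : vanish (halves J) (orient J n).
Proof.
elim: J n => [|j J IH] n; first by move=> s [U [k [b []]]].
case: n => [|n] //; apply: vanish_halves_cons => /=.
- by apply: vanish_cob; exact: vanish_cut.
- by apply: vanish_cob => s; exact: cut_out (@half_disjoint j).
- rewrite -[coboundary _]subr0 -(orient_cocycle J n).
  by apply: cob_ext; exact: vanish_cut_sub.
Qed.

Lemma orient_neq J n : n != size J -> orient J n = 0.
Proof.
elim: J n => [|j J IH] [|n] //= nJ.
rewrite IH // (_ : cut _ _ = 0) ?raddf0 //.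
by apply/funext => s; rewrite /cut; case: pselect.
Qed.

Lemma push_continuous1 j e t : continuous ((push j e)^~ t).
Proof.
move=> x; apply: (@continuous_comp _ _ _ (fun x => (x, t)) (fun z : X * R => push j e z.1 z.2)).
  have h : {for x, continuous (fun _ : X => t)} by exact: cst_continuous.
  exact: (cvg_pair cvg_id h).
exact: push_continuous.
Qed.

(* Pushing along [j] moves everything into the half space [x_j > 0]. *)
Lemma half_acyclic j J n (c : cochain X n) : j \notin J ->
  vanish (halves J) c -> vanish [set half j true] c -> coboundary c = 0 ->
  exists b : cochain X n.-1,
    [/\ vanish (halves J) b, vanish [set half j true] b & c = cobpre b].
Proof.
move=> jJ cJ cA dc.
pose S := halves J `|` [set half j true].
have cS : vanish S c by exact: vanishU.
have SS : hmap (push j 1) S S.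
  move=> U [/(hmap_push 1 jJ)[V SV UV]|->]; first by exists V => //; left.
  exists (half j true); first by right.
  by move=> x t xj /andP[t0 _]; exact: (push_own (b := true)).
have TT : hmap (push j 1) (all_space X) (all_space X) by move=> U _; exists setT.
have := homotopy_bnd (@push_continuous j 1) SS TT cS.
rewrite dc => /(_ (@vanish0 _ _ _ _)) [b bS /vanish_all].
have -> : pull ((push j 1)^~ 1) c = 0.
  apply/funext => s; rewrite /pull /ev; case: pselect => // fc.
  by apply: cA; eexists => // t; have [] := push1_half j (s t).
have -> : pull ((push j 1)^~ 0) c = c.
  by apply/funext => s; apply: pull_id_at => t; exact: push0.
rewrite sub0r => /eqP; rewrite subr_eq0 => /eqP cb.
exists (- b); split.
- by move=> s [U SU Us]; rewrite cochainN bS ?oppr0 //; exists U => //; left.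
- by move=> s [U SU Us]; rewrite cochainN bS ?oppr0 //; exists U => //; right.
- by rewrite cobpreN -cb opprK.
Qed.

Lemma contract_continuous : continuous (fun z : X * R => z.2 *: z.1).
Proof.
move=> z; apply: cvg_mx => a b.
have -> : (fun y : X * R => (y.2 *: y.1) a b) = (fun y => y.2 * y.1 a b).
  by apply/funext => y; rewrite mxE.
apply: continuousM; first exact: cvg_snd.
apply: (@cont_entry _ _ _ _ (fun y : X * R => y.1)).
exact: cvg_fst.
Qed.

Lemma pull_const n (c : cochain X n) : exists k : int, pull (fun _ : X => (0 : X)) c = fun=> k.
Proof.
pose k := ev c (fun=> (0 : X)); exists k; apply/funext => s; rewrite /pull /k.
by congr ev.
Qed.

Lemma sum_sign n : \sum_(i < n) (-1) ^+ i = (odd n)%:R :> int.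
Proof.
elim: n => [|n IH]; first by rewrite big_ord0.
by rewrite big_ord_recr /= IH -signr_odd; case: (odd n).
Qed.

Lemma cob_const n (k : int) :
  coboundary (fun=> k : int) = (fun=> k *~ (odd n)%:R) :> cochain X n.+1.
Proof.
apply/funext => s; rewrite /coboundary.
have -> : (odd n)%:R = (odd n.+2)%:R :> int by rewrite /= negbK.
rewrite -sum_sign.
rewrite mulrzz mulr_sumr; apply: eq_bigr => i _; exact: mulrzz.
Qed.

(** Scaling to the origin makes a cocycle cohomologous to a constant cochain. By [cob_const], a
    constant of odd degree is a cocycle only if it is zero, and a constant of positive even degree
    is the coboundary of the same constant. *)
Lemma contractible n (c : cochain X n) : coboundary c = 0 ->
  match n return cochain X n -> Prop with
  | 0 => fun c => exists k : int, c = fun=> k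
  | n'.+1 => fun c => exists b, c = coboundary b
  end c.
Proof.
move=> dc.
have SS : hmap (fun (x : X) t => t *: x) set0 set0 by [].
have TT : hmap (fun (x : X) t => t *: x) (all_space X) (all_space X) by move=> U _; exists setT.
have := homotopy_bnd contract_continuous SS TT (_ : vanish set0 c).
rewrite dc => h; have {h} [] := h _ (@vanish0 _ _ _ _).
  by move=> s [].
move=> b _ /vanish_all.
have -> : pull ((fun (x : X) t => t *: x)^~ 1) c = c.
  by apply/funext => s; apply: pull_id_at => t; exact: scale1r.
have -> : (fun (x : X) t => t *: x)^~ 0 = fun=> (0 : X) by apply/funext => x; rewrite scale0r.
have dp : coboundary (pull (fun _ : X => (0 : X)) c) = 0.
  rewrite -pull_cob ?dc ?pull0 //; exact: cst_continuous.
have [k ck] := pull_const c.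
rewrite ck in dp *; rewrite cob_const in dp.
case: n c dc b dp {ck SS TT} => [|n] c dc b dp /eqP; rewrite subr_eq0 => /eqP cb.
  by exists k; rewrite -[LHS](subrK (fun=> k : int)) cb add0r.
have k0 : k *~ (odd n.+1)%:R = 0.
  have s : singular R X n.+2 by exact: (mksing (@cst_continuous _ _ (0 : X))).
  exact: (congr1 (fun f => f s) dp).
case on : (odd n) k0 => k0.
  exists (b + (fun=> k)); rewrite raddfD /= -[LHS](subrK (fun=> k : int)) cb.
  by rewrite cob_const on.
exists b; rewrite -[LHS](subrK (fun=> k : int)) cb.
move: k0; rewrite /= on /= mulr1z => ->.
exact: addr0.
Qed.

End HalfSpaces.

(** * The generator relative to half spaces *)

Section HalfSpaceCohomology.
Context {R : realType} (p q : nat).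
Local Notation cochain X n := (cochain R X int n).
Local Notation X := 'M[R]_(p, q).
Local Notation index := ('I_p * 'I_q)%type.
Implicit Types (J : seq index) (j : index) (x : X).
Local Notation orient J n := (@orient R p q J n).
Local Notation halves := (@halves R p q).

Definition coordwise J (e : index -> int) (f : X -> X) :=
  forall j x, j \in J -> f x j.1 j.2 = x j.1 j.2 *~ e j.

Lemma fmap_coordwise J e f : (forall j, j \in J -> e j = 1 \/ e j = -1) ->
  coordwise J e f -> fmap f (halves J) (halves J).
Proof.
move=> e1 fe U [j [b [jJ ->]]].
have [ej|ej] := e1 _ jJ.
  exists (half j b); first by exists j, b.
  by move=> x; rewrite /half /= fe // ej mulr1z.
exists (half j (~~ b)); first by exists j, (~~ b).
by move=> x; rewrite /half /= fe // ej mulrN1z; case: b; rewrite /= ?oppr_gt0 ?oppr_lt0.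
Qed.

(** The error z comes only from simplices that lie in neither of the two half spaces of j. *)
Lemma cut_cobpre j n (b : cochain X n.-1) (J : seq index) :
  vanish (halves J) b ->
  exists2 z : cochain X n, vanish (halves (j :: J)) z &
    cut (half j false) (cobpre b) = cobpre (cut (half j false) b) + z.
Proof.
move=> bJ; exists (cut (half j false) (cobpre b) - cobpre (cut (half j false) b)).
  apply: vanish_halves_cons.
  - apply: vanishB; first by apply: vanish_cut; exact: vanish_cobpre.
    by apply: vanish_cobpre; exact: vanish_cut.
  - apply: vanishB; first by move=> s; exact: cut_out (@half_disjoint _ _ _ j).
    by apply: vanish_cobpre => s; exact: cut_out (@half_disjoint _ _ _ j).
  - rewrite (_ : _ - _ = (cut (half j false) (cobpre b) - cobpre b) -
      (cobpre (cut (half j false) b) - cobpre b)); last by rewrite opprB addrA subrK.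
    by apply: vanishB; [|apply: cobpre_ext]; exact: vanish_cut_sub.
by rewrite addrC subrK.
Qed.

Lemma pull_cut (Y Z : topologicalType) (f : Y -> Z) (U : set Z) n (c : cochain Z n) :
  continuous f -> pull f (cut U c) = cut (f @^-1` U) (pull f c).
Proof.
move=> fc; apply/funext => s; have fsc := cont_comp_sing fc (s := s).
by rewrite /pull (evC _ fsc) /cut (evC _ fsc).
Qed.

Lemma cutMz (Y : topologicalType) (U : set Y) n (c : cochain Y n) k :
  cut U (c *~ k) = cut U c *~ k.
Proof.
apply/funext => s; rewrite cochainMz /cut; case: pselect => h; rewrite ?mul0rz //.
exact: cochainMz.
Qed.

Lemma cutD (Y : topologicalType) (U : set Y) n (b c : cochain Y n) :
  cut U (b + c) = cut U b + cut U c.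
Proof. by apply/funext => s; rewrite cochainD /cut; case: pselect => h; rewrite ?addr0. Qed.

Lemma cut_pos j J n (c : cochain X n) : vanish (halves J) c ->
  exists2 z : cochain X n, vanish (halves (j :: J)) z &
    cut (half j true) c = c - cut (half j false) c + z.
Proof.
move=> cJ; exists (cut (half j true) c - (c - cut (half j false) c)).
  have dj := @half_disjoint R p q j.
  have dj' : half j true `&` half j false `<=` (@set0 X) by rewrite setIC.
  apply: vanish_halves_cons.
  - apply: vanishB; first exact: vanish_cut.
    by apply: vanishB => //; exact: vanish_cut.
  - move=> s sj; rewrite !cochainB cut_in // (cut_out _ dj sj) subr0 subrr //.
  - move=> s sj; rewrite !cochainB (cut_out _ dj' sj) cut_in // subrr subr0 //.
by rewrite addrC subrK.
Qed.

(** Reversing the coordinate j exchanges the two half spaces. The cuts of a cocycle to them add up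
    to that cocycle modulo relative cochains ([cut_pos]), so their coboundaries are opposite: each
    reversed coordinate contributes a sign. *)
Lemma orient_coordwise J n e f : (forall j, j \in J -> e j = 1 \/ e j = -1) ->
  coordwise J e f -> continuous f ->
  exists2 b : cochain X n.-1, vanish (halves J) b &
    pull f (orient J n) = orient J n *~ (\prod_(j <- J) e j) + cobpre b.
Proof.
move=> e1 fe fc; elim: J n e1 fe => [|j J IH] n e1 fe.
  exists 0; first by move=> s [U [k [b []]]].
  rewrite big_nil mulr1z cobpre0 addr0; case: n => [|n] /=; last exact: pull0.
  by apply/funext => s; rewrite /pull evC //; exact: cont_comp_sing.
case: n => [|n]; first by exists 0; rewrite //= pull0 mul0rz addr0.
have e1J k : k \in J -> e k = 1 \/ e k = -1 by move=> kJ; apply: e1; rewrite inE kJ orbT.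
have feJ : coordwise J e f by move=> k x kJ; apply: fe; rewrite inE kJ orbT.
have [b bJ pE] := IH n e1J feJ.
rewrite big_cons /= pull_cob // pull_cut //; set E := \prod_(_ <- _) _ in pE *.
have [z zJ zE] := cut_cobpre j bJ.
have ej := e1 j (mem_head _ _).
have fU : f @^-1` half j false = half j (e j != 1).
  apply/seteqP; split => x; rewrite /half /= fe ?mem_head //;
  by case: ej => ->; rewrite /= ?mulr1z ?mulrN1z ?oppr_lt0.
have core : coboundary (cut (half j false) (pull f (orient J n))) =
    coboundary (cut (half j false) (orient J n)) *~ E + coboundary z.
  by rewrite pE cutD cutMz zE !raddfD /= cob_cobpre add0r raddfMz.
rewrite fU; case: ej => -> /=.
  by exists z => //; rewrite core mul1r.
have pJ : vanish (halves J) (pull f (orient J n)).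
  by apply: vanish_pull (@orient_vanish _ _ _ J n); exact: fmap_coordwise feJ.
have [w wJ ->] := cut_pos j pJ.
exists (w - z); first exact: vanishB.
rewrite raddfD raddfB /= core -pull_cob // orient_cocycle pull0 sub0r opprD.
rewrite mulN1r mulrNz raddfB /= -addrA; congr (_ + _); exact: addrC.
Qed.

(** Acyclicity of the positive side writes c as the coboundary of some h. On the negative side h is
    a cocycle relative to J; pushing into that side extends it to the whole space, where the
    induction hypothesis provides k. *)
Theorem orient_generates J n (c : cochain X n) : uniq J ->
  vanish (halves J) c -> coboundary c = 0 ->
  exists k, exists2 b : cochain X n.-1, vanish (halves J) b &
    c = orient J n *~ k + cobpre b.
Proof.
elim: J n c => [|j J IH] n c.
  move=> _ _ dc; have vn m (z : cochain X m) : vanish (halves [::]) z.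
    by move=> s [U [k [b []]]].
  have := contractible dc; case: n c dc => [|n] c dc [k ck].
    exists k, 0 => //; rewrite ck /= addr0; apply/funext => s.
    by rewrite cochainMz /= intz.
  by exists 0, k => //; rewrite mulr0z add0r.
rewrite cons_uniq => /andP[jJ uJ] /vanish_consE[cJ cA cB] dc.
have [h [hJ hA ch]] := half_acyclic jJ cJ cA dc.
case: n c cJ cA cB dc h hJ hA ch => [|n] c cJ cA cB dc h hJ hA ch.
  by exists 0, 0 => //; rewrite mulr0z add0r.
change (n.+1.-1) with n in *.
pose G := push j (-1 : R).
have Gc := @push_continuous R p q j (-1).
have SS := @hmap_push R p q J j (-1) jJ.
have BB : hmap G [set half j false] [set half j false].
  move=> U ->; exists (half j false) => // x t xj /andP[t0 _].
  exact: (push_own (b := false)).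
have TT : hmap G [set half j false] [set half j false] by [].
have G1c : continuous (G^~ 1) by exact: push_continuous1.
have G1B x : half j false (G x 1) by have [] := push1_half j x.
have dh : vanish [set half j false] (coboundary h) by rewrite -[coboundary h]/(@cobpre R X n.+1 h) -ch.
have [h' h'J hh'] := homotopy_bnd Gc SS BB hJ dh.
have pG0 m (z : cochain X m) : pull (G^~ 0) z = z.
  by apply/funext => s; apply: pull_id_at => t; exact: push0.
rewrite pG0 in hh'.
have dg : coboundary (pull (G^~ 1) h) = 0.
  rewrite -pull_cob // -[coboundary h]/(@cobpre R X n.+1 h) -ch.
  apply/funext => s; rewrite /pull /ev; case: pselect => // fc.
  by apply: cB; exists (half j false) => // t; exact: G1B.
have gJ : vanish (halves J) (pull (G^~ 1) h).
  apply: vanish_pull hJ => U /SS[V JV UV]; exists V => // x Ux.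
  by apply: UV => //; rewrite ler01 lexx.
have [k [e eJ gE]] := IH _ _ uJ gJ dg.
exists k.
(* By construction w has coboundary c minus k times the generator. The last term cancels, on the
   negative side, the homotopy h' of the push and the coboundary part e of the induction
   hypothesis. *)
pose w := h - cut (half j false) (orient J n) *~ k - cobpre (cut (half j false) (e - h')).
exists w; last first.
  rewrite /w /= !raddfB /= raddfMz /= cob_cobpre subr0.
  by rewrite -[coboundary h]/(@cobpre R X n.+1 h) -ch addrC subrK.
have ehJ : vanish (halves J) (e - h') by exact: vanishB.
have dj := @half_disjoint R p q j.
apply: vanish_halves_cons.
- apply: vanishB; [apply: vanishB => //|].
    by apply: vanishMz; apply: vanish_cut; exact: orient_vanish.
  by apply: vanish_cobpre; exact: vanish_cut.
- apply: vanishB; [apply: vanishB => //|].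
    by apply: vanishMz => s; exact: cut_out.
  by apply: vanish_cobpre => s; exact: cut_out.
- have -> : w = - (pull (G^~ 1) h - h - cobpre h') -
     (cut (half j false) (orient J n) - orient J n) *~ k -
     (cobpre (cut (half j false) (e - h')) - cobpre (e - h')).
    rewrite /w gE cobpreB mulrzBl.
    set a := orient J n *~ k; set b := _ *~ k; set x := cobpre e; set y := cobpre h'.
    set u := cobpre _.
    apply/funext => s; rewrite !(cochainB, cochainD, cochainN); ring.
  apply: vanishB; [apply: vanishB|].
  + exact: vanishN.
  + by apply: vanishMz; exact: vanish_cut_sub.
  + by apply: cobpre_ext; exact: vanish_cut_sub.
Qed.

(** The cut generator times k, minus b, is a cocycle vanishing on the positive side, hence a
    coboundary. Pulled back by the push into the negative side, where b is zero, it becomes k times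
    the generator for J, up to a coboundary. *)
Theorem orient_nontrivial J k (b : cochain X (size J).-1) : uniq J ->
  vanish (halves J) b -> orient J (size J) *~ k = cobpre b -> k = 0.
Proof.
elim: J b => [|j J IH] b.
  move=> _ _ /= h; have s : singular R X 0 by exact: (mksing (@cst_continuous _ _ (0 : X))).
  by have := congr1 (fun f => f s) h; rewrite /= cochainMz intz.
rewrite cons_uniq => /andP[jJ uJ] /vanish_consE[bJ bA bB] /= kb.
pose h := cut (half j false) (orient J (size J)) *~ k - b.
have dj := @half_disjoint R p q j.
have hJ : vanish (halves J) h.
  apply: vanishB => //; apply: vanishMz; apply: vanish_cut; exact: orient_vanish.
have hA : vanish [set half j true] h.
  by apply: vanishB => //; apply: vanishMz => s; exact: cut_out.
have dh : coboundary h = 0 by rewrite raddfB raddfMz /= kb subrr.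
have [e [eJ eA he]] := half_acyclic jJ hJ hA dh.
pose G := (push j (-1 : R))^~ 1.
have Gc : continuous G by exact: push_continuous1.
have GB x : half j false (G x) by have [] := push1_half j x.
have Gco : coordwise J (fun=> 1) G.
  by move=> l x lJ; rewrite pushE mulr1z; case: eqP => // lj; rewrite lj (negPf jJ) in lJ.
have [|z zJ pE] := orient_coordwise (size J) _ Gco Gc; first by left.
rewrite big1_seq // mulr1z in pE.
have ph : pull G h = pull G (orient J (size J)) *~ k.
  apply/funext => s; rewrite -pullMz /pull !evC; try exact: cont_comp_sing.
  move=> fc1 fc2.
  have sB : small [set half j false] (mksing fc1) by exists (half j false) => // t; exact: GB.
  have -> : mksing fc2 = mksing fc1 by apply/continuousEP.
  transitivity ((cut (half j false) (orient J (size J)) *~ k) (mksing fc1) - b (mksing fc1)); first by [].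
  by rewrite bB // subr0 !cochainMz cut_in.
apply: (IH (pull G e - z *~ k)) => //.
  apply: vanishB; last exact: vanishMz.
  by apply: vanish_pull eJ; apply: (fmap_coordwise _ Gco); left.
rewrite cobpreB cobpreMz -pull_cobpre // -he ph pE.
rewrite mulrzDl addrK //.
Qed.

End HalfSpaceCohomology.

(** * From half spaces to charts *)

Section Transfer.
Context {R : realType}.
Local Notation cochain X n := (cochain R X int n).

Section Triple.
Context {X : topologicalType}.
Implicit Types T S Z : set (set X).

Lemma bndB T S n (b c : cochain X n) : bnd T S b -> bnd T S c -> bnd T S (b - c).
Proof.
move=> [x xS xT] [y yS yT]; exists (x - y); first exact: vanishB.
rewrite cobpreB (_ : _ - _ = b - cobpre x - (c - cobpre y)); first exact: vanishB.
by apply/funext => s; rewrite !(cochainB, cochainD, cochainN); ring.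
Qed.

Lemma bnd0 T S n : bnd T S (0 : cochain X n).
Proof. by exists 0 => // s _; rewrite cobpre0 subr0. Qed.

Lemma bndN T S n (c : cochain X n) : bnd T S c -> bnd T S (- c).
Proof. by move=> h; rewrite -sub0r; apply: bndB h; exact: bnd0. Qed.

Lemma bndD T S n (b c : cochain X n) : bnd T S b -> bnd T S c -> bnd T S (b + c).
Proof. by move=> hb hc; rewrite -[c]opprK; apply: bndB => //; exact: bndN. Qed.

Lemma bndMz T S n (c : cochain X n) k : bnd T S c -> bnd T S (c *~ k).
Proof.
move=> [b bS bT]; exists (b *~ k); first exact: vanishMz.
by rewrite cobpreMz -mulrzBl; exact: vanishMz.
Qed.

Lemma bnd_sum T S n (I : Type) (r : seq I) (P : pred I) (F : I -> cochain X n) :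
  (forall i, P i -> bnd T S (F i)) -> bnd T S (\sum_(i <- r | P i) F i).
Proof.
by move=> h; elim/big_rec: _ => [|i x Pi xb]; [exact: bnd0|apply: bndD => //; exact: h].
Qed.

Lemma bnd_cobpre T S n (b : cochain X n.-1) : vanish S b -> bnd T S (cobpre b).
Proof. by move=> bS; exists b => // s _; rewrite subrr. Qed.

Lemma bnd_vanish T S n (c : cochain X n) : vanish T c -> bnd T S c.
Proof. by move=> cT; exists 0 => //; rewrite cobpre0 subr0. Qed.

Lemma bnd_sub T S S' n (c : cochain X n) :
  (forall m (b : cochain X m), vanish S b -> vanish S' b) -> bnd T S c -> bnd T S' c.
Proof. by move=> SS [b bS cb]; exists b => //; exact: SS. Qed.

Lemma bnd_res T T' S n (c : cochain X n) :
  (forall m (b : cochain X m), vanish T b -> vanish T' b) -> bnd T S c -> bnd T' S c.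
Proof. by move=> TT [b bS cb]; exists b => //; exact: TT. Qed.

(* [S] generates the relative cohomology that [Z] does, since the cohomology
   of [Z] relative to [S] vanishes. *)
Lemma bnd_excise T Z S n (c : cochain X n) :
  (forall m (b : cochain X m), vanish T b -> vanish Z b) ->
  (forall m (b : cochain X m), vanish S b -> vanish Z (coboundary b) -> bnd Z S b) ->
  (forall m (b : cochain X m), vanish Z b -> vanish S b) ->
  vanish Z c -> bnd T S c -> bnd T Z c.
Proof.
move=> TZ acy ZS cZ [b bS cb]; case: n c cZ b bS cb => [|n] c cZ b bS cb.
  by exists 0.
have db : vanish Z (coboundary b).
  rewrite -[coboundary b](subKr c); apply: vanishB => //.
  exact: TZ cb.
have [b' b'S bb'] := acy _ _ bS db.
exists (b - cobpre b') => //.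
by rewrite /= raddfB /= cob_cobpre subr0.
Qed.

End Triple.

Section Punctured.
Context (p q : nat) (J : seq ('I_p * 'I_q)).
Hypothesis uJ : uniq J.
Local Notation M := 'M[R]_(p, q).
Local Notation orient J n := (@orient R p q J n).
Local Notation Z := [set x : M | exists2 j, j \in J & x j.1 j.2 != 0].

Lemma halves_bigcup : \bigcup_(U in halves J) U = Z.
Proof.
apply/seteqP; split=> [x [U [j [b [jJ ->]]] Ux]|x [j jJ xj]] /=.
  by exists j => //; move: Ux; rewrite /half /=; case: b => h; rewrite ?(gt_eqF h) ?(lt_eqF h).
exists (half j (0 < x j.1 j.2)); first by exists j, (0 < x j.1 j.2).
by rewrite /half /=; case: ltgtP xj.
Qed.

Lemma halves_open (U : set M) : halves J U -> open U.
Proof.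
move=> [j [b [_ ->]]].
have cj : continuous (fun x : M => x j.1 j.2) by move=> x; exact: coord_continuous.
case: b; rewrite /half.
  exact: (open_comp (fun x _ => cj x) (@open_gt R 0)).
exact: (open_comp (fun x _ => cj x) (@open_lt R 0)).
Qed.

Lemma halves_acyclic m (b : cochain M m) :
  vanish (halves J) b -> vanish [set Z] (coboundary b) -> bnd [set Z] (halves J) b.
Proof. rewrite -halves_bigcup; exact: small_simplices halves_open. Qed.

Lemma halves_sub m (b : cochain M m) : vanish [set Z] b -> vanish (halves J) b.
Proof.
move=> bZ s [U UJ Us]; apply: bZ; exists Z => // t.
by rewrite -halves_bigcup; exists U.
Qed.

Lemma all_sub (Y : topologicalType) (S : set (set Y)) m (b : cochain Y m) :
  vanish (@all_space Y) b -> vanish S b.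
Proof. by move=> /vanish_all ->. Qed.

Lemma punctured_excise n (c : cochain M n) : vanish [set Z] c ->
  bnd (@all_space M) (halves J) c -> bnd (@all_space M) [set Z] c.
Proof.
apply: bnd_excise; [|exact: halves_acyclic|exact: halves_sub].
by move=> m b; exact: all_sub.
Qed.

Definition signs (e : 'I_p * 'I_q -> int) := forall j, j \in J -> e j = 1 \/ e j = -1.

Lemma punctured_class n : exists th : cochain M n,
  [/\ vanish [set Z] th, coboundary th = 0,
   (forall c, vanish [set Z] c -> coboundary c = 0 ->
      exists k, bnd (@all_space M) [set Z] (c - th *~ k)),
   (n = size J -> forall k, bnd (@all_space M) [set Z] (th *~ k) -> k = 0) &
   (n != size J -> bnd (@all_space M) [set Z] th) /\
   (forall e f, signs e -> coordwise J e f -> continuous f ->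
      bnd (@all_space M) [set Z] (pull f th - th *~ (\prod_(j <- J) e j)))].
Proof.
have oJ := @orient_vanish R p q J n.
have [|b bJ bZ] := @halves_acyclic _ (orient J n) oJ.
  by rewrite orient_cocycle.
(* [orient] vanishes only on simplices inside a single half space; the correction makes it vanish on
   all simplices of their union. *)
pose th := orient J n - cobpre b.
have thb c : bnd (@all_space M) (halves J) (c - th) -> bnd (@all_space M) (halves J) (c - orient J n).
  move=> h; rewrite (_ : c - _ = c - th - cobpre b).
    by apply: bndB => //; exact: bnd_cobpre.
  by apply/funext => s; rewrite /th !(cochainB, cochainD, cochainN); ring.
have thoJ : bnd (@all_space M) (halves J) (th - orient J n).
  by apply: thb; rewrite subrr; exact: bnd0.
have bZ' : vanish [set Z] th by exact: bZ.
exists th; split => //.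
- by rewrite raddfB /= orient_cocycle cob_cobpre subrr.
- move=> c cZ dc; have [k [y yJ cE]] := orient_generates uJ (halves_sub cZ) dc.
  exists k; apply: punctured_excise; first by apply: vanishB => //; exact: vanishMz.
  rewrite (_ : _ - _ = cobpre y - (th - orient J n) *~ k).
    by apply: bndB; [exact: bnd_cobpre|exact: bndMz].
  by rewrite mulrzBl opprB addrA [_ + orient _ _ *~ _]addrC -cE.
- move=> nJ k [y yZ /vanish_all ky]; subst n.
  have := @orient_nontrivial R p q J k (y + b *~ k) uJ; apply.
    by apply: vanishD; [exact: halves_sub|exact: vanishMz].
  rewrite cobpreD cobpreMz; apply/eqP; rewrite -subr_eq0 opprD addrA addrAC.
  by rewrite -mulrzBl ky.
- split=> [nJ|e f e1 fe fc].
    apply: punctured_excise => //.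
    by rewrite -[th]subr0 -(@orient_neq R p q J n nJ).
  have fJ := fmap_coordwise e1 fe.
  have fZ : fmap f [set Z] [set Z].
    move=> U ->; exists Z => // x [j jJ xj]; exists j => //; rewrite fe //.
    by have [->|->] := e1 _ jJ; rewrite ?mulr1z // mulrN1z oppr_eq0.
  apply: punctured_excise.
    by apply: vanishB; [exact: vanish_pull bZ'|exact: vanishMz].
  have [y yJ pE] := orient_coordwise n e1 fe fc.
  set E := \prod_(_ <- _) _ in pE *.
  rewrite (_ : _ - _ = cobpre (y - pull f b + b *~ E)).
    apply: bnd_cobpre; apply: vanishD; last exact: vanishMz.
    by apply: vanishB => //; exact: vanish_pull bJ.
  rewrite /th pullB pE pull_cobpre // cobpreD cobpreB cobpreMz mulrzBl.
  by apply/funext => s; rewrite !(cochainB, cochainD, cochainN); ring.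
Qed.

End Punctured.

Section Chart.
Context {X : topologicalType} (p q : nat) (J : seq ('I_p * 'I_q)).
Local Notation M := 'M[R]_(p, q).
Local Notation Z := [set x : M | exists2 j, j \in J & x j.1 j.2 != 0].
Context (V V' : set X) (sigma : M -> X) (tau : X -> M).
Hypothesis uJ : uniq J.
Hypothesis sigma_cont : continuous sigma.
Hypothesis sigmaV : forall x, V (sigma x).
Hypothesis tau_cont : forall x, V x -> {for x, continuous tau}.
Hypothesis sigmaK : forall x, V x -> sigma (tau x) = x.
Hypothesis tauK : forall x j, j \in J -> tau (sigma x) j.1 j.2 = x j.1 j.2.
Hypothesis VZ : forall x, V' (sigma x) <-> Z x.

Lemma tau_sing n (s : singular R X n) : small [set V] s -> continuous (tau \o s).
Proof.
move=> [U UV Us] t; rewrite UV in Us.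
by apply: (@continuous_comp _ _ _ s tau); [exact: cts_fun|exact: tau_cont].
Qed.

Lemma tau_sigma_cont (g : X -> X) : continuous g -> (forall x, V x -> V (g x)) ->
  continuous (fun x => tau (g (sigma x))).
Proof.
move=> gc gV x.
apply: (@continuous_comp _ _ _ (fun x => g (sigma x)) tau).
  by apply: (@continuous_comp _ _ _ sigma g); [exact: sigma_cont|exact: gc].
exact/tau_cont/gV/sigmaV.
Qed.

Lemma vanish_tau n (c : cochain M n) : vanish [set Z] c -> vanish [set V `&` V'] (pull tau c).
Proof.
apply: vanish_pull => U ->; exists Z => // x [Vx V'x].
by apply/VZ; rewrite sigmaK.
Qed.

Lemma vanish_sigma n (c : cochain X n) : vanish [set V `&` V'] c -> vanish [set Z] (pull sigma c).
Proof.
apply: vanish_pull => U ->; exists (V `&` V') => // x Zx.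
by split => //; apply/VZ.
Qed.

Lemma bnd_tau n (c : cochain M n) (c' : cochain X n) :
  bnd (@all_space M) [set Z] c -> vanish [set V] (c' - pull tau c) ->
  bnd [set V] [set V `&` V'] c'.
Proof.
move=> [b bZ /vanish_all/eqP]; rewrite subr_eq0 => /eqP cb cc.
exists (pull tau b); first exact: vanish_tau.
move=> s sV; rewrite cochainB -pull_cobpre_at; last exact: tau_sing.
by rewrite -cb -cochainB cc.
Qed.

Lemma local_class n : exists th : cochain X n,
  [/\ vanish [set V `&` V'] th, vanish [set V] (coboundary th),
   (forall c, vanish [set V `&` V'] c -> vanish [set V] (coboundary c) ->
      exists k, bnd [set V] [set V `&` V'] (c - th *~ k)),
   (n = size J -> forall k, bnd [set V] [set V `&` V'] (th *~ k) -> k = 0) &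
   (n != size J -> bnd [set V] [set V `&` V'] th) /\
   (forall e g, signs J e -> continuous g -> (forall x, V x -> V (g x)) ->
      (forall x, V' x -> V' (g x)) ->
      (forall x j, j \in J -> tau (g (sigma x)) j.1 j.2 = x j.1 j.2 *~ e j) ->
      bnd [set V] [set V `&` V'] (pull g th - th *~ (\prod_(j <- J) e j)))].
Proof.
have [th [thZ dth gen inj [th0 sgn]]] := punctured_class uJ n.
exists (pull tau th); split.
- exact: vanish_tau.
- move=> s sV; rewrite -pull_cob_at ?dth ?pull0 //; exact: tau_sing.
- move=> c cV dc.
  have [|k kb] := gen (pull sigma c) (vanish_sigma cV).
    rewrite -pull_cob //; apply/vanish_all.
    by apply: vanish_pull dc => U _; exists V.
  exists k; apply: (bnd_tau kb) => s sV.
  rewrite pullB pullMz !cochainB pull_comp_at; last exact: tau_sing.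
  rewrite pull_id_at ?subrr // => t; rewrite /= sigmaK //.
  by case: sV => U -> Us; exact: Us.
- move=> nJ k [b bV kb]; apply: inj => //.
  have idc : continuous (@id X) by move=> x; exact: cvg_id.
  have pc := tau_sigma_cont idc (fun x Vx => Vx).
  (* The composite of [sigma] with [tau] is known to fix only the coordinates in J. The sign rule
     with all signs equal to 1 shows that it nevertheless preserves the class of [th]. *)
  have := sgn (fun=> 1) _ (fun _ _ => or_introl (erefl _)) _ pc.
  rewrite big1_seq // => /(_ (fun j x jJ => tauK x jJ)) sb.
  rewrite (_ : th *~ k = cobpre (pull sigma b) -
    (pull (fun x => tau (sigma x)) th - th *~ 1) *~ k).
    by apply: bndB; [apply: bnd_cobpre; exact: vanish_sigma|exact: bndMz].
  have -> : pull (fun x => tau (sigma x)) th = pull sigma (pull tau th).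
    by apply/funext => s; rewrite pull_comp_at //; exact: cont_comp_sing.
  have -> : cobpre (pull sigma b) = pull sigma (pull tau th) *~ k.
    rewrite -pull_cobpre // -pullMz; apply/eqP; rewrite eq_sym -subr_eq0 -pullB; apply/eqP.
    by apply/vanish_all; apply: vanish_pull kb => U _; exists V.
  by rewrite mulr1z mulrzBl subKr.
- split=> [nJ|e g e1 gc gV gV' ge].
    by apply: (bnd_tau (th0 nJ)); rewrite subrr.
  apply: (bnd_tau (sgn e (fun x => tau (g (sigma x))) e1 _ _)).
  + by move=> j x jJ; exact: ge.
  + exact: tau_sigma_cont.
  + move=> s sV; rewrite pullB pullMz !cochainB.
    rewrite [pull g _ s]pull_comp_at; last exact: cont_comp_sing.
    rewrite [pull tau (pull _ _) s]pull_comp_at; last exact: tau_sing.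
    rewrite (@pull_eq_at _ _ _ (tau \o g) ((fun x => tau (g (sigma x))) \o tau)) ?subrr //.
    by move=> t; rewrite /= sigmaK //; case: sV => U -> Us; exact: Us.
Qed.

End Chart.
End Transfer.

(** * Spaces stratified by charts *)

Section Strata.
Context {R : realType} {X : topologicalType} {I : finType} {K : nat}.
Local Notation cochain n := (cochain R X int n).
Context (a : I -> nat) (V : I -> set X) (th : I -> forall n, cochain n).
Context (g : 'I_K -> X -> X) (eps : 'I_K -> I -> int).

Arguments th : clear implicits.

Definition level_set m : set X := [set x | exists2 i, (a i < m)%N & V i x].
Local Notation W := level_set.

Hypothesis V_open : forall i, open (V i).
Hypothesis V_sep : forall i j, i != j -> a i = a j -> V i `&` V j `<=` W (a i).
Hypothesis V_cover : forall x, exists i, V i x.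
Hypothesis th_vanish : forall i n, vanish [set V i `&` W (a i)] (th i n).
Hypothesis th_cocycle : forall i n, vanish [set V i] (coboundary (th i n)).
Hypothesis th_gen : forall i n (c : cochain n), vanish [set V i `&` W (a i)] c ->
  vanish [set V i] (coboundary c) ->
  exists k, bnd [set V i] [set V i `&` W (a i)] (c - th i n *~ k).
Hypothesis th_inj : forall i k,
  bnd [set V i] [set V i `&` W (a i)] (th i (a i) *~ k) -> k = 0.
Hypothesis th_neq : forall i n, n != a i ->
  bnd [set V i] [set V i `&` W (a i)] (th i n).
Hypothesis g_cont : forall m, continuous (g m).
Hypothesis gV : forall m i x, V i x -> V i (g m x).
Hypothesis th_sign : forall m i n,
  bnd [set V i] [set V i `&` W (a i)] (pull (g m) (th i n) - th i n *~ eps m i).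
Hypothesis g_id : forall m n (c : cochain n), coboundary c = 0 ->
  exists b : cochain n.-1, pull (g m) c - c = cobpre b.
Hypothesis eps1 : forall m i, eps m i = 1 \/ eps m i = -1.
Hypothesis odd_bad : forall i, odd (a i) -> exists m, eps m i = -1.

Lemma vanish_set1 (U U' : set X) n (c : cochain n) : U `<=` U' ->
  vanish [set U'] c -> vanish [set U] c.
Proof.
move=> UU c0 s [U1 U1U Us]; apply: c0; exists U' => // t; apply: UU.
by rewrite -U1U.
Qed.

Lemma W_mono m n : (m <= n)%N -> W m `<=` W n.
Proof. by move=> mn x [i im Vx]; exists i => //; exact: leq_trans mn. Qed.

Lemma V_W i : V i `<=` W (a i).+1.
Proof. by move=> x Vx; exists i. Qed.

Lemma gW m n x : W n x -> W n (g m x).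
Proof. by move=> [i im Vx]; exists i => //; exact: gV. Qed.

Lemma W_open m : open (W m).
Proof.
have -> : W m = \bigcup_(i in [set i | (a i < m)%N]) V i.
  by apply/seteqP; split=> x [i im Vx]; exists i.
by apply: bigcup_open => i _; exact: V_open.
Qed.

Lemma W0 n (c : cochain n) : vanish [set W 0] c.
Proof.
move=> s [U UW Us]; have t : stdsimplex R n by exact: (to_simp 0).
by have := Us t; rewrite UW => -[i].
Qed.

(** The open cover of [W m.+1] used for gluing: distinct charts of codimension m meet inside [W m],
    where relative cochains vanish. *)
Definition stage m : set (set X) :=
  [set U | U = W m \/ exists2 i, a i = m & U = V i].

Lemma stage_open m U : stage m U -> open U.
Proof. by move=> [->|[i _ ->]]; [exact: W_open|exact: V_open]. Qed.

Lemma stage_bigcup m : \bigcup_(U in stage m) U = W m.+1.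
Proof.
apply/seteqP; split=> [x [U [->|[i im ->]] Ux]|x [i]].
- exact: W_mono Ux.
- by exists i => //; rewrite im.
- rewrite ltnS leq_eqVlt => /orP[/eqP im|im] Vx.
    by exists (V i) => //; right; exists i.
  by exists (W m); [left|exists i].
Qed.

Lemma stage_small m n (c : cochain n) : vanish (stage m) c ->
  vanish [set W m.+1] (coboundary c) -> bnd [set W m.+1] (stage m) c.
Proof. rewrite -stage_bigcup; apply: small_simplices; exact: stage_open. Qed.

Lemma vanish_stage m n (c : cochain n) :
  vanish [set W m] c -> (forall i, a i = m -> vanish [set V i] c) -> vanish (stage m) c.
Proof.
move=> cW cV s [U [UW|[i im UV]] Us]; first by apply: cW; exists U.
by apply: (cV _ im); exists U.
Qed.

Lemma stage_W m n (c : cochain n) : vanish (stage m) c -> vanish [set W m] c.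
Proof. by move=> c0 s [U -> Us]; apply: c0; exists (W m) => //; left. Qed.

Lemma stage_V i n (c : cochain n) : vanish (stage (a i)) c -> vanish [set V i] c.
Proof.
by move=> c0 s [U -> Us]; apply: c0; exists (V i) => //; right; exists i.
Qed.

Lemma cut_W i n (b : cochain n) : vanish [set V i `&` W (a i)] b ->
  vanish [set W (a i)] (cut (V i) b).
Proof.
move=> b0 s [U -> Us]; rewrite /cut; case: pselect => //= Vs.
by apply: b0; exists (V i `&` W (a i)).
Qed.

Lemma cut_V i j n (b : cochain n) : i != j -> a i = a j ->
  vanish [set V i `&` W (a i)] b -> vanish [set V j] (cut (V i) b).
Proof.
move=> ij aij b0 s [U -> Us]; rewrite /cut; case: pselect => //= Vs.
apply: b0; exists (V i `&` W (a i)) => // t; split; first exact: Vs.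
exact: V_sep ij aij _ (conj (Vs t) (Us t)).
Qed.

(** Local primitives need no compatibility: each is cut to its own chart, and the cuts do not
    interfere because a simplex in two charts of codimension m lies in [W m]. The sum is correct on
    simplices small for [stage m], and [stage_small] corrects the others. *)
Lemma glue_bnd m n (c : cochain n) : vanish [set W m] c ->
  vanish [set W m.+1] (coboundary c) ->
  (forall i, a i = m -> bnd [set V i] [set V i `&` W (a i)] c) ->
  bnd [set W m.+1] [set W m] c.
Proof.
move=> cW dc cV.
have [|b bP] := @choice _ _ (fun i (y : cochain n.-1) => a i = m -> vanish [set V i `&` W (a i)] y /\ vanish [set V i] (c - cobpre y)).
  move=> i.
  case: (eqVneq (a i) m) => [/cV[y y1 y2]|/eqP im]; first by exists y.
  by exists 0.
pose B := \sum_(i | a i == m) cut (V i) (b i).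
have BW : vanish [set W m] B.
  by apply: vanish_sumr => i /eqP im; have [bi _] := bP _ im; rewrite -im; exact: cut_W.
have BV j : a j = m -> vanish [set V j] (B - b j).
  move=> jm; rewrite /B (bigD1 j) ?jm //= addrAC.
  apply: vanishD; first exact: vanish_cut_sub.
  apply: vanish_sumr => i /andP[/eqP im ij]; have [bi _] := bP _ im.
  by apply: cut_V => //; rewrite im jm.
have cB : vanish (stage m) (c - cobpre B).
  apply: vanish_stage; first by apply: vanishB => //; exact: vanish_cobpre.
  move=> j jm; rewrite (_ : _ - _ = (c - cobpre (b j)) - (cobpre B - cobpre (b j))).
    apply: vanishB; first by have [] := bP _ jm.
    by apply: cobpre_ext; exact: BV.
  by rewrite opprB addrA subrK.
have : bnd [set W m.+1] (stage m) (c - cobpre B).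
  by apply: stage_small => //; rewrite raddfB /= cob_cobpre subr0.
move=> /(bnd_sub (@stage_W m)) h.
by rewrite -[c](subrK (cobpre B)); apply: bndD => //; exact: bnd_cobpre.
Qed.

(** The cut of the local class is a cocycle only on simplices small for the stage. [stage_small],
    applied to its coboundary, gives the correction y. *)
Lemma glue_class i n : exists Th : cochain n,
  [/\ vanish [set W (a i)] Th, vanish [set W (a i).+1] (coboundary Th),
      vanish [set V i] (Th - th i n) &
      forall j, j != i -> a j = a i -> vanish [set V j] Th].
Proof.
pose Th' := cut (V i) (th i n).
have TW : vanish [set W (a i)] Th' by apply: cut_W; exact: th_vanish.
have TV : vanish [set V i] (Th' - th i n) by exact: vanish_cut_sub.
have TVj j : j != i -> a j = a i -> vanish [set V j] Th'.
  by move=> ji aji; apply: cut_V => //; rewrite eq_sym.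
have [||y yS Ty] := @stage_small (a i) _ (coboundary Th').
- apply: vanish_stage; first exact: vanish_cob.
  move=> j aji; have [->|ji] := eqVneq j i; last by apply: vanish_cob; exact: TVj.
  rewrite -[coboundary Th'](subrK (coboundary (th i n))).
  by apply: vanishD; [exact: cob_ext|exact: th_cocycle].
- by rewrite coboundaryK.
exists (Th' - y); split.
- by apply: vanishB => //; exact: stage_W.
- by rewrite raddfB.
- by rewrite addrAC; apply: vanishB => //; exact: stage_V.
- move=> j ji aji; apply: vanishB; first exact: TVj.
  by apply: stage_V; rewrite aji.
Qed.

Definition Th i n : cochain n := projT1 (cid (glue_class i n)).

Arguments Th : clear implicits.

Lemma ThP i n : [/\ vanish [set W (a i)] (Th i n),
  vanish [set W (a i).+1] (coboundary (Th i n)),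
  vanish [set V i] (Th i n - th i n) &
  forall j, j != i -> a j = a i -> vanish [set V j] (Th i n)].
Proof. by rewrite /Th; case: cid. Qed.

Definition comb m n (k : I -> int) : cochain n := \sum_(i | a i == m) Th i n *~ k i.

Arguments comb : clear implicits.

Lemma comb_W m n k : vanish [set W m] (comb m n k).
Proof.
apply: vanish_sumr => i /eqP <-; apply: vanishMz; by have [] := ThP i n.
Qed.

Lemma comb_cocycle m n k : vanish [set W m.+1] (coboundary (comb m n k)).
Proof.
rewrite raddf_sum; apply: vanish_sumr => i /eqP <-; rewrite raddfMz.
by apply: vanishMz; have [] := ThP i n.
Qed.

Lemma comb_V n k i : vanish [set V i] (comb (a i) n k - th i n *~ k i).
Proof.
rewrite /comb (bigD1 i) //= addrAC; apply: vanishD.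
  by rewrite -mulrzBl; apply: vanishMz; have [] := ThP i n.
apply: vanish_sumr => j /andP[/eqP ji ij]; apply: vanishMz.
by have [_ _ _ h] := ThP j n; apply: h => //; rewrite eq_sym.
Qed.

Lemma comb_gen m n (c : cochain n) : vanish [set W m] c ->
  vanish [set W m.+1] (coboundary c) ->
  exists k, bnd [set W m.+1] [set W m] (c - comb m n k).
Proof.
move=> cW dc.
have cVW i : a i = m -> vanish [set V i `&` W (a i)] c.
  by move=> im; rewrite im; apply: vanish_set1 cW => x [].
have dcV i : a i = m -> vanish [set V i] (coboundary c).
  by move=> im; apply: vanish_set1 dc; rewrite -im; exact: V_W.
have [|k kP] := @choice _ _ (fun i k => a i = m ->
    bnd [set V i] [set V i `&` W (a i)] (c - th i n *~ k)).
  move=> i.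
  case: (eqVneq (a i) m) => [im|/eqP im]; last by exists 0.
  by have [k kb] := th_gen (cVW _ im) (dcV _ im); exists k.
exists k; apply: glue_bnd.
- by apply: vanishB => //; exact: comb_W.
- by rewrite raddfB /=; apply: vanishB => //; exact: comb_cocycle.
- move=> i im; rewrite -(subrK (th i n *~ k i) c) -addrA; apply: bndD; first exact: kP.
  rewrite -opprB; apply: bndN; apply: bnd_vanish; rewrite -im; exact: comb_V.
Qed.

(** The m-th layer of the filtration has cohomology in degree m only. *)
Lemma comb_neq m n (c : cochain n) : n != m -> vanish [set W m] c ->
  vanish [set W m.+1] (coboundary c) -> bnd [set W m.+1] [set W m] c.
Proof.
move=> nm cW dc; apply: glue_bnd => // i im.
have [||k kb] := th_gen (i := i) (c := c).
- by rewrite im; apply: vanish_set1 cW => x [].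
- by apply: vanish_set1 dc; rewrite -im; exact: V_W.
rewrite -(subrK (th i n *~ k) c); apply: bndD => //; apply: bndMz; apply: th_neq.
by rewrite im.
Qed.

Lemma bnd_V i n (c : cochain n) : bnd [set W (a i).+1] [set W (a i)] c ->
  bnd [set V i] [set V i `&` W (a i)] c.
Proof.
move=> h; apply: bnd_res (bnd_sub _ h).
  by move=> m b; apply: vanish_set1; exact: V_W.
by move=> m b; apply: vanish_set1 => x [].
Qed.

Lemma comb_inj m k : bnd [set W m.+1] [set W m] (comb m m k) ->
  forall i, a i = m -> k i = 0.
Proof.
move=> h i im; subst m; apply: (@th_inj i); have := bnd_V h => h'.
rewrite -[th i _ *~ _](subKr (comb (a i) (a i) k)); apply: bndB => //.
apply: bnd_vanish; exact: comb_V.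
Qed.

Lemma Th_sign m i n : bnd [set W (a i).+1] [set W (a i)]
  (pull (g m) (Th i n) - Th i n *~ eps m i).
Proof.
have [TW dT TV TVj] := ThP i n.
have gf (U : set X) : (forall x, U x -> U (g m x)) -> fmap (g m) [set U] [set U].
  by move=> gU U1 ->; exists U.
have pv (U : set X) q (c : cochain q) : (forall x, U x -> U (g m x)) ->
   vanish [set U] c -> vanish [set U] (pull (g m) c).
  by move=> gU; apply: vanish_pull; exact: gf.
apply: glue_bnd.
- by apply: vanishB; [apply: pv => //; exact: gW|exact: vanishMz].
- rewrite raddfB /= raddfMz /= -pull_cob; last exact: g_cont.
  by apply: vanishB; [apply: pv => //; exact: gW|exact: vanishMz].
- move=> j aji; have [->|ji] := eqVneq j i.
    rewrite (_ : _ - _ = (pull (g m) (th i n) - th i n *~ eps m i) +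
      (pull (g m) (Th i n - th i n) - (Th i n - th i n) *~ eps m i)).
      apply: bndD; first exact: th_sign.
      by apply: bnd_vanish; apply: vanishB; [apply: pv => //; exact: gV|exact: vanishMz].
    rewrite pullB mulrzBl; apply/funext => s.
    by rewrite !(cochainB, cochainD, cochainN); ring.
  apply: bnd_vanish; apply: vanishB; last by apply: vanishMz; exact: TVj.
  by apply: pv; [exact: gV|exact: TVj].
Qed.

Lemma W_top : exists D, forall m, (D <= m)%N -> W m = setT.
Proof.
exists (\max_i a i).+1 => m Dm; apply/seteqP; split=> // x _.
have [i Vx] := V_cover x; exists i => //.
by apply: leq_trans Dm; rewrite ltnS; exact: leq_bigmax.
Qed.

(** [W m] is built from layers of index below m, hence below the degree n, and none of them
    contributes. *)
Lemma W_acyclic m n (c : cochain n) : (m <= n)%N ->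
  vanish [set W m] (coboundary c) -> bnd [set W m] set0 c.
Proof.
elim: m c => [|m IH] c mn dc; first by apply: bnd_vanish; exact: W0.
have [|b _ cb] := IH c (ltnW mn); first by apply: vanish_set1 dc; exact: W_mono.
have : bnd [set W m.+1] [set W m] (c - cobpre b).
  apply: comb_neq => //; first by rewrite gtn_eqF.
  by rewrite raddfB /= cob_cobpre subr0.
move=> [b' _ cb']; exists (b + b'); first by move=> s [].
by rewrite cobpreD opprD addrA.
Qed.

(** All layers added to [W n.+1] have index above n, so restriction to [W n.+1] loses no class of
    degree n. *)
Lemma W_inj m n (c : cochain n) : (n < m)%N -> vanish [set W n.+1] c ->
  vanish [set W m] (coboundary c) -> bnd [set W m] [set W n.+1] c.
Proof.
elim: m c => [//|m IH] c; rewrite ltnS leq_eqVlt => /orP[/eqP <-|nm] cW dc.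
  exact: bnd_vanish.
have [|b bW cb] := IH c nm cW; first by apply: vanish_set1 dc; exact: W_mono.
have : bnd [set W m.+1] [set W m] (c - cobpre b).
  apply: comb_neq => //; first by rewrite ltn_eqF.
  by rewrite raddfB /= cob_cobpre subr0.
move=> [b' b'W cb']; exists (b + b'); last by rewrite cobpreD opprD addrA.
by apply: vanishD => //; apply: vanish_set1 b'W; exact: W_mono.
Qed.

(* On [W n.+1], the union of the cells of codimension at most [n], [c] is
   cohomologous to the cellular cochain with coordinates [k]. *)
Definition rep n (c : cochain n) (k : I -> int) := exists b : cochain n.-1,
  vanish [set W n.+1] (c - comb n n k - cobpre b).

Lemma rep_ex n (c : cochain n) : vanish [set W n.+1] (coboundary c) -> exists k, rep c k.
Proof.
move=> dc; have [|b _ cb] := @W_acyclic n n c (leqnn n).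
  by apply: vanish_set1 dc; exact: W_mono.
have [//||k [b' b'W cb']] := @comb_gen n _ (c - cobpre b).
  by rewrite raddfB /= cob_cobpre subr0.
exists k, (b + b'); rewrite cobpreD opprD addrA.
by rewrite [_ - comb _ _ _ - cobpre b]addrAC.
Qed.

Lemma combB m n k l : comb m n (fun i => k i - l i) = comb m n k - comb m n l.
Proof. by rewrite /comb -sumrB; apply: eq_bigr => i _; rewrite mulrzBr. Qed.

Lemma comb0 m n : comb m n (fun=> 0) = 0.
Proof. by rewrite /comb big1. Qed.

Lemma repB n (b c : cochain n) k l : rep b k -> rep c l -> rep (b - c) (fun i => k i - l i).
Proof.
move=> [x bx] [y cy]; exists (x - y); rewrite cobpreB combB.
rewrite (_ : _ - _ = (b - comb n n k - cobpre x) - (c - comb n n l - cobpre y)).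
  exact: vanishB.
by apply/funext => s; rewrite !(cochainB, cochainD, cochainN); ring.
Qed.

Lemma rep0 n (b : cochain n.-1) : rep (cobpre b) (fun=> 0).
Proof. by exists b; rewrite comb0 subr0 subrr. Qed.

Lemma repD n (b c : cochain n) k l : rep b k -> rep c l -> rep (b + c) (fun i => k i + l i).
Proof.
move=> hb hc; have h0 : rep (0 : cochain n) (fun=> 0) by have := rep0 (0 : cochain n.-1); rewrite cobpre0.
have := repB hb (repB h0 hc); rewrite sub0r opprK.
by congr rep; apply/funext => i; rewrite sub0r opprK.
Qed.

Lemma rep_ext n (c : cochain n) k l : (forall i, a i = n -> k i = l i) -> rep c k -> rep c l.
Proof.
move=> kl [b cb]; exists b; suff -> : comb n n l = comb n n k by [].
by apply: eq_bigr => i /eqP im; rewrite kl.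
Qed.

(* The integral cellular differential. *)
Lemma diff_ex n i : exists k : I -> int, a i = n ->
  bnd [set W n.+2] [set W n.+1] (coboundary (Th i n) - comb n.+1 n.+1 k).
Proof.
case: (eqVneq (a i) n) => [im|/eqP im]; last by exists (fun=> 0).
have [_ dT _ _] := ThP i n; rewrite im in dT.
have [//||k kP] := @comb_gen n.+1 _ (coboundary (Th i n)).
  by rewrite coboundaryK.
by exists k.
Qed.

Definition diff n i : I -> int := projT1 (cid (diff_ex n i)).

Lemma diffP n i : a i = n -> bnd [set W n.+2] [set W n.+1]
  (coboundary (Th i n) - comb n.+1 n.+1 (diff n i)).
Proof. by rewrite /diff; case: cid. Qed.

Lemma fmap_gW m n : fmap (g m) [set W n] [set W n].
Proof. by move=> U ->; exists (W n) => // x; exact: gW. Qed.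

Lemma pull_comb m n q k : bnd [set W n.+1] [set W n]
  (pull (g m) (comb n q k) - comb n q (fun i => k i * eps m i)).
Proof.
rewrite /comb pull_sum -sumrB; apply: bnd_sum => i /eqP <-.
rewrite pullMz [k i * _]mulrC mulrzA -mulrzBl.
by apply: bndMz; exact: Th_sign.
Qed.

(** The coefficient of cell j in the transform under [g m] of the coboundary of [Th i n], computed
    in two ways: transforming [Th i n] before the coboundary, or its cellular expansion after it. *)
Lemma diff_eps m n i j : a i = n -> a j = n.+1 ->
  diff n i j * eps m j = diff n i j * eps m i.
Proof.
move=> im jn.
suff /comb_inj/(_ j jn) : bnd [set W n.+2] [set W n.+1] (comb n.+1 n.+1
   (fun j => diff n i j * eps m j - diff n i j * eps m i)).
  by move/eqP; rewrite subr_eq0 => /eqP.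
have dP := diffP im; set k := diff n i in dP *.
rewrite combB; set c1 := comb _ _ _; set c2 := comb _ _ _.
have Ec2 : c2 = comb n.+1 n.+1 k *~ eps m i.
  rewrite /c2 /comb mulrz_suml; apply: eq_bigr => l _; by rewrite mulrzA.
have h1 := pull_comb m n.+1 n.+1 k.
have h2 : bnd [set W n.+2] [set W n.+1] (pull (g m) (coboundary (Th i n) - comb n.+1 n.+1 k)).
  by exact: (bnd_pull (g_cont (m := m)) (@fmap_gW m n.+1) (@fmap_gW m n.+2) dP).
have h3 : bnd [set W n.+2] [set W n.+1]
    (pull (g m) (coboundary (Th i n)) - coboundary (Th i n) *~ eps m i).
  have [y yW Ty] := Th_sign m i n; rewrite im in yW Ty.
  rewrite pull_cob; last exact: g_cont.
  rewrite -raddfMz -raddfB -[X in bnd _ _ X]subr0 -(cob_cobpre y) -raddfB.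
  exact: (@bnd_cobpre _ _ _ _ n.+1 _ Ty).
have h4 := bndMz (eps m i) dP.
rewrite (_ : _ - _ = (pull (g m) (coboundary (Th i n)) - coboundary (Th i n) *~ eps m i)
  - pull (g m) (coboundary (Th i n) - comb n.+1 n.+1 k)
  - (pull (g m) (comb n.+1 n.+1 k) - c1)
  + (coboundary (Th i n) - comb n.+1 n.+1 k) *~ eps m i).
  by apply: bndD => //; apply: bndB => //; apply: bndB.
rewrite Ec2 pullB mulrzBl; apply/funext => s.
by rewrite !(cochainB, cochainD, cochainN); ring.
Qed.

Lemma combMz m n k l : comb m n (fun i => k i * l) = comb m n k *~ l.
Proof. by rewrite /comb mulrz_suml; apply: eq_bigr => i _; rewrite -mulrzA. Qed.

Lemma comb_sum (T : finType) (P : pred T) m n (k : T -> I -> int) :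
  comb m n (fun i => \sum_(t | P t) k t i) = \sum_(t | P t) comb m n (k t).
Proof.
rewrite /comb exchange_big /=; apply: eq_bigr => i _.
by rewrite mulrz_sumr.
Qed.

Lemma rep_sum (T : finType) (P : pred T) n (c : T -> cochain n) k :
  (forall t, P t -> rep (c t) (k t)) ->
  rep (\sum_(t | P t) c t) (fun i => \sum_(t | P t) k t i).
Proof.
move=> ck; have h t : exists b : cochain n.-1, P t ->
    vanish [set W n.+1] (c t - comb n n (k t) - cobpre b).
  case Pt : (P t); last by exists 0.
  by have [b cb] := ck _ Pt; exists b.
have [b bP] := choice h; exists (\sum_(t | P t) b t).
rewrite comb_sum cobpre_sum -!sumrB; apply: vanish_sumr => t; exact: bP.
Qed.

Lemma rep_diff n i z : a i = n -> rep (0 : cochain n.+1) (fun j => z * diff n i j).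
Proof.
move=> im; have [y yW Ty] := diffP im.
exists ((y - Th i n) *~ z); rewrite sub0r cobpreMz cobpreB.
rewrite (_ : (fun j => z * _) = (fun j => diff n i j * z)); last by apply/funext => j; rewrite mulrC.
rewrite combMz -mulNrz -mulrzBl; apply: vanishMz.
rewrite (_ : _ - _ = coboundary (Th i n) - comb n.+1 n.+1 (diff n i) - cobpre y) //.
by apply/funext => s; rewrite !(cochainB, cochainD, cochainN) /=; ring.
Qed.

Lemma rep_zero0 k : rep (0 : cochain 0) k -> forall j, a j = 0%N -> k j = 0.
Proof.
move=> [b]; rewrite sub0r subr0 => h; apply: comb_inj.
by apply: bnd_vanish; rewrite -[comb _ _ _]opprK; exact: vanishN.
Qed.

Lemma rep_zeroS n k : rep (0 : cochain n.+1) k ->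
  exists z : I -> int, forall j, a j = n.+1 ->
    k j = \sum_(i | a i == n) z i * diff n i j.
Proof.
move=> [b]; rewrite sub0r => bW.
(* Cellular cochains of degree n + 1 vanish on [W n.+1], so b is a cocycle there and has coordinates
   of its own. The sign in [- b] below makes the differential of these coordinates equal to k. *)
have bW1 : vanish [set W n.+1] (coboundary b).
  have := vanish_set1 (@W_mono n.+1 n.+2 (leqnSn _)) bW => {}bW.
  rewrite -[coboundary b]opprK; apply: vanishN.
  rewrite -[X in vanish _ X](addKr (- comb n.+1 n.+1 k)); apply: vanishD => //.
  by rewrite opprK; exact: comb_W.
have [|z [b1 bb1]] := @rep_ex n (- b); first by rewrite raddfN; exact: vanishN.
exists z => j jn.
pose l j := \sum_(i | a i == n) z i * diff n i j.
suff /comb_inj/(_ j jn) : bnd [set W n.+2] [set W n.+1] (comb n.+1 n.+1 (fun j => k j - l j)).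
  by move/eqP; rewrite subr_eq0 => /eqP.
pose e := - b - comb n n z - cobpre b1.
have -> : comb n.+1 n.+1 (fun j => k j - l j) =
  coboundary (comb n n z) - comb n.+1 n.+1 l + coboundary e - (- comb n.+1 n.+1 k - coboundary b).
  rewrite combB /e !raddfB raddfN /= cob_cobpre.
  by apply/funext => s; rewrite !(cochainB, cochainD, cochainN, cochain0); ring.
apply: bndB.
  apply: bndD; last by exists e => //; rewrite subrr.
  rewrite /l (comb_sum (fun i => a i == n) n.+1 n.+1 (fun i j => z i * diff n i j)).
  rewrite {1}/comb raddf_sum -sumrB; apply: bnd_sum => i /eqP im.
  have -> : comb n.+1 n.+1 (fun i0 => z i * diff n i i0) = comb n.+1 n.+1 (diff n i) *~ z i.
    by rewrite -combMz; congr comb; apply/funext => ?; rewrite mulrC.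
  by rewrite raddfMz -mulrzBl; apply: bndMz; exact: diffP.
exact: bnd_vanish.
Qed.

Lemma rep_zero_good n k i : rep (0 : cochain n) k -> a i = n ->
  (forall m, eps m i = 1) -> k i = 0.
Proof.
case: n => [|n] hk im good; first exact: rep_zero0 hk _ im.
case on : (odd n.+1).
  by have [|m] := @odd_bad i; rewrite ?im // good.
have [z ->//] := rep_zeroS hk; rewrite big1 // => j /eqP jn.
have [|m em] := @odd_bad j; first by move: on; rewrite jn /=; case: odd.
have := diff_eps m jn im; rewrite good em => h.
suff -> : diff n j i = 0 by rewrite mulr0.
move: h; set x := diff n j i; lia.
Qed.

(* The coboundaries form a subgroup graded by the characters [eps]. *)
Lemma rep_zero_proj n k (S : pred I) :
  (forall i j, (forall m, eps m i = eps m j) -> S i = S j) ->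
  rep (0 : cochain n) k -> rep (0 : cochain n) (fun i => if S i then k i else 0).
Proof.
move=> Seps; case: n => [|n] hk.
  have h0 : rep (0 : cochain 0) (fun=> 0) by exact: (@rep0 0 0).
  apply: rep_ext h0 => i im.
  by rewrite (rep_zero0 hk im); case: ifP.
have [z zP] := rep_zeroS hk.
have : rep (\sum_(i | (a i == n) && S i) (0 : cochain n.+1))
    (fun j => \sum_(i | (a i == n) && S i) z i * diff n i j).
  by apply: rep_sum => i /andP[/eqP im _]; exact: rep_diff.
rewrite big1 //; apply: rep_ext => j jn.
have nz i : a i = n -> S i != S j -> diff n i j = 0.
  move=> im; apply: contraNeq => d0; apply/eqP/Seps => m.
  by have /(mulfI d0) := diff_eps m im jn.
case Sj : (S j); last first.
  by rewrite big1 // => i /andP[/eqP im Si]; rewrite nz ?mulr0 // Si Sj.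
rewrite zP // [RHS](bigID S) /= [X in _ + X]big1 ?addr0 //.
by move=> i /andP[/eqP im /negPf Si]; rewrite nz ?mulr0 // Si Sj.
Qed.

Lemma rep_eps m n (c : cochain n) k : coboundary c = 0 -> rep c k ->
  rep (0 : cochain n) (fun i => k i * (1 - eps m i)).
Proof.
move=> dc [b cb]; have [y yE] := g_id m dc.
have [x xW Tx] := pull_comb m n n k.
have gcb : vanish [set W n.+1] (pull (g m) (c - comb n n k - cobpre b)).
  by apply: vanish_pull cb; exact: fmap_gW.
exists (y - pull (g m) b + b - x).
have -> : (fun i => k i * (1 - eps m i)) = (fun i => k i - k i * eps m i).
  by apply/funext => i; rewrite mulrBr mulr1.
rewrite combB; set ck := comb n n (fun i => k i * _) in Tx *.
rewrite !pullB pull_cobpre in gcb; last exact: g_cont.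
rewrite (_ : _ - _ = (c - comb n n k - cobpre b)
   - (pull (g m) c - pull (g m) (comb n n k) - cobpre (pull (g m) b))
   - (pull (g m) (comb n n k) - ck - cobpre x) *~ 1
   + (pull (g m) c - c - cobpre y)).
  apply: vanishD; last by rewrite yE subrr.
  by apply: vanishB; [exact: vanishB|exact: vanishMz].
rewrite !(cobpreB, cobpreD) mulr1z.
by apply/funext => s; rewrite !(cochainB, cochainD, cochainN, cochain0); ring.
Qed.

Lemma rep_zeroE n (c : cochain n) : coboundary c = 0 -> rep c (fun=> 0) ->
  exists b : cochain n.-1, c = cobpre b.
Proof.
move=> dc [b]; rewrite comb0 subr0 => cb.
have [D DW] := W_top.
have [|||y _ cy] := @W_inj (maxn D n.+1) n (c - cobpre b) => //.
- by rewrite leq_max ltnSn orbT.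
- by rewrite raddfB /= dc cob_cobpre subr0.
exists (b + y); apply/eqP; rewrite -subr_eq0 cobpreD opprD addrA; apply/eqP.
by apply/vanish_all; rewrite /all_space -(DW _ (leq_maxl D n.+1)).
Qed.

Theorem good_coords_zero n (c : cochain n) k : coboundary c = 0 -> rep c k ->
  (forall i, a i = n -> (forall m, eps m i = 1) -> k i = 0) ->
  exists b : cochain n.-1, c *+ 2 = cobpre b.
Proof.
move=> dc ck k0.
(* [S m i] says that m is the least index with sign -1 at i. A cell with some sign -1 belongs to
   exactly one S m, where 1 - eps = 2, so the projections of the relations k (1 - eps m) sum to 2
   k. *)
pose S (m : 'I_K) (i : I) := (eps m i == -1) && [forall m' : 'I_K, (m' < m)%N ==> (eps m' i == 1)].
have SE m i j : (forall m, eps m i = eps m j) -> S m i = S m j.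
  by move=> e; rewrite /S e; congr (_ && _); apply: eq_forallb => m'; rewrite e.
have h m : rep (0 : cochain n) (fun i => if S m i then k i * (1 - eps m i) else 0).
  exact: (rep_zero_proj (SE m) (rep_eps m dc ck)).
have := rep_sum (P := xpredT) (fun m _ => h m); rewrite big1 // => h2.
have h3 : rep (0 : cochain n) (fun i => k i *+ 2).
  apply: rep_ext h2 => i im.
  case: (pickP (fun m => eps m i == -1)) => [m0 em0|good]; last first.
    rewrite k0 //; first by rewrite big1 // => m _; rewrite /S good.
    by move=> m; case: (eps1 m i) => // /eqP; rewrite good.
  case: (@arg_minnP _ m0 (fun m => eps m i == -1) (fun m : 'I_K => m : nat) em0) => m1 em1 min1.
  rewrite (bigD1 m1) //= big1 ?addr0 => [|m mm1].
    rewrite /S em1 /= ifT; first by rewrite (eqP em1) opprK mulrDr mulr1 mulr2n.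
    apply/forallP => m'; apply/implyP => lt; case: (eps1 m' i) => [->//|/eqP /min1].
    by rewrite leqNgt lt.
  rewrite ifF //; apply/negP => /andP[em /forallP all1].
  have := min1 _ em; rewrite leq_eqVlt => /orP[/eqP/val_inj m1m|lt].
    by rewrite m1m eqxx in mm1.
  by have := all1 m1; rewrite lt /= (eqP em1).
apply: rep_zeroE; first by rewrite mulr2n raddfD /= dc addr0.
have := repB (repD ck ck) h3; rewrite subr0 mulr2n.
by congr rep; apply/funext => i; rewrite mulr2n subrr.
Qed.

Theorem good_coord_cobpre n (b : cochain n.-1) k i : rep (cobpre b) k -> a i = n ->
  (forall m, eps m i = 1) -> k i = 0.
Proof.
move=> bk; apply: rep_zero_good.
have := repB bk (rep0 b); rewrite subrr.
by congr rep; apply/funext => j; rewrite subr0.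
Qed.

Lemma class_eq0P n (z : cocycle R X int n) :
  cohomology_class z = 0 <-> exists b : cochain n.-1, cocycle_val z = cobpre b.
Proof.
rewrite (rwP eqP) cohomology_class_eq0; case: n z => [|n] z; split.
- by move=> /asboolP z0; exists 0.
- by move=> [b zb]; apply/asboolP.
- by move=> /asboolP[b _ bz]; exists b.
- by move=> [b zb]; apply/asboolP; exists b.
Qed.

Lemma cocycle_cob n (z : cocycle R X int n) : coboundary (cocycle_val z) = 0.
Proof. exact/asboolP/cocycle_valP. Qed.

Theorem strata_detect n : exists rho : I -> cohomology R X int n -> int,
  (forall i x y, rho i (x - y) = rho i x - rho i y) /\
  (forall x, (forall i, rho i x = 0) -> x *+ 2 = 0).
Proof.
have kx (x : cohomology R X int n) : exists k, rep (cocycle_val (repr x)) k.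
  by apply: rep_ex; rewrite cocycle_cob; exact: vanish0.
have [k kP] := choice kx.
(* [rep] constrains the coordinates of cells of codimension n only, so the others must be discarded
   for the functionals to be additive. *)
pose good i := `[< a i = n /\ forall m, eps m i = 1 >].
exists (fun i x => if good i then k x i else 0); split=> [i x y|x x0].
  case gd : (good i); last by rewrite subrr.
  have /asboolP[im gi] := gd.
  have : cohomology_class (repr (x - y) - (repr x - repr y)) = 0.
    have cr (u : cohomology R X int n) : cohomology_class (repr u) = u by exact: reprK.
    by rewrite raddfB raddfB /= !cr; exact: subrr.
  move=> /class_eq0P[b zb].
  have h := repB (kP (x - y)) (repB (kP x) (kP y)).
  rewrite (_ : _ - _ = cobpre b) in h; last by rewrite -zb.
  by have /eqP := good_coord_cobpre h im gi; rewrite subr_eq0 => /eqP.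
have [|b xb] := good_coords_zero (cocycle_cob (repr x)) (kP x).
  move=> i im gi; have gd : good i by apply/asboolP.
  by have := x0 i; rewrite gd.
have <- : cohomology_class (repr x) = x by exact: reprK.
rewrite -raddfMn /=.
by apply/class_eq0P; exists b; rewrite mulr2n -xb mulr2n.
Qed.

End Strata.

(** * Charts and cells of flag manifolds *)

Section RowSpans.
Context {R : realType} {n : nat}.
Implicit Types (g : 'M[R]_n) (P : pred 'I_n).

Lemma mem_span_rows g P (v : 'rV[R]_n) :
  v \in <<[seq row k g | k <- enum 'I_n & P k]>>%VS <->
  exists2 c : 'rV[R]_n, v = c *m g & forall k, ~~ P k -> c ord0 k = 0.
Proof.
have E : [seq row k g | k <- enum 'I_n & P k] = [seq row k g | k <- enum P].
  by congr map; rewrite {2}/enum_mem -enumT.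
rewrite E span_def big_map big_enum /=; split.
  case/memv_sumP => vs vsP ->.
  have /choice [c cP] : forall k, exists x, P k -> vs k = x *: row k g.
    move=> k; case Pk : (P k); last by exists 0.
    by have /vlineP[x xP] := vsP k Pk; exists x.
  exists (\row_k (if k \in P then c k else 0)); last first.
    by move=> k /negPf Pk; rewrite mxE -[k \in P]/(P k) Pk.
  rewrite mulmx_sum_row [RHS](bigID (mem P)) /= [X in _ + X]big1 ?addr0.
    by apply: eq_bigr => k Pk; rewrite mxE Pk cP.
  by move=> k /negPf Pk; rewrite mxE Pk scale0r.
case=> c -> c0; rewrite mulmx_sum_row (bigID (mem P)) /= [X in _ + X]big1 ?addr0.
  apply: memv_sumr => k Pk; rewrite memvZ // memv_line //.
by move=> k /c0 ->; rewrite scale0r.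
Qed.

Lemma dim_span_rows g P : g \in unitmx ->
  \dim <<[seq row k g | k <- enum 'I_n & P k]>>%VS = #|P|.
Proof.
move=> gU; set I := enum _.
have rows_free : free [seq row k g | k <- I].
  pose X := [tuple row k g | k < n].
  have -> : [seq row k g | k <- I] = X :> seq _ by rewrite -[I]val_ord_tuple.
  apply/freeP => c cX0 i.
  have : (\row_k c k) *m g = 0.
    rewrite mulmx_sum_row -[RHS]cX0; apply: eq_bigr => k _.
    by rewrite mxE -tnth_nth tnth_mktuple.
  move=> /(congr1 (mulmx^~ (invmx g))).
  by rewrite mulmxK // mul0mx => /rowP/(_ i); rewrite !mxE.
have /perm_free : perm_eq [seq row k g | k <- I]
    ([seq row k g | k <- [seq k <- I | P k]] ++
     [seq row k g | k <- [seq k <- I | predC P k]]).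
  by rewrite -map_cat; apply: perm_map; rewrite perm_sym; apply/permPl/perm_filterC.
rewrite rows_free => /esym/catl_free/eqP ->.
by rewrite size_map cardE /I enumT.
Qed.

Lemma unitmx_inj (A : 'M[R]_n) : (forall v : 'rV[R]_n, v *m A = 0 -> v = 0) -> A \in unitmx.
Proof. by move=> h; rewrite -row_free_unit; exact: inj_row_free. Qed.

End RowSpans.

(** * Leading positions and the word of a flag *)

Section Flags.
Context {R : realType} {r : nat} (d : 'I_r -> nat).
Local Notation X := (even_flag R r d).
Local Notation n := (flag_ambient d).
Local Notation rank := (flag_rank d).
Local Notation vec := 'rV[R]_n.

Lemma flag_eq (F G : X) : (forall i, flag_space F i = flag_space G i) -> F = G.
Proof.
case: F G => [F Fn Fd] [G Gn Gd] /= FG.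
have E : F = G by apply/funext.
by subst G; congr EvenFlag; exact: Prop_irrelevance.
Qed.

Lemma flag_eq_sub (F G : X) : (forall i, (flag_space F i <= flag_space G i)%VS) -> F = G.
Proof.
move=> FG; apply: flag_eq => i; apply/eqP.
by rewrite eqEdim FG !flag_dim leqnn.
Qed.

Definition mkframe (g : 'M[R]_n) (gU : g \in unitmx) : @frames R r d := SigSub (mem_set (gU : @frames R r d g)).

Lemma mem_first_rows (g : 'M[R]_n) p (v : vec) :
  v \in first_rows g p <->
  exists2 c : vec, v = c *m g & forall k : 'I_n, (p <= k)%N -> c ord0 k = 0.
Proof.
rewrite /first_rows (mem_span_rows g (fun k : 'I_n => (k < p)%N)).
split=> -[c -> c0]; exists c => // k kp; apply: c0; first by rewrite -leqNgt.
by rewrite leqNgt.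
Qed.

Lemma flag_of_frame_continuous : continuous (flag_of_frame (R := R) (d := d)).
Proof. by apply/continuousP => U; exact. Qed.

Lemma mkframe_continuous (T : topologicalType) (f : T -> 'M[R]_n)
    (fU : forall t, f t \in unitmx) t :
  {for t, continuous f} -> {for t, continuous (fun t => flag_of_frame (mkframe (fU t)))}.
Proof.
move=> fc.
apply: (@continuous_comp _ _ _ (fun t => mkframe (fU t)) (flag_of_frame (R := R) (d := d))).
  by apply: set_type_continuous.
exact: flag_of_frame_continuous.
Qed.

Definition lead (v : vec) (j : 'I_n) := v ord0 j != 0 /\ forall k : 'I_n, (k < j)%N -> v ord0 k = 0.

Lemma lead_ex (v : vec) : v != 0 -> exists j, lead v j.
Proof.
move=> v0; have [j0 j0P] : exists j, v ord0 j != 0.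
  apply: contrapT => h; case/eqP: v0; apply/rowP => j; rewrite mxE.
  by apply: contrapT => vj; apply: h; exists j; exact/eqP.
case: (@arg_minnP _ j0 (fun j => v ord0 j != 0) (fun j : 'I_n => j : nat) j0P) => j vj jmin.
exists j; split => // k kj; apply: contrapT => /eqP/jmin.
by rewrite leqNgt kj.
Qed.

Definition leads (W : {vspace vec}) (j : 'I_n) := exists2 v, v \in W & lead v j.

Lemma lead_sum (B : 'M[R]_n) (c : vec) (j : 'I_n) :
  (forall k l : 'I_n, (l < k)%N -> B k l = 0) ->
  (forall k : 'I_n, (k < j)%N -> c ord0 k = 0) -> (c *m B) ord0 j = c ord0 j * B j j.
Proof.
move=> Bt c0; rewrite mxE (bigD1 j) //= big1 ?addr0 // => k kj.
case: (ltngtP k j) => kj'; first by rewrite c0 // mul0r.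
  by rewrite Bt // mulr0.
by rewrite (val_inj kj') eqxx in kj.
Qed.

Lemma triangular_unit (B : 'M[R]_n) : (forall k l : 'I_n, (l < k)%N -> B k l = 0) ->
  (forall k, B k k != 0) -> B \in unitmx.
Proof.
move=> Bt Bd; apply: unitmx_inj => v vB; apply/eqP; apply: contrapT => /negP/lead_ex[j [vj v0]].
have := lead_sum Bt v0; rewrite vB mxE => /esym/eqP.
by rewrite mulf_eq0 (negPf vj) (negPf (Bd j)).
Qed.

Lemma flag_top (hr : (0 < r)%N) (F : X) (i : 'I_r) : i = r.-1 :> nat -> flag_space F i = fullv.
Proof.
move=> ir; apply/eqP; rewrite eqEdim subvf flag_dim dimvf /dim /= mul1n.
rewrite /flag_rank /flag_ambient leq_mul2l /=.
rewrite [leqRHS](eq_bigl xpredT) // => j /=.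
by rewrite ir -ltnS prednK // ltn_ord.
Qed.

Definition word := {ffun 'I_n -> 'I_r}.

(* Exactly [2 * d i] positions carry the letter [i], stated cumulatively. *)
Definition wordP (phi : word) := [forall i : 'I_r, #|[pred j | phi j <= i]%N| == rank i].

Definition flag_word (F : X) (phi : word) (B : 'M[R]_n) :=
  [/\ forall k l : 'I_n, (l < k)%N -> B k l = 0, forall k, B k k != 0,
    wordP phi & forall i, flag_space F i = <<[seq row k B | k <- enum 'I_n & (phi k <= i)%N]>>%VS].

(** Gaussian elimination adapted to the flag: [phi j] is the least i such that F_i has a vector with
    leading position j, and B collects such vectors. The induction below shows that they span each
    F_i. *)
Lemma flag_word_ex (hr : (0 < r)%N) (F : X) : exists phi B, flag_word F phi B.
Proof.
have top : exists i : 'I_r, i = r.-1 :> nat.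
  have lt_r : (r.-1 < r)%N by rewrite prednK.
  by exists (Ordinal lt_r).
case: top => top topE.
have lt_top j : leads (flag_space F top) j.
  rewrite (flag_top hr) //; exists (delta_mx 0 j); first exact: memvf.
  split=> [|k kj]; first by rewrite mxE !eqxx oner_eq0.
  by rewrite mxE !eqxx /= (_ : k == j = false) // -val_eqE /= ltn_eqF.
have phi_ex j : exists i : 'I_r, leads (flag_space F i) j /\
    forall i', leads (flag_space F i') j -> (i <= i')%N.
  case: (@arg_minnP _ top (fun i => `[< leads (flag_space F i) j >]) (fun i : 'I_r => i : nat)).
    exact/asboolP.
  move=> i /asboolP ij imin; exists i; split => // i' /asboolP; exact: imin.
have [phi0 phi0P] := choice phi_ex; pose phi : word := [ffun j => phi0 j].
have phiP j (i : 'I_r) : (phi j <= i)%N <-> leads (flag_space F i) j.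
  rewrite ffunE; have [[v vF vj] jmin] := phi0P j; split; last exact: jmin.
  by move=> ji; exists v => //; exact: (subvP (flag_nested F ji)).
have b_ex j : exists v : vec, v \in flag_space F (phi j) /\ lead v j.
  by have [v vF vj] := (phiP j (phi j)).1 (leqnn _); exists v.
have [b bP] := choice b_ex; pose B := \matrix_(k, l) b k ord0 l.
have rowB k : row k B = b k by apply/rowP => l; rewrite !mxE.
have Bt (k l : 'I_n) : (l < k)%N -> B k l = 0.
  by move=> lk; rewrite mxE; have [_ [_]] := bP k; apply.
have Bd k : B k k != 0 by rewrite mxE; have [_ []] := bP k.
have FB i : flag_space F i = <<[seq row k B | k <- enum 'I_n & (phi k <= i)%N]>>%VS.
  apply/eqP; rewrite eqEsubv; apply/andP; split; last first.
    apply/span_subvP => v /mapP[k + ->]; rewrite mem_filter => /andP[ki _].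
    by rewrite rowB; apply: (subvP (flag_nested F ki)); have [] := bP k.
  apply/subvP => v vF.

  (* N bounds the number of trailing coordinates that may be nonzero; subtracting a multiple of
     [b j] clears the leftmost of them. *)
  have : forall N (v : vec), v \in flag_space F i ->
      (forall k : 'I_n, (k < n - N)%N -> v ord0 k = 0) ->
      v \in <<[seq row k B | k <- enum 'I_n & (phi k <= i)%N]>>%VS.
    elim=> [|M IH] {vF} {}v vF v0.
      suff -> : v = 0 by exact: mem0v.
      by apply/rowP => k; rewrite mxE v0 // subn0.
    case: (leqP n M) => [nM|Mn].
      by apply: IH => // k; rewrite (_ : (n - M)%N = 0%N) //; apply/eqP; rewrite subn_eq0.
    have ltj : (n - M.+1 < n)%N by lia.
    pose j := Ordinal ltj.
    have [vj|vj] := eqVneq (v ord0 j) 0.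
      apply: IH => // k kM; have [kj|kj] := ltnP k (n - M.+1)%N; first exact: v0.
      by have -> : k = j by apply/val_inj => /=; lia.
    have ji : (phi j <= i)%N by apply/phiP; exists v.
    have bF : b j \in flag_space F i.
      by apply: (subvP (flag_nested F ji)); have [] := bP j.
    rewrite -(subrK ((v ord0 j / B j j) *: b j) v); apply: rpredD; last first.
      apply: rpredZ; apply: memv_span; apply/mapP; exists j; last by rewrite rowB.
      by rewrite mem_filter ji mem_enum.
    apply: IH; first by apply: rpredB => //; exact: rpredZ.
    move=> k kM; rewrite !mxE.
    have [kj|kj] := ltnP k (n - M.+1)%N.
      have bk : b j ord0 k = 0 by have [_ [_ h]] := bP j; exact: h.
      by rewrite (v0 k) // bk mulr0 subr0.
    have -> : k = j by apply/val_inj => /=; lia.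
    by rewrite -mulrA mulVf ?mulr1 ?subrr //; have := Bd j; rewrite mxE.
  by move=> /(_ n v vF); apply => k; rewrite subnn.
exists phi, B; split => //.
apply/forallP => i; rewrite -(flag_dim F i) FB dim_span_rows //.
exact: triangular_unit.
Qed.

End Flags.

(** * Affine charts indexed by words *)

Section Charts.
Context {R : realType} {r : nat} (d : 'I_r -> nat).
Local Notation X := (even_flag R r d).
Local Notation n := (flag_ambient d).
Local Notation rank := (flag_rank d).
Local Notation vec := 'rV[R]_n.
Local Notation word := (word d).
Local Notation frame gU := (flag_of_frame (@mkframe R r d _ gU)).

Lemma sorted_count (s : seq 'I_n) (phi : word) (i : nat) (x0 : 'I_n) k :
  sorted (fun j j' => phi j <= phi j')%N s -> (k < size s)%N ->
  (phi (nth x0 s k) <= i)%N = (k < count (fun j => phi j <= i)%N s)%N.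
Proof.
elim: s k => [//|x s IH] k /= ps ks.
have tr : transitive (fun j j' : 'I_n => phi j <= phi j')%N by move=> a b c; exact: leq_trans.
have all_s := order_path_min tr ps.
have xi_false : (phi x <= i)%N = false -> count (fun j => phi j <= i)%N s = 0%N.
  move=> xi; apply/eqP; rewrite -leqn0 leqNgt -has_count; apply/hasPn => y ys.
  by rewrite -ltnNge; have /allP/(_ y ys) := all_s; apply: leq_trans; rewrite ltnNge xi.
case xi : (phi x <= i)%N; case: k ks => [|k] ks /=; rewrite ?xi //.
- by rewrite IH ?(path_sorted ps) // add1n ltnS.
- by rewrite xi_false.
- rewrite xi_false //; apply/negbTE; rewrite -ltnNge.
  have /allP/(_ (nth x0 s k)) := all_s; rewrite mem_nth // => /(_ isT).
  by apply: leq_trans; rewrite ltnNge xi.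
Qed.

(** Sorting the positions by letter makes the positions of letter at most i an initial segment of
    length rank i, as [flag_of_frame] requires of the rows. *)
Lemma word_order (phi : word) : wordP phi ->
  exists s : 'S_n, forall k (i : 'I_r), (phi (s k) <= i)%N = (k < rank i)%N.
Proof.
move=> /forallP wP; pose e := sort (fun j j' => phi j <= phi j')%N (enum 'I_n).
have se : size e = n by rewrite size_sort size_enum_ord.
have ue : uniq e by rewrite sort_uniq enum_uniq.
have w_inj : injective (fun k : 'I_n => nth k e k).
  move=> k l /eqP; rewrite (set_nth_default l) ?se ?ltn_ord //.
  by rewrite nth_uniq ?se ?ltn_ord // => /eqP/val_inj.
exists (perm w_inj) => k i; rewrite permE sorted_count ?se ?ltn_ord //; last first.
  by apply: sort_sorted => j j'; exact: leq_total.
congr (_ < _)%N; rewrite -(eqP (wP i)) -sum1_card -sum1_count.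
rewrite (perm_big (enum 'I_n)) ?perm_sort //= big_enum_cond /=.
by apply: eq_bigl => j; rewrite inE.
Qed.

Lemma row_perm_unit (s : 'S_n) (U : 'M[R]_n) : U \in unitmx -> row_perm s U \in unitmx.
Proof. by move=> UU; rewrite row_permE unitmx_mul unitmx_perm. Qed.

Lemma mem_frame (g : 'M[R]_n) (gU : g \in unitmx) i (v : vec) :
  v \in flag_space (frame gU) i <->
  exists2 c : vec, v = c *m g & forall k : 'I_n, (rank i <= k)%N -> c ord0 k = 0.
Proof. by rewrite -mem_first_rows /= set_valE. Qed.

Lemma mem_frame_word (phi : word) (s : 'S_n) (U : 'M[R]_n) (UU : U \in unitmx) i (v : vec) :
  (forall k (i : 'I_r), (phi (s k) <= i)%N = (k < rank i)%N) ->
  v \in flag_space (frame (row_perm_unit s UU)) i <->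
  exists2 c : vec, v = c *m U & forall j : 'I_n, (i < phi j)%N -> c ord0 j = 0.
Proof.
move=> sP; rewrite mem_frame.
have E (c : vec) : c *m row_perm s U = col_perm s^-1 c *m U.
  by rewrite row_permE mulmxA; congr (_ *m _); rewrite col_permE invgK.
split=> -[c -> c0].
  exists (col_perm s^-1 c); first exact: E.
  move=> j ij; rewrite mxE c0 // leqNgt -sP permKV -ltnNge //.
exists (col_perm s c); first by rewrite E -col_permM mulVg col_perm1.
by move=> k ik; rewrite mxE c0 // ltnNge sP -leqNgt.
Qed.

Lemma frame_ex (hr : (0 < r)%N) (F : X) : exists g (gU : g \in unitmx), F = frame gU.
Proof.
have [phi [B [Bt Bd wP FB]]] := flag_word_ex hr F.
have [s sP] := word_order wP; have BU := triangular_unit Bt Bd.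
exists (row_perm s B), (row_perm_unit s BU); apply: flag_eq => i.
apply/vspaceP => v; apply/idP/idP.
  rewrite FB => /(mem_span_rows B (fun k => phi k <= i)%N)[c vc c0].
  by apply/(mem_frame_word BU i v sP); exists c => // j ij; apply: c0; rewrite -ltnNge.
move=> /(mem_frame_word BU i v sP)[c vc c0].
rewrite FB; apply/(mem_span_rows B (fun k => phi k <= i)%N).
by exists c => // j ij; apply: c0; rewrite ltnNge.
Qed.

(* The flags transverse to the coordinate flag complementary to [phi]. *)
Definition chart_dom (phi : word) : set X := [set F | forall i v,
  v \in flag_space F i -> (forall k, (phi k <= i)%N -> v ord0 k = 0) -> v = 0].

Lemma chart_cover (hr : (0 < r)%N) (F : X) : exists2 phi, wordP phi & chart_dom phi F.
Proof.
have [phi [B [Bt Bd wP FB]]] := flag_word_ex hr F; exists phi => // i v.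
rewrite FB => /(mem_span_rows B (fun k => phi k <= i)%N)[c -> c0] v0.
suff -> : c = 0 by rewrite mul0mx.
apply/eqP; apply: contrapT => /negP/lead_ex[j [cj cl]].
have ji : (phi j <= i)%N by apply: contraNT cj => /c0 ->.
have := lead_sum Bt cl; rewrite v0 // => /esym/eqP.
by rewrite mulf_eq0 (negPf cj) (negPf (Bd j)).
Qed.

Definition unip (phi : word) (x : 'M[R]_n) : 'M[R]_n :=
  \matrix_(j, k) (if (phi j < phi k)%N then x j k else (j == k)%:R).

Lemma mul_unip (phi : word) x (c : vec) k :
  (c *m unip phi x) ord0 k = c ord0 k + \sum_(j | (phi j < phi k)%N) c ord0 j * x j k.
Proof.
rewrite mxE (bigID (fun j => phi j < phi k)%N) /= addrC; congr (_ + _).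
  rewrite (bigD1 k) ?ltnn //= mxE ltnn eqxx mulr1 big1 ?addr0 // => j /andP[jk jk'].
  by rewrite mxE (negPf jk) (negPf jk') mulr0.
by apply: eq_bigr => j jk; rewrite mxE jk.
Qed.

(** [unip] is unitriangular with respect to the letters, so the coordinates of c vanish one letter
    after another. *)
Lemma unip_zero (phi : word) x (c : vec) (S : pred 'I_n) :
  (forall k, S k -> (c *m unip phi x) ord0 k = 0) ->
  (forall k, ~~ S k -> c ord0 k = 0) -> c = 0.
Proof.
move=> cS cN; apply/rowP => k; rewrite mxE.
have [m] := ubnP (phi k); elim: m k => [//|m IH] k km.
case Sk : (S k); last by rewrite cN // Sk.
have := cS k Sk; rewrite mul_unip big1 ?addr0 // => j jk.
by rewrite IH ?mul0r //; exact: leq_trans jk _.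
Qed.

Lemma unip_unit phi x : unip phi x \in unitmx.
Proof.
apply: unitmx_inj => v v0; apply: (unip_zero (phi := phi) (x := x) (S := xpredT)) => // k _.
by rewrite v0 mxE.
Qed.

Definition word_perm (phi : word) (wP : wordP phi) : 'S_n := projT1 (cid (word_order wP)).

Lemma word_permP (phi : word) (wP : wordP phi) k (i : 'I_r) :
  (phi (word_perm wP k) <= i)%N = (k < rank i)%N.
Proof. by rewrite /word_perm; case: cid. Qed.

(** The domain is the full matrix space, of which [unip] reads only the entries with phi j < phi k.
    In this form the half space computations apply directly, with J the list of inversions. *)
Definition sigma (phi : word) (wP : wordP phi) (x : 'M[R]_n) : X :=
  frame (row_perm_unit (word_perm wP) (unip_unit phi x)).

(* In the chart of [phi], [F i] has the basis of the [u_j], [phi j <= i], where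
   [u_j] is the vector of [F (phi j)] congruent to [e_j] modulo the [e_k] with
   [phi k > phi j]. *)
Definition is_coord (phi : word) (F : X) j (v : vec) :=
  v \in flag_space F (phi j) /\ forall k, (phi k <= phi j)%N -> v ord0 k = (j == k)%:R.

Definition tau (phi : word) (F : X) : 'M[R]_n :=
  \matrix_(j, k) (xget 0 (is_coord phi F j) : vec) ord0 k.

Section Word.
Context (phi : word) (wP : wordP phi).
Local Notation s := (word_perm wP).

Lemma mem_sigma x i (v : vec) : v \in flag_space (sigma wP x) i <->
  exists2 c : vec, v = c *m unip phi x & forall j : 'I_n, (i < phi j)%N -> c ord0 j = 0.
Proof. exact: mem_frame_word (@word_permP phi wP). Qed.

Lemma sigma_dom x : chart_dom phi (sigma wP x).
Proof.
move=> i v /mem_sigma[c -> c0] v0; rewrite (_ : c = 0) ?mul0mx //.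
apply: (unip_zero (phi := phi) (x := x) (S := fun k => phi k <= i)%N) => // k.
by rewrite -ltnNge; exact: c0.
Qed.

Lemma sigma_continuous : continuous (sigma wP).
Proof.
move=> x; apply: (@mkframe_continuous _ _ _ _ (fun y => row_perm s (unip phi y))
  (fun y => row_perm_unit s (unip_unit phi y)) x); apply: cvg_mx => j k.
have -> : (fun y => row_perm s (unip phi y) j k) =
  fun y => if (phi (s j) < phi k)%N then y (s j) k else (s j == k)%:R.
  by apply/funext => y; rewrite !mxE.
by case: (_ < _)%N; [exact: coord_continuous|exact: cst_continuous].
Qed.

Lemma coord_uniq F j u v : chart_dom phi F -> is_coord phi F j u -> is_coord phi F j v -> u = v.
Proof.
move=> VF [uF u1] [vF v1]; apply/eqP; rewrite -subr_eq0; apply/eqP; apply: VF (rpredB uF vF) _.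
by move=> k kj; rewrite !mxE u1 // v1 // subrr.
Qed.

(** The block of g in its initial rank i rows and the columns of letter at most i, bordered by an
    identity so that its size does not depend on i. *)
Definition minor (g : 'M[R]_n) (i : 'I_r) : 'M[R]_n := \matrix_(a, b)
  if (a < rank i)%N && (b < rank i)%N then g a (s b) else (a == b)%:R.

Lemma minor_high g i (c : vec) (b : 'I_n) : (rank i <= b)%N -> (c *m minor g i) ord0 b = c ord0 b.
Proof.
move=> ib; rewrite mxE (bigD1 b) //= mxE ltnNge ib eqxx mulr1 big1 ?addr0 // => a /negPf ab.
by rewrite mxE [(b < _)%N]ltnNge ib andbF ab mulr0.
Qed.

Lemma minor_low (g : 'M[R]_n) (i : 'I_r) (c : vec) (b : 'I_n) : (b < rank i)%N ->
  (forall a : 'I_n, (rank i <= a)%N -> c ord0 a = 0) ->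
  (c *m minor g i) ord0 b = (c *m g) ord0 (s b).
Proof.
move=> ib c0; rewrite !mxE; apply: eq_bigr => a _; rewrite mxE ib andbT.
by case: ltnP => // /c0 ->; rewrite !mul0r.
Qed.

Lemma chart_domP g (gU : g \in unitmx) :
  chart_dom phi (frame gU) <-> forall i, minor g i \in unitmx.
Proof.
split=> [V i|M i v /mem_frame[c -> c0] v0].
  apply: unitmx_inj => c cM.
  have c0 (a : 'I_n) : (rank i <= a)%N -> c ord0 a = 0.
    by move=> ia; rewrite -(@minor_high g (i)) // cM mxE.
  have : c *m g = 0.
    apply: (V i); first by apply/mem_frame; exists c.
    move=> k; rewrite -(permKV s k) word_permP => ki.
    by rewrite -(@minor_low g i) // cM mxE.
  by move=> /(congr1 (mulmx^~ (invmx g))); rewrite mulmxK // mul0mx.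
suff -> : c = 0 by rewrite mul0mx.
have : c *m minor g i = 0.
  apply/rowP => b; rewrite [RHS]mxE; have [ib|ib] := ltnP b (rank i).
    by rewrite minor_low // v0 // word_permP.
  by rewrite minor_high // c0.
by move=> /(congr1 (mulmx^~ (invmx (minor g i)))); rewrite mulmxK // mul0mx.
Qed.

(** A rational formula in the frame for the rows of [tau], which are otherwise given by choice; the
    continuity of [tau] rests on it. *)
Definition frame_coord (g : 'M[R]_n) (j : 'I_n) : vec :=
  row (s^-1%g j) (invmx (minor g (phi j)) *m g).

Lemma frame_coordP g (gU : g \in unitmx) j : chart_dom phi (frame gU) ->
  is_coord phi (frame gU) j (frame_coord g j).
Proof.
move=> /chart_domP/(_ (phi j)) MU; pose a := s^-1%g j.
have ai : (a < rank (phi j))%N by rewrite -(word_permP wP) permKV.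
pose c := row a (invmx (minor g (phi j))).
have cM b : (c *m minor g (phi j)) ord0 b = (a == b)%:R.
  by rewrite -row_mul mulVmx // !mxE.
have c0 (b : 'I_n) : (rank (phi j) <= b)%N -> c ord0 b = 0.
  move=> ib; rewrite -(@minor_high g (phi j)) // cM; case: eqP => // ab.
  by move: ib; rewrite -ab leqNgt ai.
have E : frame_coord g j = c *m g by rewrite /frame_coord row_mul.
rewrite E; split; first by apply/mem_frame; exists c.
move=> k; rewrite -{1}(permKV s k) word_permP => ki.
rewrite -{1}(permKV s k) -(@minor_low g (phi j)) // cM; congr (_ %:R).
by rewrite /a (inj_eq perm_inj).
Qed.

Lemma tauP (hr : (0 < r)%N) F j : chart_dom phi F -> is_coord phi F j (row j (tau phi F)).
Proof.
have [g [gU ->]] := frame_ex hr F => V.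
have -> : row j (tau phi (frame gU)) = xget 0 (is_coord phi (frame gU) j).
  by apply/rowP => k; rewrite !mxE.
exact: xgetPex (ex_intro _ _ (frame_coordP j V)).
Qed.

Lemma tau_frame (hr : (0 < r)%N) g (gU : g \in unitmx) : chart_dom phi (frame gU) ->
  tau phi (frame gU) = \matrix_(j, k) frame_coord g j ord0 k.
Proof.
move=> V; apply/row_matrixP => j; apply: (coord_uniq V (tauP hr j V)).
have -> : row j (\matrix_(j, k) frame_coord g j ord0 k) = frame_coord g j.
  by apply/rowP => k; rewrite !mxE.
exact: frame_coordP.
Qed.

Lemma sigmaK (hr : (0 < r)%N) F : chart_dom phi F -> sigma wP (tau phi F) = F.
Proof.
move=> V; apply: flag_eq_sub => i; apply/subvP => v /mem_sigma[c -> c0].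
rewrite mulmx_sum_row; apply: rpred_sum => j _.
have [ij|ji] := ltnP i (phi j); first by rewrite c0 // scale0r mem0v.
apply: rpredZ; apply: (subvP (flag_nested F ji)).
have [tF t1] := tauP hr j V.
suff -> : row j (unip phi (tau phi F)) = row j (tau phi F) by [].
apply/rowP => k; rewrite [LHS]mxE mxE; case: ltnP => jk; first by rewrite [RHS]mxE.
by rewrite t1.
Qed.

Lemma sigma_coord x j : is_coord phi (sigma wP x) j (row j (unip phi x)).
Proof.
split.
  apply/mem_sigma; exists (delta_mx 0 j); first by rewrite -rowE.
  by move=> k jk; rewrite mxE eqxx /=; case: eqP => // kj; rewrite kj ltnn in jk.
by move=> k kj; rewrite !mxE ltnNge kj.
Qed.

Lemma tauK (hr : (0 < r)%N) x j k : (phi j < phi k)%N -> tau phi (sigma wP x) j k = x j k.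
Proof.
move=> jk; have V : chart_dom phi (sigma wP x) by exact: sigma_dom.
have := coord_uniq V (tauP hr j V) (sigma_coord x j).
by move/rowP/(_ k); rewrite !mxE jk.
Qed.

Lemma minor_continuous i : continuous (fun g => minor g i).
Proof.
move=> g; apply: cvg_mx => a b.
have -> : (fun g => minor g i a b) = fun g => if (a < rank i)%N && (b < rank i)%N then g a (s b) else (a == b)%:R.
  by apply/funext => y; rewrite mxE.
by case: (_ && _); [exact: coord_continuous|exact: cst_continuous].
Qed.

Lemma frame_coord_continuous g : (forall i, minor g i \in unitmx) ->
  {for g, continuous (fun g => \matrix_(j, k) frame_coord g j ord0 k)}.
Proof.
move=> MU; apply: cvg_mx => j k.
have -> : (fun g : 'M[R]_n => (\matrix_(j, k) frame_coord g j ord0 k) j k) =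
  fun g => (invmx (minor g (phi j)) *m g) (s^-1%g j) k.
  by apply/funext => y; rewrite !mxE.
apply: (@cont_entry _ _ _ _ (fun g => invmx (minor g (phi j)) *m g)).
apply: cont_mulmx; last exact: cvg_id.
by apply: cont_invmx => //; exact: minor_continuous.
Qed.

Lemma near_minor_unit (g : 'M[R]_n) : (forall i, minor g i \in unitmx) ->
  \forall h \near g, forall i, minor h i \in unitmx.
Proof.
move=> MU; apply: (@filter_forall _ _ (fun (i : 'I_r) (h : 'M[R]_n) => minor h i \in unitmx : Prop) _ (nbhs_filter g)) => i.
have d0 : \det (minor g i) != 0 by rewrite -unitfE -unitmxE.
have dc := @cont_det _ _ _ (fun g => minor g i) g (@minor_continuous i g).
have : \forall y \near g, \det (minor y i) != 0 by exact: dc _ (nbhs_neq0 d0).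
by apply: filterS => y /=; rewrite unitmxE unitfE.
Qed.

Lemma frameE (f : @frames R r d) : flag_of_frame f = frame (set_mem (valP f)).
Proof. by congr flag_of_frame; apply/val_inj. Qed.

Lemma flag_nbhs F (A : set X) :
  (forall f : @frames R r d, A (flag_of_frame f) -> \forall h \near f, A (flag_of_frame h)) ->
  A F -> nbhs F A.
Proof.
move=> Aop AF; apply: open_nbhs_nbhs; split => //.
suff : open (@flag_of_frame R r d @^-1` A) by [].
rewrite openE => f /= /Aop; exact.
Qed.

Lemma near_frame (f : @frames R r d) (P : 'M[R]_n -> Prop) :
  (\forall g \near (set_val f : 'M[R]_n), P g) -> \forall h \near f, P (set_val h).
Proof. by move=> h; apply: (@initial_continuous _ _ set_val f). Qed.

Lemma chart_open : open (chart_dom phi).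
Proof.
suff : open (@flag_of_frame R r d @^-1` chart_dom phi) by [].
rewrite openE => f /=; rewrite /preimage /= frameE => /chart_domP MU.
have := near_frame (near_minor_unit MU); rewrite /interior /=.
apply: filterS => h /= MUh; rewrite frameE; apply/chart_domP.
exact: MUh.
Qed.

Lemma tau_continuous (hr : (0 < r)%N) F : chart_dom phi F -> {for F, continuous (tau phi)}.
Proof.
move=> VF U; rewrite /= => /nbhs_interior UF.
(* Asking for a neighbourhood of [tau phi G], rather than for membership in U, makes this set open
   when pulled back to frames, as [flag_nbhs] demands. *)
suff : nbhs F (chart_dom phi `&` [set G | nbhs (tau phi G) U]).
  by apply: filterS => G [_ /nbhs_singleton].
apply: flag_nbhs; last by split => //; exact: nbhs_singleton UF.
move=> f [/=]; rewrite frameE => Vf; rewrite tau_frame // => Uf.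
have MU := (chart_domP _).1 Vf.
have h1 := near_frame (near_minor_unit MU).
have h2 := near_frame (frame_coord_continuous MU (nbhs_interior Uf)).
near=> h.
have MUh : forall i, minor (set_val h) i \in unitmx by near: h.
have Vh : chart_dom phi (flag_of_frame h) by rewrite frameE; apply/chart_domP.
split=> //=; move: (Vh); rewrite frameE => Vh'; rewrite tau_frame //.
by near: h; exact: h2.
Unshelve. all: by end_near.
Qed.

End Word.
End Charts.

(** * Schubert cells and inversions *)

Section Cells.
Context {R : realType} {r : nat} (d : 'I_r -> nat).
Local Notation X := (even_flag R r d).
Local Notation n := (flag_ambient d).
Local Notation word := (word d).
Local Notation pos := ('I_n * 'I_n)%type.
Implicit Types (phi psi : word) (F : X) (j k l : 'I_n).

Definition inversion phi (p : pos) := (p.2 < p.1)%N && (phi p.1 < phi p.2)%N.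

Definition inversions phi : seq pos := [seq p <- enum {: pos} | inversion phi p].

Definition inv_num phi := size (inversions phi).

Lemma mem_inversions phi p : (p \in inversions phi) = inversion phi p.
Proof. by rewrite mem_filter mem_enum andbT. Qed.

Lemma inversions_uniq phi : uniq (inversions phi).
Proof. by rewrite filter_uniq // enum_uniq. Qed.

Definition swap phi j k : word := [ffun l => phi (tperm j k l)].

Lemma swap_wordP phi j k : wordP phi -> wordP (swap phi j k).
Proof.
move=> /forallP wP; apply/forallP => i; rewrite -(eqP (wP i)) -!sum1_card.
rewrite [X in _ == X](reindex_inj (@perm_inj _ (tperm j k))) /=; apply/eqP.
by apply: eq_bigl => l; rewrite !inE ffunE.
Qed.

Lemma swapE phi j k l : swap phi j k l =
  if l == j then phi k else if l == k then phi j else phi l.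
Proof.
rewrite ffunE; case: tpermP => [->|->|/eqP/negPf-> /eqP/negPf->] //; first by rewrite eqxx.
by case: eqP => [->|]; rewrite ?eqxx.
Qed.

(* Transposing both positions of a pair, unless this would reverse the pair,
   is an involution of ordered pairs; it maps the inversions of the swapped
   word to inversions of [phi] other than the swapped pair itself. *)
Lemma inv_num_swap phi j k : inversion phi (j, k) -> (inv_num (swap phi j k) < inv_num phi)%N.
Proof.
move=> jk_inv; have /andP[/= kj jk] := jk_inv; rewrite /inv_num.
pose t := tperm j k.
pose f (p : pos) : pos := if (t p.2 < t p.1)%N then (t p.1, t p.2) else p.
have tt l : t (t l) = l by rewrite /t tpermK.
have fK (p : pos) : (p.2 < p.1)%N -> f (f p) = p.
  move=> lt; rewrite /f; case h : (t p.2 < t p.1)%N => /=; last by rewrite h.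
  by rewrite !tt lt; case: p {lt h}.
pose s := [seq f p | p <- inversions (swap phi j k)].
suff : (size ((j, k) :: s) <= size (inversions phi))%N by rewrite /= size_map.
apply: uniq_leq_size.
  rewrite cons_uniq map_inj_in_uniq ?inversions_uniq ?andbT; last first.
    move=> p q; rewrite !mem_inversions => /andP[hp _] /andP[hq _] /(congr1 f).
    by rewrite !fK.
  apply/mapP => -[[a b]]; rewrite mem_inversions /inversion /= !ffunE => /andP[ba ab].
  rewrite /f /=; case h : (t b < t a)%N => -[E1 E2].
    have Ea : a = k by rewrite -(tt a) -E1 /t tpermL.
    have Eb : b = j by rewrite -(tt b) -E2 /t tpermR.
    by move: ba kj; rewrite Ea Eb => h1 h2; have := ltn_trans h1 h2; rewrite ltnn.
  by move: ab; rewrite -E1 -E2 tpermL tpermR ltnNge ltnW.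
move=> q; rewrite inE => /orP[/eqP ->|/mapP[[a b]]]; first by rewrite mem_inversions.
rewrite mem_inversions /inversion /= !ffunE => /andP[ba ab] ->.
rewrite /f mem_inversions /inversion /=; case h : (t b < t a)%N => /=.
  by rewrite h ab.
rewrite ba /=; move: h ab; rewrite /t.
case: tpermP => [Eb|Eb|/eqP bj /eqP bk]; case: tpermP => [Ea|Ea|/eqP aj /eqP ak] h ab;
  subst; move: ba kj jk h ab; rewrite -?val_eqE /=; lia.
Qed.

(* An off-diagonal entry with [k < j] and minimal gap [phi k - phi j] is not
   affected by the elimination that expresses the flag in the swapped chart. *)
Lemma swap_dom phi (wP : wordP phi) (x : 'M[R]_n) j k : inversion phi (j, k) ->
  x j k != 0 ->
  (forall j' k', inversion phi (j', k') -> x j' k' != 0 ->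
    (phi k - phi j <= phi k' - phi j')%N) ->
  chart_dom (swap phi j k) (sigma wP x).
Proof.
move=> /andP[/= kj jk] xjk xmin i v vF v0.
(* Unless phi j <= i < phi k, the two words have letters at most i at the same positions, so there
   is nothing to prove for F_i. *)
have [out|/andP[ji ik]] : ((i < phi j) || (phi k <= i))%N \/ ((phi j <= i) && (i < phi k))%N.
- by case: (ltnP i (phi j)) => h1; [left|case: (leqP (phi k) i) => h2; [left; rewrite orbT|right]].
- apply: (@sigma_dom _ _ _ _ wP x i v vF) => l li; apply: v0; rewrite swapE.
  by case: eqP => [lj|_]; [|case: eqP => [lk|_]]; subst; lia.
have [c vE c0] := (mem_sigma wP x i v).1 vF.
have vl l : (phi l <= i)%N -> l != j -> (c *m unip phi x) ord0 l = 0.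
  move=> li /negPf lj; rewrite -vE; apply: v0; rewrite swapE lj.
  by case: eqP => // lk; rewrite lk leqNgt ik in li.
have vk : (c *m unip phi x) ord0 k = 0.
  rewrite -vE; apply: v0; rewrite swapE eqxx.
  by case: eqP => // kj'; rewrite kj' ltnn in kj.
(* If c is nonzero at l != j, some l' of smaller letter has c and x l' l nonzero. Were l' to the
   right of l, (l', l) would be an inversion of gap smaller than that of (j, k), because phi j <=
   phi l' and phi l <= i < phi k. Hence j <= l' < l. *)
have supp l : c ord0 l != 0 -> l = j \/ ((phi j < phi l)%N /\ (j < l)%N).
  have [m] := ubnP (phi l); elim: m l => [//|m IH] l lm cl.
  have [->|lj] := eqVneq l j; [by left|right].
  have li : (phi l <= i)%N by rewrite leqNgt; apply: contra cl => /c0 ->.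
  have := vl l li lj; rewrite mul_unip.
  case: (pickP (fun l' => (phi l' < phi l)%N && (c ord0 l' * x l' l != 0))) => [l'|none].
    move=> /andP[l'l]; rewrite mulf_eq0 negb_or => /andP[cl' xl'] _.
    have h : (phi j <= phi l')%N /\ (j <= l')%N.
      by have [->|[h1 h2]] := IH l' (leq_trans l'l lm) cl'; split=> //; exact: ltnW.
    have [/= ll'|l'l2] := ltnP l l'; last first.
      split; first by lia.
      have : l' != l by apply: contraTneq l'l => ->; rewrite ltnn.
      by rewrite -val_eqE /= => ne; lia.
    have := xmin l' l; rewrite /inversion /= ll' l'l => /(_ isT xl').
    by case: h; lia.
  rewrite big1 ?addr0; first by move/eqP; rewrite (negPf cl).
  by move=> l' l'l; have := none l'; rewrite l'l /= => /negbFE/eqP.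
(* At position k only the term of j survives: any other l in the support has j < l and phi j < phi
   l, and minimality of the gap gives x l k = 0. *)
have cj : c ord0 j = 0.
  move: vk; rewrite mul_unip c0 // add0r (bigD1 j) //= big1 ?addr0.
    by move/eqP; rewrite mulf_eq0 (negPf xjk) orbF => /eqP.
  move=> l /andP[lk lj]; apply/eqP; rewrite mulf_eq0.
  case: (eqVneq (c ord0 l) 0) => //= cl.
  have [lj'|[jl jl2]] := supp l cl; first by rewrite lj' eqxx in lj.
  case: (eqVneq (x l k) 0) => // xlk.
  have := xmin l k; rewrite /inversion /= lk (ltn_trans kj jl2) => /(_ isT xlk).
  by lia.
rewrite vE (_ : c = 0) ?mul0mx //.
apply: (unip_zero (phi := phi) (x := x) (S := fun l => phi l <= i)%N) => l; last first.
  by rewrite -ltnNge; exact: c0.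
move=> li; have [->|lj] := eqVneq l j; last exact: vl.
rewrite mul_unip cj add0r big1 // => l' l'j.
case: (eqVneq (c ord0 l') 0) => [->|cl']; first by rewrite mul0r.
have [lj'|[jl' _]] := supp l' cl'; first by rewrite lj' cj mul0r.
by have := ltn_trans jl' l'j; rewrite ltnn.
Qed.

Definition cell phi F := chart_dom phi F /\
  forall j k, inversion phi (j, k) -> tau phi F j k = 0.

Lemma cell_or_swap (hr : (0 < r)%N) phi F : wordP phi -> chart_dom phi F ->
  cell phi F \/ exists2 psi, wordP psi & (inv_num psi < inv_num phi)%N /\ chart_dom psi F.
Proof.
move=> wP V.
pose P (p : pos) := inversion phi p && (tau phi F p.1 p.2 != 0).
case: (pickP P) => [p0 Pp0|none]; last first.
  left; split=> // j k jk; have := none (j, k).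
  by rewrite /P jk /= => /negbFE/eqP.
right; case: (@arg_minnP _ p0 P (fun p => phi p.2 - phi p.1)%N Pp0) => -[j k] /andP[jk xjk] pmin.
exists (swap phi j k); first exact: swap_wordP.
split; first exact: inv_num_swap.
rewrite -(sigmaK wP hr V); apply: swap_dom => // j' k' jk' xjk'.
by apply: (pmin (j', k')); rewrite /P jk'.
Qed.

(** On the cell [unip] is upper triangular with unit diagonal, so its rows have their leading
    entries on the diagonal. The word is therefore recovered from the flag. *)
Lemma cell_leads (hr : (0 < r)%N) phi F : wordP phi -> cell phi F ->
  forall i j, leads (flag_space F i) j <-> (phi j <= i)%N.
Proof.
move=> wP [V x0] i j; pose x := tau phi F.
have Ut (a b : 'I_n) : (b < a)%N -> unip phi x a b = 0.
  move=> ba; rewrite mxE; case: ifP => ab; first by apply: x0; rewrite /inversion /= ba.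
  by rewrite -val_eqE /= gtn_eqF.
have Ud a : unip phi x a a = 1 by rewrite mxE ltnn eqxx.
rewrite -(sigmaK wP hr V) -/x; split.
  case=> v /(mem_sigma wP x)[c -> c0] [vj vl].
  have c_lt (l : 'I_n) : (l < j)%N -> c ord0 l = 0.
    have [m] := ubnP (l : nat); elim: m l => [//|m IH] l lm lj.
    have := vl l lj; rewrite (lead_sum Ut) ?Ud ?mulr1 // => l' l'l.
    by apply: IH; [exact: leq_trans l'l lm|exact: ltn_trans l'l lj].
  rewrite (lead_sum Ut) ?Ud ?mulr1 // in vj.
  by rewrite leqNgt; apply: contra vj => /c0 ->.
move=> ji; exists (row j (unip phi x)).
  apply/(mem_sigma wP x); exists (delta_mx 0 j); first by rewrite -rowE.
  by move=> k ik; rewrite mxE eqxx /=; case: eqP => // kj; move: ik; rewrite kj ltnNge ji.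
split; first by rewrite mxE Ud oner_eq0.
by move=> k kj; rewrite mxE Ut.
Qed.

Lemma cell_uniq (hr : (0 < r)%N) phi psi F : wordP phi -> wordP psi ->
  cell phi F -> cell psi F -> phi = psi.
Proof.
move=> wP wP' cP cP'; apply/ffunP => j.
have h (i : 'I_r) : (phi j <= i)%N <-> (psi j <= i)%N.
  exact: iff_trans (iff_sym (cell_leads hr wP cP i j)) (cell_leads hr wP' cP' i j).
by apply/val_inj/anti_leq; rewrite (h (psi j)).2 // (h (phi j)).1.
Qed.

(** Swaps lower the number of inversions and keep F in the chart, so they end at a cell containing
    F, and that cell is unique. *)
Lemma cell_lt (hr : (0 < r)%N) phi psi F : wordP phi -> wordP psi ->
  cell phi F -> chart_dom psi F -> phi = psi \/ (inv_num phi < inv_num psi)%N.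
Proof.
move=> wP; have [m] := ubnP (inv_num psi).
elim: m psi => [//|m IH] psi pm wP' cP V.
have [cP'|[psi' wP2 [lt V']]] := cell_or_swap hr wP' V.
  by left; exact: cell_uniq cP cP'.
right; have [->//|lt'] := IH psi' (leq_trans lt pm) wP2 cP V'.
exact: ltn_trans lt' lt.
Qed.

Definition flag_index := {phi : word | wordP phi}.

Definition index_inv (i : flag_index) := inv_num (sval i).

Definition index_dom (i : flag_index) : set X := chart_dom (sval i).

Lemma index_sep (hr : (0 < r)%N) (i j : flag_index) : i != j -> index_inv i = index_inv j ->
  index_dom i `&` index_dom j `<=` level_set index_inv index_dom (index_inv i).
Proof.
move=> ij ainv F [Vi Vj].
have [ci|[psi wP [lt V]]] := cell_or_swap hr (valP i) Vi; last first.
  by exists (exist _ psi wP).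
have [E|] := cell_lt hr (valP i) (valP j) ci Vj.
  by case/eqP: ij; apply/val_inj.
by rewrite -/(index_inv i) -/(index_inv j) ainv ltnn.
Qed.

Lemma index_cover (hr : (0 < r)%N) F : exists i, index_dom i F.
Proof.
by have [phi wP V] := chart_cover hr F; exists (exist _ phi wP).
Qed.

Lemma index_level (hr : (0 < r)%N) (i : flag_index) (x : 'M[R]_n) :
  level_set index_inv index_dom (index_inv i) (sigma (valP i) x) <->
  exists2 p, p \in inversions (sval i) & x p.1 p.2 != 0.
Proof.
have V : chart_dom (sval i) (sigma (valP i) x) by exact: sigma_dom.
split=> [[[psi wP'] lt Vpsi]|[p]].
  apply: contrapT => none.
  have ci : cell (sval i) (sigma (valP i) x).
    split=> // j k jk; rewrite tauK //; last by case/andP: jk.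
    apply/eqP; apply: contrapT => /negP xjk; apply: none; exists (j, k) => //.
    by rewrite mem_inversions.
  have [E|] := cell_lt hr (valP i) wP' ci Vpsi.
    by move: lt; rewrite /index_inv /= -E ltnn.
  by rewrite ltnNge ltnW.
rewrite mem_inversions => pinv xp.
have [[_ c0]|[psi wP' [lt V']]] := cell_or_swap hr (valP i) V; last first.
  by exists (exist _ psi wP').
move: xp; case: p pinv => j k jk /=; rewrite -(tauK (valP i) hr x); last by case/andP: jk.
by rewrite c0 ?eqxx.
Qed.

End Cells.

(** * Rotations and parity *)

Section Pairs.
Context {r : nat} (d : 'I_r -> nat).
Local Notation n := (flag_ambient d).

Definition half_size := (\sum_(j < r) d j)%N.

Lemma pair_lt (m : 'I_half_size) (b : bool) : (m.*2 + b < n)%N.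
Proof. by rewrite /flag_ambient -/half_size; have := ltn_ord m; case: b; lia. Qed.

Definition pair_pos (m : 'I_half_size) (b : bool) : 'I_n := Ordinal (pair_lt m b).

Lemma pair_neq m : (pair_pos m false == pair_pos m true) = false.
Proof. by rewrite -val_eqE /=; lia. Qed.

Definition pair_sign m (k : 'I_n) : int :=
  if (k == pair_pos m false) || (k == pair_pos m true) then -1 else 1.

Lemma pair_signK m k : pair_sign m k * pair_sign m k = 1.
Proof. by rewrite /pair_sign; case: ifP. Qed.

End Pairs.

Section Action.
Context {R : realType} {r : nat} (d : 'I_r -> nat).
Local Notation X := (even_flag R r d).
Local Notation n := (flag_ambient d).
Local Notation vec := 'rV[R]_n.
Local Notation word := (word d).
Local Notation frame gU := (flag_of_frame (@mkframe R r d _ gU)).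
Hypothesis hr : (0 < r)%N.

Lemma mulmx_unit (g h : 'M[R]_n) : g \in unitmx -> h \in unitmx -> g *m h \in unitmx.
Proof. by move=> gU hU; rewrite unitmx_mul gU. Qed.

Definition frame_mx (F : X) : 'M[R]_n := projT1 (cid (frame_ex hr F)).

Lemma frame_mxP (F : X) : exists gU : frame_mx F \in unitmx, F = frame gU.
Proof. by rewrite /frame_mx; case: cid. Qed.

Lemma frame_mx_unit (F : X) : frame_mx F \in unitmx.
Proof. by have [] := frame_mxP F. Qed.

(** The definition goes through a chosen frame; [mem_act] shows that the result does not depend on
    it. *)
Definition act (h : 'M[R]_n) (hU : h \in unitmx) (F : X) : X :=
  frame (mulmx_unit (frame_mx_unit F) hU).

Lemma frame_irr (g : 'M[R]_n) (gU gU' : g \in unitmx) : frame gU = frame gU'.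
Proof. by rewrite (Prop_irrelevance gU gU'). Qed.

Lemma mem_act h (hU : h \in unitmx) F i (v : vec) :
  v \in flag_space (act hU F) i <-> exists2 u, u \in flag_space F i & v = u *m h.
Proof.
have [gU FE] := frame_mxP F.
rewrite mem_frame; split.
  move=> [c -> c0]; exists (c *m frame_mx F); last by rewrite mulmxA.
  by rewrite [in flag_space F]FE; apply/mem_frame; exists c.
move=> [u + ->]; rewrite [in flag_space F]FE => /mem_frame[c -> c0].
by exists c; rewrite ?mulmxA.
Qed.

Lemma act_frame (g h : 'M[R]_n) (gU : g \in unitmx) (hU : h \in unitmx) :
  act hU (frame gU) = frame (mulmx_unit gU hU).
Proof.
apply: flag_eq => i; apply/vspaceP => v; apply/idP/idP.
  move=> /mem_act[u /mem_frame[c -> c0] ->]; apply/mem_frame; exists c => //.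
  by rewrite mulmxA.
move=> /mem_frame[c -> c0]; apply/mem_act; exists (c *m g); last by rewrite mulmxA.
by apply/mem_frame; exists c.
Qed.

Section Rotation.
Variable m : 'I_(half_size d).
Local Notation pair_sign := (pair_sign m).
Local Notation p := (pair_pos m false).
Local Notation q := (pair_pos m true).

(* A polynomial path in GL from the identity to the diagonal matrix with
   entries [-1] at [p], [q]; the block at [p], [q] has determinant
   (1 - 2 t)^2 + (t (1 - t))^2 > 0. *)
Definition rot (t : R) : 'M[R]_n :=
  1%:M - (t *+ 2) *: (delta_mx p p + delta_mx q q) +
  (t * (1 - t)) *: (delta_mx q p - delta_mx p q).

Lemma mul_rot (v : vec) t k : (v *m rot t) ord0 k =
  if k == p then v ord0 p * (1 - t *+ 2) + t * (1 - t) * v ord0 q else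
  if k == q then v ord0 q * (1 - t *+ 2) - t * (1 - t) * v ord0 p else v ord0 k.
Proof.
have D (a b : 'I_n) : v *m delta_mx a b = v ord0 a *: delta_mx 0 b.
  apply/rowP => c; rewrite !mxE (bigD1 a) //= big1 => [|l /negPf la].
    by rewrite mxE !eqxx addr0.
  by rewrite mxE la mulr0.
rewrite /rot mulmxDr mulmxBr mulmx1 -!scalemxAr mulmxDr mulmxBr !D !mxE !eqxx /=.
have [->|kp] := eqVneq k p; first by rewrite pair_neq /=; ring.
by have [->|kq] := eqVneq k q; rewrite /=; ring.
Qed.

Lemma rot_det_neq0 (t : R) : (1 - t *+ 2) ^+ 2 + (t * (1 - t)) ^+ 2 != 0.
Proof.
rewrite paddr_eq0 ?sqr_ge0 // !sqrf_eq0; apply/negP => /andP[/eqP c0 /eqP e0].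
have t2 : t = 2^-1 by lra.
by move: e0; rewrite t2; lra.
Qed.

Lemma rot_unit t : rot t \in unitmx.
Proof.
apply: unitmx_inj => v v0.
have E1 := mul_rot v t p; have E2 := mul_rot v t q; have E3 k := mul_rot v t k.
rewrite v0 !mxE eqxx in E1; rewrite v0 !mxE eqxx eq_sym pair_neq in E2.
set a := v ord0 p in E1 E2; set b := v ord0 q in E1 E2.
set c := 1 - t *+ 2 in E1 E2; set e := t * (1 - t) in E1 E2.
have c0 : c ^+ 2 + e ^+ 2 != 0.
  exact: rot_det_neq0.
have a0 : a = 0.
  suff : (c ^+ 2 + e ^+ 2) * a = 0 by move/eqP; rewrite mulf_eq0 (negPf c0) => /eqP.
  have -> : (c ^+ 2 + e ^+ 2) * a = c * (a * c + e * b) - e * (b * c - e * a) by ring.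
  by rewrite -E1 -E2 !mulr0 subrr.
have b0 : b = 0.
  suff : (c ^+ 2 + e ^+ 2) * b = 0 by move/eqP; rewrite mulf_eq0 (negPf c0) => /eqP.
  have -> : (c ^+ 2 + e ^+ 2) * b = e * (a * c + e * b) + c * (b * c - e * a) by ring.
  by rewrite -E1 -E2 !mulr0 addr0.
apply/rowP => k; rewrite [RHS]mxE; have := E3 k; rewrite v0 mxE.
have [->//|kp] := eqVneq k p; have [->//|kq] := eqVneq k q.
by move=> <-.
Qed.

Lemma mul_rot1 (v : vec) k : (v *m rot 1) ord0 k = v ord0 k *~ pair_sign k.
Proof.
rewrite mul_rot /pair_sign; have [->|kp] := eqVneq k p; first by rewrite mulrN1z; ring.
by have [->|kq] := eqVneq k q; rewrite /= ?mulrN1z ?mulr1z //; ring.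
Qed.

Lemma rot0 : rot 0 = 1%:M.
Proof. by rewrite /rot mul0rn !mul0r !scale0r subr0 addr0. Qed.

Definition flip : X -> X := act (rot_unit 1).

Lemma flip_dom (phi : word) F : chart_dom phi F -> chart_dom phi (flip F).
Proof.
move=> V i v /mem_act[u uF ->] v0; rewrite (V i u uF) ?mul0mx // => k ki.
have := v0 k ki; rewrite mul_rot1 /pair_sign; case: ifP => _.
  by rewrite mulrN1z => /eqP; rewrite oppr_eq0 => /eqP.
by rewrite mulr1z.
Qed.

Lemma tau_flip (phi : word) (wP : wordP phi) x j k : (phi j < phi k)%N ->
  tau phi (flip (sigma wP x)) j k = x j k *~ (pair_sign j * pair_sign k).
Proof.
move=> jk; have V : chart_dom phi (sigma wP x) by exact: sigma_dom.
have Vf := flip_dom V.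
have [uF u1] := sigma_coord wP x j; set u := row j _ in uF u1.
have uz l : (u *~ pair_sign j) ord0 l = u ord0 l *~ pair_sign j.
  by rewrite /pair_sign; case: ifP => _; rewrite ?mulrN1z ?mulr1z // mxE.
(* The rotated vector has entry [pair_sign j] at position j; the extra factor restores the
   normalization to 1. *)
have cf : is_coord phi (flip (sigma wP x)) j ((u *~ pair_sign j) *m rot 1).
  split; first by apply/mem_act; exists (u *~ pair_sign j) => //; exact: rpredMz.
  move=> l lj; rewrite mul_rot1 uz u1 // -mulrzA; case: eqP => [->|_].
    by rewrite pair_signK mulr1z.
  by rewrite mul0rz.
have := coord_uniq Vf (tauP wP hr j Vf) cf.
move/rowP/(_ k); rewrite mul_rot1 uz [LHS]mxE => ->.
by rewrite -mulrzA /u !mxE jk.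
Qed.

Lemma rot_continuous : continuous rot.
Proof.
move=> t; apply: cvg_mx => j k.
have -> : (fun t => rot t j k) = fun t : R => (j == k)%:R -
  (t * 2) * ((delta_mx p p + delta_mx q q) : 'M[R]_n) j k +
  (t * (1 - t)) * ((delta_mx q p - delta_mx p q) : 'M[R]_n) j k.
  by apply/funext => u; rewrite /rot !mxE; ring.
have idc : {for t, continuous (fun t : R => t)} by exact: cvg_id.
apply: continuousD.
  apply: continuousB; first exact: cst_continuous.
  apply: continuousM; last exact: cst_continuous.
  by apply: continuousM => //; exact: cst_continuous.
apply: continuousM; last exact: cst_continuous.
apply: continuousM => //; apply: continuousB => //; exact: cst_continuous.
Qed.

Lemma unip_continuous (phi : word) : continuous (unip (R := R) phi).
Proof.
move=> x; apply: cvg_mx => j k.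
have -> : (fun y => unip (R := R) phi y j k) =
  fun y => if (phi j < phi k)%N then y j k else (j == k)%:R.
  by apply/funext => y; rewrite !mxE.
by case: (_ < _)%N; [exact: coord_continuous|exact: cst_continuous].
Qed.

(** The chosen frame of a flag need not vary continuously. Near z it is replaced by the frame built
    from chart coordinates, which gives the same flag. *)
Lemma act_rot_continuous : continuous (fun z : X * R => act (rot_unit z.2) z.1).
Proof.
move=> z; have [phi wP V] := chart_cover hr z.1.
pose A (y : X * R) := row_perm (word_perm wP) (unip phi (tau phi y.1)).
have AU y : A y \in unitmx by exact: row_perm_unit (unip_unit _ _).
pose f (y : X * R) : X := frame (mulmx_unit (AU y) (rot_unit y.2)).
have fE y : chart_dom phi y.1 -> act (rot_unit y.2) y.1 = f y.
  move=> Vy; rewrite -{1}(sigmaK wP hr Vy) /sigma act_frame.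
  exact: frame_irr.
have fstc : {for z, continuous (fun y : X * R => y.1)} by exact: cvg_fst.
have fc : {for z, continuous f}.
  apply: (@mkframe_continuous _ _ _ _ (fun y => A y *m rot y.2)
    (fun y => mulmx_unit (AU y) (rot_unit y.2)) z).
  apply: cont_mulmx; last first.
    apply: (@continuous_comp _ _ _ (fun y : X * R => y.2) rot); first exact: cvg_snd.
    exact: rot_continuous.
  have h : {for z, continuous (fun y : X * R => unip phi (tau phi y.1))}.
    apply: (@continuous_comp _ _ _ (fun y : X * R => tau phi y.1) (unip phi)).
      apply: (@continuous_comp _ _ _ (fun y : X * R => y.1) (tau phi)) => //.
      exact: tau_continuous.
    exact: unip_continuous.
  apply: cvg_mx => j k.
  have -> : (fun y => A y j k) = fun y => unip phi (tau phi y.1) (word_perm wP j) k.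
    by apply/funext => y; rewrite mxE.
  exact: cont_entry.
rewrite /continuous_at fE //.
apply: cvg_trans fc; apply: near_eq_cvg.
have Vn : \forall y \near z, chart_dom phi y.1.
  by apply: fstc; apply: open_nbhs_nbhs; split => //; exact: chart_open.
by apply: filterS Vn => y Vy; rewrite fE.
Qed.

Lemma act_rot_continuous1 t : continuous (act (rot_unit t)).
Proof.
move=> F; apply: (@continuous_comp _ _ _ (fun F => (F, t)) (fun z : X * R => act (rot_unit z.2) z.1)).
  have h : {for F, continuous (fun _ : X => t)} by exact: cst_continuous.
  exact: (cvg_pair cvg_id h).
exact: act_rot_continuous.
Qed.

Lemma flip_continuous : continuous flip.
Proof. exact: act_rot_continuous1. Qed.

Lemma act_rot0 F : act (rot_unit 0) F = F.
Proof.
apply: flag_eq => i; apply/vspaceP => v; apply/idP/idP.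
  by move=> /mem_act[u uF ->]; rewrite rot0 mulmx1.
by move=> vF; apply/mem_act; exists v; rewrite // rot0 mulmx1.
Qed.

Lemma flip_id k (c : cochain R X int k) : coboundary c = 0 ->
  exists b : cochain R X int k.-1, pull flip c - c = cobpre b.
Proof.
move=> dc; pose H (F : X) t := act (rot_unit t) F.
have SS : hmap H set0 set0 by [].
have TT : hmap H (@all_space X) (@all_space X) by move=> U _; exists setT.
have c0 : vanish set0 c by move=> s [].
have := homotopy_bnd act_rot_continuous SS TT c0.
rewrite dc => /(_ (@vanish0 _ _ _ _)) [b _ /vanish_all/eqP]; rewrite subr_eq0 => /eqP h.
exists b; rewrite -h; congr (_ - _).
by apply/funext => s; rewrite pull_id_at // => t; exact: act_rot0.
Qed.

End Rotation.
End Action.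

(** * Parity of inversions *)

Section Parity.
Context {r : nat} (d : 'I_r -> nat).
Local Notation n := (flag_ambient d).
Local Notation N := (half_size d).
Local Notation word := (word d).

(** The determinant of the m-th flip on the normal coordinates of the cell: by [tau_flip], the
    coordinate p is scaled by the two signs of its positions. *)
Definition word_sign (phi : word) (m : 'I_N) : int :=
  \prod_(p <- inversions phi) (pair_sign m p.1 * pair_sign m p.2).

Lemma sum_pairs (G : 'I_n -> nat) :
  (\sum_k G k = \sum_(m < N) (G (pair_pos m false) + G (pair_pos m true)))%N.
Proof.
have half_lt (k : 'I_n) : (k./2 < N)%N.
  by have := ltn_ord k; rewrite {2}/flag_ambient -/(half_size d); lia.
rewrite (reindex (fun mb : 'I_N * bool => pair_pos mb.1 mb.2)) /=; last first.
  exists (fun k => (Ordinal (half_lt k), odd k)) => [[m b] _|k _].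
    by congr pair; [apply/val_inj => /=; case: b; lia|rewrite /=; case: b; lia].
  by apply/val_inj => /=; have := odd_double_half k; case: (odd k); lia.
rewrite -(pair_bigA _ (fun m b => G (pair_pos m b))) /=.
by apply: eq_bigr => m _; rewrite big_bool addnC.
Qed.

Lemma odd_sum_eq0 (I : finType) (P : pred I) (G : I -> nat) :
  (forall i, P i -> ~~ odd (G i)) -> odd (\sum_(i | P i) G i) = false.
Proof.
move=> GP; elim/big_rec: _ => // i x Pi xo.
by rewrite oddD xo (negPf (GP i Pi)).
Qed.

Definition below (phi : word) (c : nat) : nat := (\sum_(k < n) (phi k < c)%N)%N.

Lemma below_even (phi : word) (j : 'I_n) : wordP phi -> odd (below phi (phi j)) = false.
Proof.
move=> /forallP wP; rewrite /below.
case E : (phi j : nat) => [|c]; first by rewrite big1.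
have lt_c : (c < r)%N by have := ltn_ord (phi j); rewrite E; lia.
have /eqP := wP (Ordinal lt_c).
rewrite -sum1_card big_mkcond /= /flag_rank => h.
transitivity (odd (2 * \sum_(j0 < r | (j0 <= Ordinal lt_c)%N) d j0)); last first.
  by rewrite oddM.
by rewrite -h; congr odd; apply: eq_bigr => k _; rewrite inE /= ltnS; case: leqP.
Qed.

Definition inv_deg (phi : word) (x : 'I_n) : nat :=
  (\sum_(y < n) (((y < x) && (phi x < phi y)) + ((x < y) && (phi y < phi x))))%N.

(** An inversion contributes -1 exactly when one of its two positions lies in the pair. If both do,
    it is counted twice in the exponent. *)
Lemma word_signE (phi : word) m :
  word_sign phi m = (-1) ^+ (inv_deg phi (pair_pos m false) + inv_deg phi (pair_pos m true)).
Proof.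
pose mb (x : 'I_n) : nat := ((x == pair_pos m false) + (x == pair_pos m true))%N.
have pqF := pair_neq m.
have sE x : pair_sign m x = (-1) ^+ mb x.
  rewrite /pair_sign /mb; have [->|_] := eqVneq x (pair_pos m false).
    by rewrite pqF.
  by case: eqP.
have -> : word_sign phi m =
    (-1) ^+ (\sum_(p : 'I_n * 'I_n | inversion phi p) (mb p.1 + mb p.2))%N.
  rewrite /word_sign big_filter big_enum_cond /=.
  rewrite (big_morph (fun k : nat => (-1) ^+ k : int) (@exprD _ _) (expr0 _)).
  by apply: eq_big => // p _; rewrite !sE exprD.
congr (_ ^+ _).
have E x : inv_deg phi x = (\sum_y inversion phi (x, y) + \sum_y inversion phi (y, x))%N.
  by rewrite /inv_deg big_split.
have S1 (F : 'I_n -> nat) : (\sum_x mb x * F x = F (pair_pos m false) + F (pair_pos m true))%N.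
  rewrite (bigD1 (pair_pos m false)) //= (bigD1 (pair_pos m true)) /=; last first.
    by rewrite eq_sym pqF.
  rewrite big1 => [|x /andP[/negPf x1 /negPf x2]]; last by rewrite /mb x1 x2.
  have qpF : (pair_pos m true == pair_pos m false) = false by rewrite eq_sym.
  by rewrite /mb !eqxx pqF qpF; lia.
rewrite -S1 big_mkcond /= -(pair_bigA _ (fun x y => if inversion phi (x, y) then mb x + mb y else 0))%N /=.
have -> : (\sum_x mb x * inv_deg phi x = \sum_x \sum_y (mb x * inversion phi (x, y)) +
   \sum_x \sum_y (mb x * inversion phi (y, x)))%N.
  rewrite -big_split /=; apply: eq_bigr => x _.
  by rewrite E mulnDr !big_distrr.
rewrite [X in (_ + X)%N]exchange_big /= -big_split /=; apply: eq_bigr => x _.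
rewrite -big_split /=; apply: eq_bigr => y _.
by case: inversion; lia.
Qed.

Definition mixed (phi : word) m := phi (pair_pos m false) != phi (pair_pos m true).

(* The number of inversions with exactly one position in the first mixed pair
   is odd: letters before it come in equal pairs, and every letter occurs an
   even number of times. *)
Lemma first_mixed_sign (phi : word) m : wordP phi -> mixed phi m ->
  (forall m' : 'I_N, (m' < m)%N -> ~~ mixed phi m') -> word_sign phi m = -1.
Proof.
move=> wP mix first; rewrite word_signE -signr_odd.
set p := pair_pos m false; set q := pair_pos m true.
have bp := below_even p wP; have bq := below_even q wP.
(* The added numbers are even. A position y after the pair counts for [inv_deg phi p] exactly when
   phi y < phi p, so the [below] terms cancel it modulo 2; an earlier pair contributes twice the
   same number; the pair m leaves one of two strict comparisons. *)
suff : odd (inv_deg phi p + inv_deg phi q + below phi (phi p) + below phi (phi q)).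
  by rewrite oddD bq addbF oddD bp addbF => ->.
rewrite /inv_deg /below -!big_split sum_pairs (bigD1 m) //; cbv beta; rewrite oddD.
rewrite odd_sum_eq0 ?addbF.
  move: mix; rewrite /mixed -/p -/q -val_eqE /=.
  have pq : (p < q)%N by rewrite /=; lia.
  have qp : (q < p)%N = false by rewrite /=; lia.
  rewrite pq qp !ltnn /=; case: ltngtP => //= _ _.
move=> m' m'm; cbv beta.
have [lt|ge] := ltnP m' m.
  have /negbNE/eqP E := first m' lt.
  have h (b b' : bool) : (pair_pos m' b < pair_pos m b')%N by rewrite /=; case: b; case: b'; lia.
  have h' (b b' : bool) : (pair_pos m b' < pair_pos m' b)%N = false.
    by apply/negbTE; rewrite -leqNgt ltnW.
  by rewrite /p /q !h !h' E /= !addn0 addnn odd_double.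
have {}ge : (m < m')%N by rewrite ltn_neqAle ge eq_sym andbT; exact: m'm.
have h (b b' : bool) : (pair_pos m b' < pair_pos m' b)%N by rewrite /=; case: b; case: b'; lia.
have h' (b b' : bool) : (pair_pos m' b < pair_pos m b')%N = false.
  by apply/negbTE; rewrite -leqNgt ltnW.
rewrite /p /q !h !h' /= !add0n.
set a1 := (_ < _)%N; set a2 := (_ < phi (pair_pos m true))%N.
set a3 := (_ < phi (pair_pos m false))%N; set a4 := (phi (pair_pos m' true) < phi (pair_pos m true))%N.
by case: a1; case: a2; case: a3; case: a4.
Qed.

(** For fixed x, the inversions (x, y) come in twos as y runs over a pair: both positions carry the
    same letter and lie on the same side of x, unless x is the second of them, and then neither
    gives an inversion. *)
Lemma doubled_even (phi : word) : (forall m, ~~ mixed phi m) -> odd (inv_num phi) = false.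
Proof.
move=> dbl; rewrite /inv_num -sum1_size big_filter big_enum_cond /= big_mkcond /=.
rewrite -(pair_bigA _ (fun x y => if inversion phi (x, y) then 1 else 0))%N /=.
apply: odd_sum_eq0 => x _; rewrite sum_pairs; apply/negbT; apply: odd_sum_eq0 => m _.
have /negbNE/eqP E := dbl m; rewrite /inversion /= E.
have [xq|xq] := eqVneq x (pair_pos m true).
  by rewrite xq ltnn !andbF.
suff -> : (m.*2 + false < x)%N = (m.*2 + true < x)%N by case: ifP.
by move: xq; rewrite -val_eqE /=; lia.
Qed.

Lemma odd_bad_sign (phi : word) : wordP phi -> odd (inv_num phi) ->
  exists m, word_sign phi m = -1.
Proof.
move=> wP io; case: (pickP (mixed phi)) => [m0 mix0|none]; last first.
  by move: io; rewrite doubled_even // => m; rewrite none.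
case: (@arg_minnP _ m0 (mixed phi) (fun m : 'I_N => m : nat) mix0) => m mix mmin.
exists m; apply: first_mixed_sign => // m' lt; apply/negP => /mmin.
by rewrite leqNgt lt.
Qed.

Lemma word_sign1 (phi : word) m : word_sign phi m = 1 \/ word_sign phi m = -1.
Proof. by rewrite word_signE -signr_odd; case: odd; [right|left]. Qed.

End Parity.

(** * Detecting functionals and the Bockstein *)

Section DetectingFunctionals.
Context {V : zmodType} {I : finType} (rho : I -> V -> int).
Hypothesis rhoB : forall i x y, rho i (x - y) = rho i x - rho i y.
Hypothesis rho_ker : forall x, (forall i, rho i x = 0) -> x *+ 2 = 0.
Implicit Types (B : seq V) (G : set V).

HB.instance Definition _ i := GRing.isZmodMorphism.Build V int (rho i) (rhoB i).

Lemma torsion_rho x : torsion V x -> forall i, rho i x = 0.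
Proof.
move=> [m m0 xm] i; have := congr1 (rho i) xm; rewrite raddfMn raddf0.
by move/eqP; rewrite mulrn_eq0 eqn0Ngt m0 => /eqP.
Qed.

Lemma torsion_two x : torsion V x <-> x *+ 2 = 0.
Proof.
split; last by exists 2.
by move=> /torsion_rho h; exact: rho_ker.
Qed.

Definition lin_comb B (c : V -> int) : V := \sum_(b <- B) b *~ c b.

Lemma rho_lin i B c : rho i (lin_comb B c) = \sum_(b <- B) rho i b * c b.
Proof. by rewrite /lin_comb raddf_sum; apply: eq_bigr => b _; rewrite raddfMz mulrzz. Qed.

(** Hermite reduction over the list of functionals: a v in G at which [rho i] takes its least
    positive value is added to a basis for the kernel of [rho i] in G. The group itself need not be
    finitely generated. *)
Lemma echelon_basis (s : seq I) G : is_subgroup G -> exists B,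
  [/\ uniq B, forall b, b \in B -> G b,
    forall x, G x -> exists c, forall i, i \in s -> rho i (x - lin_comb B c) = 0 &
    forall c, (forall i, i \in s -> rho i (lin_comb B c) = 0) ->
      forall b, b \in B -> c b = 0].
Proof.
elim: s G => [|i s IH] G [G0 GB].
  by exists [::]; split => // x Gx; exists (fun=> 0).
pose G' := [set x | G x /\ rho i x = 0].
have G'sub : is_subgroup G'.
  split; first by split=> //; exact: raddf0.
  by move=> x y [Gx x0] [Gy y0]; split; [exact: GB|rewrite rhoB x0 y0 subr0].
have [B [uB BG Bspan Bind]] := IH _ G'sub.
have rB b : b \in B -> rho i b = 0 by move=> /BG[].
have rl c : rho i (lin_comb B c) = 0.
  by rewrite rho_lin big1_seq // => b /andP[_ /rB ->]; rewrite mul0r.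
have [all0|] := pselect (forall x, G x -> rho i x = 0).
  exists B; split => //.
  - by move=> b /BG[].
  - move=> x Gx; have [c cP] := Bspan x (conj Gx (all0 x Gx)).
    exists c => j; rewrite inE => /orP[/eqP ->|]; last exact: cP.
    by rewrite rhoB rl all0.
  - by move=> c h; apply: Bind => j js; apply: h; rewrite inE js orbT.
move=> /existsNP[x0 /not_implyP[Gx0 /eqP nz]].
have Gmul x k : G x -> G (x *~ k).
  move=> Gx; have GN y : G y -> G (- y) by move=> Gy; rewrite -sub0r; exact: GB.
  have Gn (m : nat) : G (x *+ m).
    by elim: m => [|m IHm]; rewrite ?mulr0n // mulrSr -[x in _ + x]opprK; apply: GB => //; exact: GN.
  by case: k => m; [exact: Gn|apply: GN; exact: Gn].
(* The shift [m.+1] encodes positivity; division with remainder shows that the least such value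
   generates the image of G under [rho i]. *)
pose P m := `[< exists2 x, G x & rho i x = m.+1%:Z >].
have exP : exists m, P m.
  exists (`|rho i x0|.-1)%N; apply/asboolP.
  have [ge|lt] := leP 0 (rho i x0).
    by exists x0 => //; lia.
  exists (x0 *~ (-1)); first exact: Gmul.
  by rewrite raddfMz /= mulrN1z; lia.
case: (ex_minnP exP) => g /asboolP[v Gv vg] gmin.
have dvd x : G x -> rho i x = g.+1%:Z * (rho i x %/ g.+1%:Z)%Z.
  move=> Gx; have E := divz_eq (rho i x) g.+1%:Z.
  suff m0 : (rho i x %% g.+1%:Z)%Z = 0 by rewrite {1}E m0 addr0 mulrC.
  apply: contrapT => /eqP m0.
  have mlt := ltz_pmod (rho i x) (isT : 0 < g.+1%:Z).
  have mge := modz_ge0 (rho i x) (isT : g.+1%:Z != 0).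
  have := gmin `|(rho i x %% g.+1%:Z)%Z|.-1%N.
  have -> : P `|(rho i x %% g.+1%:Z)%Z|.-1%N.
    apply/asboolP; exists (x - v *~ (rho i x %/ g.+1%:Z)%Z).
      by apply: GB => //; exact: Gmul.
    rewrite rhoB raddfMz /= vg mulrzz {1}E; lia.
  move=> /(_ isT); lia.
have vB : v \notin B by apply/negP => /rB; rewrite vg.
have combE c : lin_comb (v :: B) c = v *~ c v + lin_comb B c.
  by rewrite /lin_comb big_cons.
exists (v :: B); split.
- by rewrite cons_uniq vB.
- by move=> b; rewrite inE => /orP[/eqP ->|/BG[]].
- move=> x Gx; pose k := (rho i x %/ g.+1%:Z)%Z.
  have G'y : G' (x - v *~ k).
    split; first by apply: GB => //; exact: Gmul.
    by rewrite rhoB raddfMz /= vg mulrzz dvd // subrr.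
  have [c cP] := Bspan _ G'y.
  exists (fun b => if b == v then k else c b) => j js.
  have -> : x - lin_comb (v :: B) (fun b => if b == v then k else c b) = x - v *~ k - lin_comb B c.
    rewrite combE eqxx opprD addrA; congr (_ - _); apply: eq_big_seq => b bB.
    by case: eqP => // bv; rewrite bv (negPf vB) in bB.
  move: js; rewrite inE => /orP[/eqP ->|]; last exact: cP.
  by rewrite rhoB rl; case: G'y => _ ->.
- move=> c h.
  have cv : c v = 0.
    have := h i (mem_head _ _); rewrite combE raddfD /= rl addr0 raddfMz /= vg mulrzz.
    by move/eqP; rewrite mulf_eq0 => /orP[] // /eqP.
  move=> b; rewrite inE => /orP[/eqP ->//|]; apply: Bind => j js.
  by have := h j; rewrite inE js orbT combE cv mulr0z add0r; apply.
Qed.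

Lemma free_part_ex : exists F : set V, is_free_part F.
Proof.
have [|B [uB _ Bspan Bind]] := @echelon_basis (enum I) setT; first by [].
have lcB c e : lin_comb B c - lin_comb B e = lin_comb B (fun b => c b - e b).
  by rewrite /lin_comb -sumrB; apply: eq_bigr => b _; rewrite mulrzBr.
exists [set x | exists c, x = lin_comb B c]; split.
  exists [set` B]; split.
  - move=> b /= bB; exists (fun b' => if b' == b then 1 else 0).
    rewrite /lin_comb (bigD1_seq b) //= eqxx mulr1z big1 ?addr0 // => b' /negPf ->.
    exact: mulr0z.
  - move=> s c us sB sum0 b bs.
    pose c' b := if b \in s then c b else 0.
    have c'0 : lin_comb B c' = 0.
      rewrite -sum0 /lin_comb (bigID (mem s)) /= [X in _ + X]big1 ?addr0; last first.
        by move=> b' /negPf b's; rewrite /c' b's mulr0z.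
      rewrite -big_filter (perm_big s); last first.
        apply: uniq_perm => //; first exact: filter_uniq.
        by move=> b'; rewrite mem_filter; case b's : (b' \in s) => //; exact: sB.
      by apply: eq_big_seq => b' b's; rewrite /c' b's.
    have : c' b = 0.
      by apply: (Bind c') (sB b bs) => i _; rewrite c'0; exact: raddf0.
    by rewrite /c' bs.
  - by move=> x [c ->]; exists B, c; split.
split.
- split; first by exists (fun=> 0); rewrite /lin_comb big1 // => b _; exact: mulr0z.
  by move=> x y [c ->] [e ->]; exists (fun b => c b - e b); rewrite lcB.
- split; first by exists 1%N.
  by move=> x y /torsion_two x2 /torsion_two y2; apply/torsion_two; rewrite mulrnBl x2 y2 subrr.
- apply/seteqP; split=> [x [[c ->] tx]|x ->].
    have c0 := Bind c (fun i _ => torsion_rho tx i).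
    by rewrite /= /lin_comb big1_seq // => b /andP[_ bB]; rewrite c0 ?mulr0z.
  split; first by exists (fun=> 0); rewrite /lin_comb big1 // => b _; exact: mulr0z.
  by exists 1%N.
- move=> x; have [c cP] := Bspan x Logic.I.
  exists (lin_comb B c), (x - lin_comb B c); split; last by rewrite addrC subrK.
    by exists c.
  apply/torsion_two; apply: rho_ker => i; apply: cP; exact: mem_enum.
Qed.

End DetectingFunctionals.

(** * Exactness at the integral cohomology *)

Section BocksteinExactness.
Context {R : realType} {X : topologicalType}.

Lemma exact_cocycleP (A : zmodType) k (z : cocycle R X A k.+1) :
  cohomology_class z = 0 <-> exists b, cocycle_val z = coboundary b.
Proof.
split=> [/eqP|[b zb]].
  by rewrite cohomology_class_eq0 => /asboolP[b _ bz]; exists b.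
by apply/eqP; rewrite cohomology_class_eq0; apply/asboolP; exists b.
Qed.

Lemma class_repr (A : zmodType) k (x : cohomology R X A k) : cohomology_class (repr x) = x.
Proof. exact: reprK. Qed.

(** If 2x = 0, twice a representative is the coboundary of some b, and b modulo 2 is a cocycle with
    Bockstein x. In degree 0 exact cocycles are zero and doubling is injective on cochains, so x =
    0. *)
Lemma bockstein_exact k (x : cohomology R X int k) :
  bockstein_image R X k x <-> x *+ 2 = 0.
Proof.
case: k x => [|k] x /=.
  split=> [->|x2]; first exact: mul0rn.
  have : cohomology_class (repr x *+ 2) = 0 by rewrite raddfMn /= class_repr.
  move/eqP; rewrite cohomology_class_eq0 => /asboolP /= h.
  have r0 : cocycle_val (repr x) = 0.
    by apply: (@mulr2_cochain_inj R X 0); rewrite /= mul0rn -h mulr2n.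
  rewrite -[x]class_repr; apply/eqP; rewrite cohomology_class_eq0.
  by apply/asboolP.
split=> [[y _ <-]|x2].
  rewrite /bockstein -raddfMn /=; apply/exact_cocycleP.
  exists (lift2 (repr y)); rewrite mulr2n -(bockstein_cochainE (repr y)).
  by rewrite mulr2n.
have : cohomology_class (repr x *+ 2) = 0 by rewrite raddfMn /= class_repr.
move=> /exact_cocycleP[b]; rewrite mulr2n => zb; rewrite /= in zb.
have wP : reduce2 b \in cocycles (n := k).
  apply/asboolP; rewrite -reduce2_coboundary -zb raddfD /=.
  by apply/funext => s; exact: (addrr_pchar2 (pchar_Fp (isT : prime 2))).
exists (cohomology_class (Cocycle wP)) => //.
rewrite -[RHS]class_repr; apply: (bocksteinE (c := b)) => //.
Qed.

End BocksteinExactness.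

(** * Application to flag manifolds *)

Section FlagCohomology.
Context {R : realType} {r : nat} (d : 'I_r -> nat).
Local Notation X := (even_flag R r d).
Local Notation n := (flag_ambient d).
Local Notation N := (half_size d).
Local Notation I := (flag_index d).
Hypothesis hr : (0 < r)%N.

Local Notation a := (@index_inv r d).
Local Notation V := (@index_dom R r d).
Local Notation W i := (level_set a V (a i)).

Local Notation cochain k := (cochain R X int k).
Local Notation rel i := [set V i `&` W i].

Lemma flag_class_ex (i : I) k : exists th : cochain k,
  [/\ vanish (rel i) th, vanish [set V i] (coboundary th),
   (forall c, vanish (rel i) c -> vanish [set V i] (coboundary c) ->
      exists e, bnd [set V i] (rel i) (c - th *~ e)),
   (k = a i -> forall e, bnd [set V i] (rel i) (th *~ e) -> e = 0) &
   (k != a i -> bnd [set V i] (rel i) th) /\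
   (forall m : 'I_N, bnd [set V i] (rel i)
      (pull (flip hr m) th - th *~ word_sign (sval i) m))].
Proof.
pose phi := sval i; pose wP : wordP phi := valP i.
have uJ := inversions_uniq phi.
have sc : continuous (sigma (R := R) wP) by exact: sigma_continuous.
have sV x : V i (sigma wP x) by exact: sigma_dom.
have tc F : V i F -> {for F, continuous (tau (R := R) phi)}.
  by move=> VF; exact: (tau_continuous wP hr VF).
have sK F : V i F -> sigma wP (tau phi F) = F by exact: sigmaK.
have tK (x : 'M[R]_n) (p : 'I_n * 'I_n) : p \in inversions phi ->
    tau phi (sigma wP x) p.1 p.2 = x p.1 p.2.
  by rewrite mem_inversions => /andP[_ lt]; exact: tauK.
have VW (x : 'M[R]_n) : W i (sigma wP x) <->
    [set y : 'M[R]_n | exists2 p, p \in inversions phi & y p.1 p.2 != 0] x.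
  exact: index_level.
have [th [th1 th2 th3 th4 [th5 th6]]] :=
  @local_class R X n n (inversions phi) (V i) (W i) (sigma wP) (tau phi) uJ sc sV tc sK tK VW k.
exists th; split => //; split=> // m; apply: th6.
- move=> p _; rewrite /pair_sign; case: ifP => _; case: ifP => _; by [left|right].
- exact: flip_continuous.
- by move=> x; exact: flip_dom.
- by move=> x [j ji Vj]; exists j => //; exact: flip_dom.
- move=> x p; rewrite mem_inversions => /andP[_ lt]; exact: tau_flip.
Qed.

Definition flag_class i k : cochain k := projT1 (cid (flag_class_ex i k)).

Arguments flag_class : clear implicits.

Lemma flag_classP i k : let th := flag_class i k in
  [/\ vanish (rel i) th, vanish [set V i] (coboundary th),
   (forall c, vanish (rel i) c -> vanish [set V i] (coboundary c) ->
      exists e, bnd [set V i] (rel i) (c - th *~ e)),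
   (k = a i -> forall e, bnd [set V i] (rel i) (th *~ e) -> e = 0) &
   (k != a i -> bnd [set V i] (rel i) th) /\
   (forall m : 'I_N, bnd [set V i] (rel i)
      (pull (flip hr m) th - th *~ word_sign (sval i) m))].
Proof. by rewrite /flag_class; case: cid. Qed.

Lemma flag_detect k : exists rho : I -> cohomology R X int k -> int,
  (forall i x y, rho i (x - y) = rho i x - rho i y) /\
  (forall x, (forall i, rho i x = 0) -> x *+ 2 = 0).
Proof.
have VO i : open (V i) by exact: (chart_open (valP i)).
have c1 i q : vanish (rel i) (flag_class i q) by have [] := flag_classP i q.
have c2 i q : vanish [set V i] (coboundary (flag_class i q)) by have [] := flag_classP i q.
have c3 i q c : vanish (rel i) c -> vanish [set V i] (coboundary c) ->
  exists e, bnd [set V i] (rel i) (c - flag_class i q *~ e).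
  by have [_ _ h _ _] := flag_classP i q; exact: h.
have c4 i e : bnd [set V i] (rel i) (flag_class i (a i) *~ e) -> e = 0.
  by have [_ _ _ h _] := flag_classP i (a i); exact: h.
have c5 i q : q != a i -> bnd [set V i] (rel i) (flag_class i q).
  by have [_ _ _ _ [h _]] := flag_classP i q.
have c6 m i q : bnd [set V i] (rel i)
    (pull (flip hr m) (flag_class i q) - flag_class i q *~ word_sign (sval i) m).
  by have [_ _ _ _ [_ h]] := flag_classP i q.
have gV m i x : V i x -> V i (flip hr m x) by exact: flip_dom.
have obad i : odd (a i) -> exists m, word_sign (sval i) m = -1.
  by move=> ai; exact: (odd_bad_sign (valP i)).
have e1 (m : 'I_N) (i : I) : word_sign (sval i) m = 1 \/ word_sign (sval i) m = -1 by exact: word_sign1.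
have [rho [h1 h2]] := (@strata_detect R X I N a V flag_class (flip hr) (fun m i => word_sign (sval i) m)
  VO (index_sep hr) (index_cover hr) c1 c2 c3 c4 c5 (@flip_continuous _ _ _ hr)
  gV c6 (@flip_id _ _ _ hr) e1 obad k).
by exists rho.
Qed.

End FlagCohomology.

Lemma torsion_bockstein (R : realType) (X : topologicalType) k :
  (forall x : cohomology R X int k, torsion _ x <-> x *+ 2 = 0) ->
  torsion (cohomology R X int k) = bockstein_image R X k.
Proof.
move=> t2; apply/seteqP; split=> x; first by move=> /t2 /bockstein_exact.
by move=> /bockstein_exact /t2.
Qed.

Theorem theorem6p1 (R : realType) (r : nat) (d : 'I_r -> nat)
    (hr : (0 < r)%N) (hd : forall i, (0 < d i)%N) :
  let H := cohomology R (even_flag R r d) int in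
  (forall n (x : H n), torsion (H n) x -> x *+ 2 = 0) /\
  (exists Hfree : forall n, set (H n), forall n, is_free_part (Hfree n)) /\
  (forall Hfree : forall n, set (H n),
     (forall n, is_free_part (Hfree n)) ->
     forall n, is_direct_sum (Hfree n)
                 (bockstein_image R (even_flag R r d) n)).
Proof.
move=> H.
have t2 n (x : H n) : torsion (H n) x <-> x *+ 2 = 0.
  by have [rho [rhoB rho_ker]] := flag_detect d hr (R := R) n; exact: torsion_two rhoB rho_ker x.
have free n : exists F : set (H n), is_free_part F.
  by have [rho [rhoB rho_ker]] := flag_detect d hr (R := R) n; exact: free_part_ex rhoB rho_ker.
split; [|split].
- by move=> n x /t2.
- by exists (fun n => projT1 (cid (free n))) => n; case: cid.
- by move=> Hfree HP n; have [_] := HP n; rewrite (torsion_bockstein (t2 n)).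
Qed.
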